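(* Let $0<p\le1$ and let $X$ be a UMD Banach lattice. Then $$H_p^{\delta,s}(I,X)=H_p^{\delta,m}(I,X)=\mathring{H}_p^{\delta,m}(I,X)$$ (as subspaces of $\mathcal{M}(I,X)$, with equivalent quasi-norms).
   Context: A UMD Banach lattice is a Banach lattice that is a UMD (unconditional martingale differences) space: for some (equivalently, all) $q\in(1,\infty)$ there is a constant $\beta$ with $\|\sum_{n=0}^m\varepsilon_n(f_n-f_{n-1})\|_{L_q(\mu,X)}\le\beta\|f_m\|_{L_q(\mu,X)}$ for all $X$-valued martingales $(f_n)_{n=0}^\infty$, all scalars $|\varepsilon_n|\le1$ and all $m$, with $f_{-1}=0$. $I=[-1/2,1/2)$. $\Delta_n$ is the finite $\sigma$-algebra generated by the $2^n$ dyadic subintervals of $I$ of length $2^{-n}$. $\mathcal{M}(I,X)$ is the vector space of $X$-valued dyadic martingales: sequences $F=(f_n)_{n=0}^\infty$ of functions $f_n\colon I\to X$ that are $\Delta_n$-measurable with $\mathbb{E}(f_{n+1},\Delta_n)=f_n$ for all $n\in\mathbb{N}_0$. $H_p^{\delta,m}(I,X)$ is the space of $F\in\mathcal{M}(I,X)$ with $\|F\|_{H_p^{\delta,m}(I,X)}=\big\|\sup_n\|f_n\|_X\big\|_{L_p(I)}<\infty$. $L_1(I,X)$ is regarded as a subspace of $\mathcal{M}(I,X)$ via $f\mapsto(\mathbb{E}(f,\Delta_n))_{n=0}^\infty$, and $\mathring{H}_p^{\delta,m}(I,X)$ is the closure of $H_p^{\delta,m}(I,X)\cap L_1(I,X)$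 in $H_p^{\delta,m}(I,X)$. $H_p^{\delta,s}(I,X)$ is the space of $F\in\mathcal{M}(I,X)$ with $$\|F\|_{H_p^{\delta,s}(I,X)}=\sup_{m\in\mathbb{N}_0}\Big\|\Big(\sum_{n=0}^m|f_n-f_{n-1}|^2\Big)^{1/2}\Big\|_{L_p(I,X)}<\infty,\qquad f_{-1}=0,$$ where the square function is computed pointwise in $X$ with the lattice (Krivine) functional calculus. *)

(* Defs.v *)
From HB Require Import structures.
From mathcomp Require Import all_boot all_order all_algebra.
From mathcomp Require Import all_classical all_reals all_analysis.

Set Implicit Arguments.
Unset Strict Implicit.
Unset Printing Implicit Defensive.

Import Order.TTheory GRing.Theory Num.Theory.
Import numFieldNormedType.Exports.

Local Open Scope classical_set_scope.
Local Open Scope ring_scope.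

(** * Banach lattices *)

(* The order is carried by the mixin itself: MathComp's [Order.Lattice] cannot
   be joined with [CompleteNormedModule], because the existing structure
   [Num.RealDomain] already lies over both hierarchies. *)
HB.mixin Record isBanachLattice (R : realType) (X : Type)
    & CompleteNormedModule R X := {
  bl_le : X -> X -> Prop ;
  bl_join : X -> X -> X ;
  bl_meet : X -> X -> X ;
  bl_le_refl : forall x, bl_le x x ;
  bl_le_anti : forall x y, bl_le x y -> bl_le y x -> x = y ;
  bl_le_trans : forall x y z, bl_le x y -> bl_le y z -> bl_le x z ;
  bl_joinP : forall x y z, bl_le (bl_join x y) z <-> bl_le x z /\ bl_le y z ;
  bl_meetP : forall x y z, bl_le z (bl_meet x y) <-> bl_le z x /\ bl_le z y ;
  bl_leD2r : forall x y z, bl_le x y -> bl_le (x + z) (y + z) ;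
  bl_scale_ge0 : forall (a : R) x, 0 <= a -> bl_le 0 x -> bl_le 0 (a *: x) ;
  (* [bl_join x (- x)] is the lattice absolute value; [`|x|] is the norm *)
  bl_norm_mono : forall x y,
    bl_le (bl_join x (- x)) (bl_join y (- y)) -> `|x| <= `|y|
}.

#[short(type="banachLatticeType")]
HB.structure Definition BanachLattice (R : realType) :=
  { X of CompleteNormedModule R X & isBanachLattice R X }.

(** * Krivine functional calculus *)

Definition homogeneous_continuous (R : realType) (n : nat)
    (h : 'rV[R]_n -> R) : Prop :=
  continuous h /\
  forall (a : R) (t : 'rV[R]_n), 0 <= a -> h (a *: t) = a * h t.

(* [Phi] is the functional calculus of [x_0, ..., x_(n-1)]: a linear lattice
   homomorphism on the space of continuous positively homogeneous functions
   of [n] real variables, sending the [i]-th coordinate function to [x_i].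
   By Krivine's theorem it exists and is unique on that space; its values at
   other functions are irrelevant. *)
Definition is_krivine_calculus (R : realType) (X : banachLatticeType R)
    (n : nat) (x : 'I_n -> X) (Phi : ('rV[R]_n -> R) -> X) : Prop :=
  [/\ forall i : 'I_n, Phi (fun t => t ord0 i) = x i,
      forall (a : R) (g h : 'rV[R]_n -> R),
        homogeneous_continuous g -> homogeneous_continuous h ->
        Phi (fun t => a * g t + h t) = a *: Phi g + Phi h,
      forall g h : 'rV[R]_n -> R,
        homogeneous_continuous g -> homogeneous_continuous h ->
        Phi (fun t => Num.max (g t) (h t)) = bl_join (Phi g) (Phi h)
    & forall g h : 'rV[R]_n -> R,
        homogeneous_continuous g -> homogeneous_continuous h ->
        Phi (fun t => Num.min (g t) (h t)) = bl_meet (Phi g) (Phi h)].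

Definition krivine (R : realType) (X : banachLatticeType R) (n : nat)
    (x : 'I_n -> X) : ('rV[R]_n -> R) -> X :=
  xget (fun=> 0) [set Phi | is_krivine_calculus x Phi].

Definition lattice_l2 (R : realType) (X : banachLatticeType R) (n : nat)
    (x : 'I_n -> X) : X :=
  krivine x (fun t => Num.sqrt (\sum_(i < n) `|t ord0 i| ^+ 2)).

(** * Bochner integral and vector-valued martingales *)

(* Below, [D] is the underlying set, and a sigma-algebra on [D] is a set [G]
   of subsets of [D]. *)

Definition simple_on (R : realType) (X : normedModType R) (T : Type)
    (D : set T) (G : set (set T)) (s : T -> X) : Prop :=
  finite_set (s @` D) /\ forall v : X, G (D `&` s @^-1` [set v]).

Definition strongly_measurable (R : realType) (X : normedModType R)
    (T : Type) (D : set T) (G : set (set T)) (f : T -> X) : Prop :=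
  exists s : nat -> T -> X,
    (forall k, simple_on D G (s k)) /\
    (forall x, D x -> s k x @[k --> \oo] --> f x).

Definition bochner_integrable (R : realType) (X : normedModType R) d
    (T : measurableType d) (mu : {measure set T -> \bar R}) (D : set T)
    (G : set (set T)) (f : T -> X) : Prop :=
  strongly_measurable D G f /\ (\int[mu]_(x in D) `|f x|%:E < +oo)%E.

Definition simple_integral (R : realType) (X : normedModType R) d
    (T : measurableType d) (mu : {measure set T -> \bar R}) (D : set T)
    (s : T -> X) : X :=
  \sum_(v \in s @` D) fine (mu (D `&` s @^-1` [set v])) *: v.

Definition is_bochner_integral (R : realType) (X : normedModType R) d
    (T : measurableType d) (mu : {measure set T -> \bar R}) (D : set T)
    (f : T -> X) (v : X) : Prop :=
  exists s : nat -> T -> X,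
    [/\ forall k, simple_on D measurable (s k),
        (\int[mu]_(x in D) `|f x - s k x|%:E @[k --> \oo] --> 0)%E
      & simple_integral mu D (s k) @[k --> \oo] --> v].

Definition bochner_integral (R : realType) (X : normedModType R) d
    (T : measurableType d) (mu : {measure set T -> \bar R}) (D : set T)
    (f : T -> X) : X :=
  xget 0 [set v | is_bochner_integral mu D f v].

(* [g] is (a version of) the conditional expectation [E(f, G)] on [D]. *)
Definition is_cond_exp (R : realType) (X : normedModType R) d
    (T : measurableType d) (mu : {measure set T -> \bar R}) (D : set T)
    (G : set (set T)) (f g : T -> X) : Prop :=
  [/\ bochner_integrable mu D measurable f,
      bochner_integrable mu D G g
    & forall A, G A -> bochner_integral mu A g = bochner_integral mu A f].

Definition filtration d (T : measurableType d) (D : set T)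
    (G : nat -> set (set T)) : Prop :=
  [/\ forall n, sigma_algebra D (G n),
      forall n A, G n A -> measurable A /\ A `<=` D
    & forall n, G n `<=` G n.+1].

Definition martingale (R : realType) (X : normedModType R) d
    (T : measurableType d) (mu : {measure set T -> \bar R}) (D : set T)
    (G : nat -> set (set T)) (f : nat -> T -> X) : Prop :=
  (forall n, bochner_integrable mu D (G n) (f n)) /\
  (forall n, is_cond_exp mu D (G n) (f n.+1) (f n)).

(* [f_n - f_(n-1)], with [f_(-1) = 0]. *)
Definition mdiff (V : zmodType) (T : Type) (f : nat -> T -> V) (n : nat)
    (x : T) : V :=
  if n is k.+1 then f k.+1 x - f k x else f 0 x.

(** * UMD spaces *)

(* Martingales are taken over arbitrary probability spaces. *)
Definition UMD (R : realType) (X : completeNormedModType R) : Prop :=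
  exists q : R, 1 < q /\ exists beta : R,
    forall (d : measure_display) (T : measurableType d) (P : probability T R)
      (G : nat -> set (set T)) (f : nat -> T -> X),
      filtration setT G -> martingale P setT G f ->
      forall (eps : nat -> R) (m : nat), (forall n, `|eps n| <= 1) ->
      ('N[P]_q%:E[(fun x => `|(\sum_(n < m.+1) eps n *: mdiff f n x)%R|%:E)]
        <= beta%:E * 'N[P]_q%:E[(fun x => `|f m x|%:E)])%E.

(** * Dyadic martingales and Hardy spaces on [-1/2, 1/2) *)

Definition unitI (R : realType) : set (measurableTypeR R) :=
  (`[- 2^-1, 2^-1[%classic : set R).
Arguments unitI R : clear implicits.

Lemma measurable_unitI (R : realType) : measurable (unitI R).
Proof. exact: (@measurable_itv R). Qed.
Arguments measurable_unitI R : clear implicits.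

Definition leb (R : realType) : {measure set (measurableTypeR R) -> \bar R} :=
  lebesgue_measure.
Arguments leb R : clear implicits.

Definition lebI (R : realType) : {measure set (measurableTypeR R) -> \bar R} :=
  mrestr (leb R) (measurable_unitI R).

Definition dyadic_interval (R : realType) (n k : nat) :
    set (measurableTypeR R) :=
  (`[- 2^-1 + k%:R / 2 ^+ n, - 2^-1 + k.+1%:R / 2 ^+ n[%classic : set R).
Arguments dyadic_interval R n k : clear implicits.

Definition Delta (R : realType) (n : nat) : set (set (measurableTypeR R)) :=
  <<s unitI R, [set J | exists2 k, (k < 2 ^ n)%N & J = dyadic_interval R n k] >>.
Arguments Delta R n : clear implicits.

Section Hardy.
Context {R : realType}.

(* A function on [I] is encoded as a function on the real line that vanishes
   off [I], so that equality of sequences is equality on [I]. *)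
Definition dyadic_martingale (X : normedModType R)
    (F : nat -> measurableTypeR R -> X) : Prop :=
  (forall n x, ~ unitI R x -> F n x = 0) /\
  martingale (leb R) (unitI R) (Delta R) F.

(* [H_p^{delta,m}(I, X)] *)
Definition Hm_norm (X : normedModType R) (p : R)
    (F : nat -> measurableTypeR R -> X) : \bar R :=
  'N[lebI R]_p%:E[(fun x => ereal_sup (range (fun n => `|F n x|%:E)))].

Definition Hm (X : normedModType R) (p : R) :
    set (nat -> measurableTypeR R -> X) :=
  [set F | dyadic_martingale F /\ (Hm_norm p F < +oo)%E].

Definition L1_martingale (X : normedModType R) :
    set (nat -> measurableTypeR R -> X) :=
  [set F | dyadic_martingale F /\
     exists f : measurableTypeR R -> X,
       forall n, is_cond_exp (leb R) (unitI R) (Delta R n) f (F n)].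

(* Closure in [Hm p] of its intersection with [L_1(I, X)]. *)
Definition Hm0 (X : normedModType R) (p : R) :
    set (nat -> measurableTypeR R -> X) :=
  [set F | Hm p F /\
     forall e : R, 0 < e -> exists2 H, (Hm p `&` @L1_martingale X) H &
       (Hm_norm p (fun n x => (F n x - H n x)%R) < e%:E)%E].

(* [H_p^{delta,s}(I, X)] *)
Definition square_function (X : banachLatticeType R)
    (F : nat -> measurableTypeR R -> X) (m : nat) (x : measurableTypeR R) : X :=
  lattice_l2 (fun n : 'I_m.+1 => mdiff F n x).

Definition Hs_norm (X : banachLatticeType R) (p : R)
    (F : nat -> measurableTypeR R -> X) : \bar R :=
  ereal_sup (range (fun m =>
    'N[lebI R]_p%:E[(fun x => `|square_function F m x|%:E)]%E)).

Definition Hs (X : banachLatticeType R) (p : R) :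
    set (nat -> measurableTypeR R -> X) :=
  [set F | dyadic_martingale F /\ (Hs_norm p F < +oo)%E].

Definition equivalent_quasinorms (X : normedModType R)
    (S : set (nat -> measurableTypeR R -> X))
    (N1 N2 : (nat -> measurableTypeR R -> X) -> \bar R) : Prop :=
  exists c C : R, [/\ 0 < c, 0 < C &
    forall F, S F -> (c%:E * N1 F <= N2 F)%E /\ (N2 F <= C%:E * N1 F)%E].

End Hardy.

(* Main.v *)
(** Up to the first [m] generations a dyadic martingale is a martingale on the
    sign cube [{-1, 1}^m], and the [m]-th square function is compared with the
    random norm [rq] = [E `|\sum_n r_n d_n|^q], [r_n] independent signs and
    [q > 1] the exponent of the UMD inequality.

    The norm of the square function and the random norm are equivalent pointwise:
    one inequality is Khintchine's, applied inside the Krivine calculus; the other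
    truncates the Rademacher sums in the lattice and uses that a UMD space is
    K-convex.

    The random norm and the martingale are equivalent in the mean of order [q] by
    UMD.  Since [rq] of the first [n] differences is predictable, and the maximal
    function becomes predictable once the value at the sibling interval is added,
    stopping either of them at level [l] turns this into a distributional
    inequality, which integrates to the exponents [p <= 1].

    Finally the stopped martingales [F (minn n N)] lie in [L_1] and converge to
    [F]: if [rq] stays bounded at a point, K-convexity forces its tails to vanish,
    and dominated convergence applies. *)

Require Import Defs.
From HB Require Import structures.
From mathcomp Require Import all_boot all_order all_algebra finmap.
From mathcomp Require Import all_classical all_reals all_analysis.
From mathcomp Require Import measurable_realfun.
From mathcomp Require Import lra ring zify.

Set Implicit Arguments.
Unset Strict Implicit.
Unset Printing Implicit Defensive.

Import Order.TTheory GRing.Theory Num.Theory.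
Import numFieldNormedType.Exports.

Local Open Scope classical_set_scope.
Local Open Scope ring_scope.

(** * Krivine functional calculus *)

(** For [p < 1] neither duality nor convexity of the norm is at hand, and UMD speaks of an exponent
    [q > 1] only. Comparisons are therefore made in [q]-th moments of genuine martingales, and
    stopping carries them down to [p]. A stopping rule that looks at the difference it is about to
    admit would destroy the martingale property, and one that does not may overshoot the level;
    hence the insistence on predictable quantities. The [krivine] calculus is a choice from a set of
    maps, so nothing is known about the square function until this set is shown to be nonempty for
    every tuple. Density of [L_1] needs more than boundedness: in [c_0] the unit vectors have
    bounded Rademacher sums whose tails do not vanish. K-convexity excludes this, because sign
    functions on a large cube have large Rademacher projections. Estimates concern finitely many
    generations, with constants independent of their number, so that suprema can be taken at the
    end. *)

Section BanachLatticeTheory.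
Context {R : realType} {X : banachLatticeType R}.
Implicit Types x y z : X.
Local Notation "x <=_L y" := (bl_le x y) (at level 70).
Local Notation J := bl_join.

Definition labs x := J x (- x).

Lemma bl_leDr x y z : x + z <=_L y + z <-> x <=_L y.
Proof.
split=> [h|]; last exact: bl_leD2r.
by have := bl_leD2r _ _ (- z) h; rewrite !addrK.
Qed.

Lemma bl_leDl x y z : z + x <=_L z + y <-> x <=_L y.
Proof. by rewrite ![z + _]addrC; exact: bl_leDr. Qed.

Lemma bl_leD x y z t : x <=_L y -> z <=_L t -> x + z <=_L y + t.
Proof.
move=> xy zt; apply: (bl_le_trans _ (y + z)); first exact: bl_leD2r.
by apply/bl_leDl.
Qed.

Lemma bl_subr_ge0 x y : 0 <=_L y - x <-> x <=_L y.
Proof. by rewrite -(bl_leDr 0 (y - x) x) add0r subrK. Qed.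

Lemma bl_leN x y : - x <=_L - y <-> y <=_L x.
Proof. by rewrite -[X in X <-> _]bl_subr_ge0 -[X in _ <-> X]bl_subr_ge0 opprK addrC. Qed.

Lemma bl_leZ (a : R) x y : 0 <= a -> x <=_L y -> a *: x <=_L a *: y.
Proof.
move=> a0 /bl_subr_ge0 xy; apply/bl_subr_ge0.
by rewrite -scalerBr; exact: bl_scale_ge0.
Qed.

Lemma bl_le_sum (I : Type) (s : seq I) (P : pred I) (f g : I -> X) :
  (forall i, P i -> f i <=_L g i) ->
  \sum_(i <- s | P i) f i <=_L \sum_(i <- s | P i) g i.
Proof.
move=> fg; elim/big_ind2 : _ => //; first exact: bl_le_refl.
by move=> *; exact: bl_leD.
Qed.

Lemma bl_joinl x y : x <=_L J x y.
Proof. by have /bl_joinP[] := bl_le_refl (J x y). Qed.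

Lemma bl_joinr x y : y <=_L J x y.
Proof. by have /bl_joinP[] := bl_le_refl (J x y). Qed.

Lemma bl_meetl x y : bl_meet x y <=_L x.
Proof. by have /bl_meetP[] := bl_le_refl (bl_meet x y). Qed.

Lemma bl_meetr x y : bl_meet x y <=_L y.
Proof. by have /bl_meetP[] := bl_le_refl (bl_meet x y). Qed.

Lemma bl_joinD x y z : J (x + z) (y + z) = J x y + z.
Proof.
apply: bl_le_anti.
  by apply/bl_joinP; split; apply/bl_leDr; [exact: bl_joinl|exact: bl_joinr].
rewrite -(subrK z (J (x + z) _)); apply/bl_leDr/bl_joinP; split.
- by rewrite -[x in bl_le x](addrK z); apply/bl_leDr/bl_joinl.
- by rewrite -[y in bl_le y](addrK z); apply/bl_leDr/bl_joinr.
Qed.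

Lemma bl_meetE x y : bl_meet x y = - J (- x) (- y).
Proof.
apply: bl_le_anti.
- rewrite -bl_leN opprK; apply/bl_joinP.
  by split; apply/bl_leN; [exact: bl_meetl|exact: bl_meetr].
- by apply/bl_meetP; split; rewrite -bl_leN opprK; [exact: bl_joinl|exact: bl_joinr].
Qed.

Lemma labs_le x y : labs x <=_L y <-> x <=_L y /\ - x <=_L y.
Proof. exact: bl_joinP. Qed.

Lemma labs_ge0 x : 0 <=_L labs x.
Proof.
have h : 0 <=_L labs x + labs x.
  by rewrite -(subrr x); apply: bl_leD; [exact: bl_joinl|exact: bl_joinr].
have h2 : 0 <= (2^-1 : R) by rewrite invr_ge0.
have := bl_scale_ge0 _ _ h2 h.
have -> : labs x + labs x = 2 *: labs x by rewrite scaler_nat mulr2n.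
by rewrite scalerA mulVf// scale1r.
Qed.

Lemma labs_id x : 0 <=_L x -> labs x = x.
Proof.
move=> x0; apply: bl_le_anti; last exact: bl_joinl.
apply/labs_le; split; first exact: bl_le_refl.
by apply: (bl_le_trans _ 0) => //; rewrite -[0]oppr0; apply/bl_leN.
Qed.

Lemma bl_norm_le x y : 0 <=_L y -> x <=_L y -> - x <=_L y -> `|x| <= `|y|.
Proof.
move=> y0 xy nxy; apply: bl_norm_mono.
by rewrite -!/(labs _) (labs_id y0); apply/labs_le.
Qed.

Lemma norm_labs x : `|labs x| = `|x|.
Proof.
by apply/eqP; rewrite eq_le; apply/andP; split; apply: bl_norm_mono;
  rewrite -!/(labs _) (labs_id (labs_ge0 x)); exact: bl_le_refl.
Qed.

(** The estimate already holds in the lattice order, with [labs] in place of the norm. It lets joins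
    pass to norm limits in [kr_max]. *)
Lemma bl_norm_join x y z t : `|J x y - J z t| <= `|x - z| + `|y - t|.
Proof.
rewrite -(norm_labs (x - z)) -(norm_labs (y - t)).
apply: le_trans (ler_normD _ _).
have key a b c d : J a b - J c d <=_L labs (a - c) + labs (b - d).
  rewrite -(bl_leDr _ _ (J c d)) subrK; apply/bl_joinP; split.
  - rewrite -[a in bl_le a](subrK c); apply: bl_leD; last exact: bl_joinl.
    rewrite -[X in bl_le X]addr0; apply: bl_leD; first exact: bl_joinl.
    exact: labs_ge0.
  - rewrite -[b in bl_le b](subrK d); apply: bl_leD; last exact: bl_joinr.
    rewrite -[X in bl_le X]add0r; apply: bl_leD; last exact: bl_joinl.
    exact: labs_ge0.
have labsC a b : labs (a - b) = labs (b - a).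
  by rewrite -(opprB b a); apply: bl_le_anti; apply/bl_joinP; rewrite /labs opprK;
     split; (exact: bl_joinl || exact: bl_joinr).
apply: bl_norm_le; last 2 first.
- exact: key.
- by rewrite opprB labsC (labsC y); exact: key.
- by rewrite -[0]addr0; apply: bl_leD; exact: labs_ge0.
Qed.

End BanachLatticeTheory.

(** * Gordan's alternative for finite families of linear forms *)

Lemma small_step (R : realType) (T : eqType) (L : seq T) (u v : T -> R) :
  {in L, forall b, 0 < u b} ->
  exists2 e : R, 0 < e & {in L, forall b, e * v b < u b}.
Proof.
elim: L => [|b L ih] h; first by exists 1.
have [|e e0 he] := ih; first by move=> c cL; apply: h; rewrite in_cons cL orbT.
have hb : 0 < u b by apply: h; rewrite mem_head.
pose e' := Num.min e (u b / (2 * (`|v b| + 1))).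
have e'0 : 0 < e' by rewrite lt_min e0 divr_gt0// mulr_gt0// ltr_wpDl.
have key c : e' * v c <= e' * `|v c| by rewrite ler_pM2l// ler_norm.
exists e' => // c; rewrite in_cons => /predU1P[->|cL].
- apply: le_lt_trans (key _) _.
  apply: (@le_lt_trans _ _ (u b / (2 * (`|v b| + 1)) * `|v b|)).
    by rewrite ler_wpM2r// ge_min lexx orbT.
  rewrite mulrAC ltr_pdivrMr; last by rewrite mulr_gt0// ltr_wpDl.
  have := normr_ge0 (v b); nra.
- have [v0|v0] := ltP (v c) 0.
    apply: (@lt_trans _ _ 0); first by rewrite pmulr_rlt0.
    by apply: h; rewrite in_cons cL orbT.
  apply: le_lt_trans (he c cL).
  by rewrite ler_wpM2r// ge_min lexx.
Qed.

Section Gordan.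
Context {R : realType} {n : nat}.
Implicit Types (a b t : 'rV[R]_n) (L : seq 'rV[R]_n).

Definition dot a t : R := \sum_(i < n) a ord0 i * t ord0 i.

Lemma dotDl a b t : dot (a + b) t = dot a t + dot b t.
Proof.
by rewrite /dot -big_split; apply: eq_bigr => i _; rewrite mxE mulrDl.
Qed.

Lemma dotZl (c : R) a t : dot (c *: a) t = c * dot a t.
Proof. by rewrite /dot mulr_sumr; apply: eq_bigr => i _; rewrite mxE mulrA. Qed.

Lemma dotC a t : dot a t = dot t a.
Proof. by apply: eq_bigr => i _; rewrite mulrC. Qed.

Lemma dotDr a t u : dot a (t + u) = dot a t + dot a u.
Proof. by rewrite dotC dotDl !(dotC a). Qed.

Lemma dotZr (c : R) a t : dot a (c *: t) = c * dot a t.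
Proof. by rewrite dotC dotZl (dotC a). Qed.

Lemma dotBl a b t : dot (a - b) t = dot a t - dot b t.
Proof. by rewrite dotDl -scaleN1r dotZl mulN1r. Qed.

Lemma dot0l t : dot 0 t = 0.
Proof. by rewrite -(scale0r 0) dotZl mul0r. Qed.

Lemma dot_gt0 a : a != 0 -> 0 < dot a a.
Proof.
move=> a0; rewrite lt0r; apply/andP; split; last first.
  by apply: sumr_ge0 => i _; rewrite -expr2 sqr_ge0.
apply: contra a0 => /eqP h; apply/eqP/rowP => i; rewrite mxE.
have a2 j : true -> 0 <= a ord0 j * a ord0 j by rewrite -expr2 sqr_ge0.
have /eqP : a ord0 i * a ord0 i = 0 := psumr_eq0P a2 h isT.
by rewrite mulf_eq0 orbb => /eqP.
Qed.

(** Positive combinations with at least one term: with the empty combination excluded, [cone L 0] is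
    a nontrivial relation. *)
Inductive cone L : 'rV[R]_n -> Prop :=
| cone_base a : a \in L -> cone L a
| cone_add a b : cone L a -> cone L b -> cone L (a + b)
| cone_scale (c : R) a : 0 < c -> cone L a -> cone L (c *: a).

Lemma cone_trans L L' a : {in L, forall b, cone L' b} -> cone L a -> cone L' a.
Proof.
move=> LL'; elim=> [b /LL'//|b c _ ? _ ?|c b c0 _ ?]; first exact: cone_add.
exact: cone_scale.
Qed.

(** Elimination of one vector at a time. The induction covers all lists of bounded length because
    the second appeal is to the projected list, not to the tail itself. *)
Lemma gordan L :
  (exists t, {in L, forall a, 0 < dot a t}) \/ cone L 0.
Proof.
have [k] := ubnP (size L); elim: k L => // k ih [_|a L]; first by left; exists 0.
rewrite /= ltnS => sL.
have sub b : cone L b -> cone (a :: L) b.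
  by apply: cone_trans => c cL; apply: cone_base; rewrite in_cons cL orbT.
have aL : cone (a :: L) a by apply: cone_base; rewrite mem_head.
have [[t ht]|c0] := ih L sL; last by right; exact: sub.
have {t ht} [[t at0 ht]|] : (exists2 t, dot a t < 0 & {in L, forall b, 0 < dot b t})
   \/ ((exists t, {in a :: L, forall a, 0 < dot a t}) \/ cone (a :: L) 0); last by [].
  have [at0|at0|at0] := ltgtP (dot a t) 0; first by left; exists t.
    by right; left; exists t => b; rewrite in_cons => /predU1P[->//|/ht].
  have [a0|a0] := eqVneq a 0; first by right; right; rewrite -a0.
  (* A vector [a] orthogonal to [t] is brought to the negative side by a step along [- a], so small
     that the strict inequalities on [L] persist. *)
  have [e e0 he] := small_step (fun b => dot b a) ht.
  left; exists (t - e *: a).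
    by rewrite -scaleNr dotDr at0 add0r dotZr mulNr oppr_lt0 mulr_gt0// dot_gt0.
  by move=> b bL; rewrite -scaleNr dotDr dotZr mulNr subr_gt0 he.
(* Adding a positive multiple of [a] moves each [b] into the hyperplane orthogonal to [t]. A
   relation among the [f b] is one among [a :: L]; a solution [u] for the [f b] is corrected along
   [t], which they do not see, until its product with [a] is small and positive. *)
pose f b := b + (dot b t / - dot a t) *: a.
have f0 b : dot (f b) t = 0.
  by rewrite dotDl dotZl invrN mulrN mulNr divfK ?subrr// lt_eqF.
have [[u hu]|c0] := ih (map f L) ltac:(by rewrite size_map).
- have hu' : {in L, forall b, 0 < dot (f b) u}.
    by move=> b bL; apply: hu; exact: map_f.
  have [e e0 he] := small_step (fun b => dot b t / - dot a t) hu'.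
  left; exists (u + ((e - dot a u) / dot a t) *: t).
  have ha : dot a (u + ((e - dot a u) / dot a t) *: t) = e.
    by rewrite dotDr dotZr divfK ?lt_eqF// addrC subrK.
  move=> b; rewrite in_cons => /predU1P[->|bL]; first by rewrite ha.
  have -> : b = f b - (dot b t / - dot a t) *: a by rewrite addrK.
  rewrite dotBl dotZl ha dotDr dotZr f0 mulr0 addr0 subr_gt0.
  by rewrite mulrC; exact: he.
- right; apply: cone_trans c0 => _ /mapP[b bL ->].
  apply: cone_add; first by apply: sub; exact: cone_base.
  by apply: cone_scale => //; rewrite divr_gt0 ?oppr_gt0//; exact: ht.
Qed.

End Gordan.

Section Krivine.
Context {R : realType} {X : banachLatticeType R} {n : nat} (x : 'I_n -> X).
Local Notation "u <=_L v" := (bl_le u v) (at level 70).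
Implicit Types (a b t : 'rV[R]_n) (P Q : seq 'rV[R]_n) (g h : 'rV[R]_n -> R)
  (u v w : X).

Definition lin a : X := \sum_(i < n) a ord0 i *: x i.

Lemma linD a b : lin (a + b) = lin a + lin b.
Proof.
by rewrite /lin -big_split; apply: eq_bigr => i _; rewrite mxE scalerDl.
Qed.

Lemma linZ (c : R) a : lin (c *: a) = c *: lin a.
Proof. by rewrite /lin scaler_sumr; apply: eq_bigr => i _; rewrite mxE scalerA. Qed.

Lemma linB a b : lin (a - b) = lin a - lin b.
Proof. by rewrite linD -scaleN1r linZ scaleN1r. Qed.

Lemma lin0 : lin 0 = 0.
Proof. by rewrite -(scale0r 0) linZ scale0r. Qed.

(* An inequality [b <= max a] between linear forms is witnessed, through
   Gordan's alternative, by a convex combination of the [a]'s equal to [b];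
   it therefore transfers to every ordered vector space. *)
Lemma lin_max_le P b v :
  (forall t, exists2 a, a \in P & dot b t <= dot a t) ->
  {in P, forall a, lin a <=_L v} -> lin b <=_L v.
Proof.
move=> bP Pv.
have [[t ht]|] := gordan (map (fun a => b - a) P).
  have [a aP] := bP t; rewrite leNgt => /negP[].
  by rewrite -subr_gt0 -dotBl; apply: ht; exact: map_f.
have key (w : 'rV[R]_n) : cone (map (fun a => b - a) P) w ->
    exists2 c : R, 0 < c & c *: (lin b - v) <=_L lin w.
  elim=> [_ /mapP[a aP ->]|c d _ [e e0 he] _ [f f0 hf]|e c e0 _ [f f0 hf]].
  - exists 1 => //; rewrite scale1r linB; apply/bl_leDl.
    by apply/bl_leN; exact: Pv.
  - by exists (e + f); rewrite ?addr_gt0// scalerDl linD; exact: bl_leD.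
  - exists (e * f); first exact: mulr_gt0.
    by rewrite -scalerA linZ; apply: bl_leZ => //; exact: ltW.
move=> /key[c c0]; rewrite lin0 => hc; apply/(bl_leDr _ _ (- v)).
rewrite subrr.
have := bl_leZ (ltW (_ : 0 < c^-1)) hc; rewrite scaler0 scalerA mulVf ?gt_eqF//.
by rewrite scale1r; apply; rewrite invr_gt0.
Qed.

(* [h] is a finite maximum of linear forms, and [v] the corresponding supremum
   in [X]; [dcl] closes these pairs under differences. *)
Definition sublin h v := exists P,
  (forall t, (exists2 a, a \in P & h t = dot a t) /\
             {in P, forall a, dot a t <= h t}) /\
  forall w, v <=_L w <-> {in P, forall a, lin a <=_L w}.

Lemma sublin_lin a : sublin (dot a) (lin a).
Proof.
exists [:: a]; split=> [t|w].
  by split=> [|b]; [exists a; rewrite ?mem_head|rewrite inE => /eqP ->].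
by split=> [aw b|]; [rewrite inE => /eqP ->|apply; rewrite mem_head].
Qed.

(** Applied in both directions it shows that the element of [X] depends on the function only, not on
    the list that represents it. *)
Lemma sublin_mono g v h w : sublin g v -> sublin h w ->
  (forall t, g t <= h t) -> v <=_L w.
Proof.
move=> [P [gP vP]] [Q [hQ wQ]] gh; apply/vP => a aP.
apply: (@lin_max_le Q).
  move=> t; have [[b bQ hb] _] := hQ t; exists b => //; rewrite -hb.
  by apply: le_trans (gh t); have [_] := gP t; apply.
by apply/wQ; exact: bl_le_refl.
Qed.

Lemma sublinD g v h w : sublin g v -> sublin h w ->
  sublin (fun t => g t + h t) (v + w).
Proof.
move=> [P [gP vP]] [Q [hQ wQ]]; exists [seq a + b | a <- P, b <- Q]; split=> [t|z].
  have [[a aP ga] Pg] := gP t; have [[b bQ hb] Qh] := hQ t; split.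
    by exists (a + b); rewrite ?dotDl ?ga ?hb//; exact: allpairs_f.
  move=> _ /allpairsP[[c d]/= [cP dQ ->]].
  by rewrite dotDl lerD// ?Pg// Qh.
split=> [vwz _ /allpairsP[[c d]/= [cP dQ ->]]|h1].
  rewrite linD; apply: bl_le_trans vwz; apply: bl_leD.
    exact: (vP v).1 (bl_le_refl v) _ _.
  exact: (wQ w).1 (bl_le_refl w) _ _.
rewrite -(subrK w z); apply/bl_leDr/vP => a aP; rewrite -(bl_leDr _ _ w) subrK.
rewrite -(subrK (lin a) z) addrC; apply/bl_leDr/wQ => b bQ.
by rewrite -(bl_leDr _ _ (lin a)) subrK addrC -linD; apply: h1; exact: allpairs_f.
Qed.

Lemma sublinZ (c : R) h v : 0 < c -> sublin h v ->
  sublin (fun t => c * h t) (c *: v).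
Proof.
move=> c0 [P [hP vP]]; exists (map ( *:%R c) P); split=> [t|w].
  have [[a aP ha] Ph] := hP t; split.
    by exists (c *: a); rewrite ?map_f// dotZl ha.
  by move=> _ /mapP[b bP ->]; rewrite dotZl ler_wpM2l ?(ltW c0)// Ph.
have cV : 0 < c^-1 by rewrite invr_gt0.
split=> [vw _ /mapP[b bP ->]|h1].
  rewrite linZ; apply: bl_le_trans vw; apply: bl_leZ; first exact: ltW.
  exact: (vP v).1 (bl_le_refl v) _ _.
rewrite -(scale1r w) -(mulfV (lt0r_neq0 c0)) -scalerA; apply: bl_leZ.
  exact: ltW.
apply/vP => a aP; rewrite -(scale1r (lin a)) -(mulVf (lt0r_neq0 c0)) -scalerA.
by apply: bl_leZ; [exact: ltW|rewrite -linZ; apply: h1; exact: map_f].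
Qed.

Lemma sublin_max g v h w : sublin g v -> sublin h w ->
  sublin (fun t => Num.max (g t) (h t)) (bl_join v w).
Proof.
move=> [P [gP vP]] [Q [hQ wQ]]; exists (P ++ Q); split=> [t|z].
  have [[a aP ga] Pg] := gP t; have [[b bQ hb] Qh] := hQ t; split.
    have [gh|gh] := leP (g t) (h t).
      by exists b; rewrite ?hb// mem_cat bQ orbT.
    by exists a; rewrite ?ga// mem_cat aP.
  by move=> c; rewrite mem_cat le_max => /orP[/Pg->|/Qh->]; rewrite ?orbT.
rewrite bl_joinP vP wQ; split=> [[h1 h2] a|h1].
  by rewrite mem_cat => /orP[/h1|/h2].
by split=> a aP; apply: h1; rewrite mem_cat aP ?orbT.
Qed.

Definition dcl h v := exists g1 v1 g2 v2, [/\ sublin g1 v1, sublin g2 v2,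
  (forall t, h t = g1 t - g2 t) & v = v1 - v2].

Lemma dcl_sublin h v : sublin h v -> dcl h v.
Proof.
move=> hv; exists h, v, (dot 0), (lin 0); split => //; first exact: sublin_lin.
  by move=> t; rewrite dot0l subr0.
by rewrite lin0 subr0.
Qed.

(** Moving the subtracted parts to the other side leaves an inequality between sublinear
    functions. *)
Lemma dcl_mono g v h w : dcl g v -> dcl h w -> (forall t, g t <= h t) -> v <=_L w.
Proof.
move=> [g1 [v1 [g2 [v2 [s1 s2 gE ->]]]]] [h1 [w1 [h2 [w2 [r1 r2 hE ->]]]]] gh.
have -> : v1 - v2 = (v1 + w2) - (v2 + w2) by rewrite opprD addrACA subrr addr0.
have -> : w1 - w2 = (w1 + v2) - (v2 + w2).
  by rewrite [v2 + w2]addrC opprD addrACA subrr addr0.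
apply/bl_leDr; apply: sublin_mono (sublinD s1 r2) (sublinD r1 s2) _ => t.
by have := gh t; rewrite gE hE; lra.
Qed.

Lemma eq_dcl g h v : (forall t, g t = h t) -> dcl g v -> dcl h v.
Proof. by move=> /funext->. Qed.

Lemma dclD g v h w : dcl g v -> dcl h w -> dcl (fun t => g t + h t) (v + w).
Proof.
move=> [g1 [v1 [g2 [v2 [s1 s2 gE ->]]]]] [h1 [w1 [h2 [w2 [r1 r2 hE ->]]]]].
exists (fun t => g1 t + h1 t), (v1 + w1), (fun t => g2 t + h2 t), (v2 + w2).
split; [exact: sublinD|exact: sublinD| |by rewrite opprD addrACA].
by move=> t; rewrite gE hE; ring.
Qed.

Lemma dclN h v : dcl h v -> dcl (fun t => - h t) (- v).
Proof.
move=> [g1 [v1 [g2 [v2 [s1 s2 gE ->]]]]]; exists g2, v2, g1, v1.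
by split=> // [t|]; rewrite ?gE opprB.
Qed.

Lemma dclZ (c : R) h v : dcl h v -> dcl (fun t => c * h t) (c *: v).
Proof.
have pos d g w : 0 < d -> dcl g w -> dcl (fun t => d * g t) (d *: w).
  move=> d0 [g1 [v1 [g2 [v2 [s1 s2 gE ->]]]]].
  exists (fun t => d * g1 t), (d *: v1), (fun t => d * g2 t), (d *: v2).
  split; [exact: sublinZ|exact: sublinZ| |by rewrite scalerBr].
  by move=> t; rewrite gE mulrBr.
move=> hv; have [c0|c0|->] := ltgtP c 0; last 2 first.
- exact: pos.
- rewrite scale0r -lin0; apply: eq_dcl (dcl_sublin (sublin_lin 0)) => t.
  by rewrite mul0r dot0l.
rewrite -(opprK c) scaleNr; apply: eq_dcl (dclN (pos (- c) _ _ _ hv)) => [t|].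
  by rewrite !mulNr.
by rewrite oppr_gt0.
Qed.

(** Rests on [max (g1 - g2) (h1 - h2) = max (g1 + h2) (h1 + g2) - (g2 + h2)]. *)
Lemma dcl_max g v h w : dcl g v -> dcl h w ->
  dcl (fun t => Num.max (g t) (h t)) (bl_join v w).
Proof.
move=> [g1 [v1 [g2 [v2 [s1 s2 gE ->]]]]] [h1 [w1 [h2 [w2 [r1 r2 hE ->]]]]].
exists (fun t => Num.max (g1 t + h2 t) (h1 t + g2 t)), (bl_join (v1 + w2) (w1 + v2)).
exists (fun t => g2 t + h2 t), (v2 + w2); split.
- by apply: sublin_max; exact: sublinD.
- exact: sublinD.
- move=> t; rewrite gE hE addr_maxl; congr Num.max; ring.
- rewrite -bl_joinD; congr bl_join.
    by rewrite opprD addrACA subrr addr0.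
  by rewrite [v2 + w2]addrC opprD addrACA subrr addr0.
Qed.

Lemma dcl_abs h v : dcl h v -> dcl (fun t => `|h t|) (labs v).
Proof.
move=> hv; apply: eq_dcl (dcl_max hv (dclN hv)) => t.
by have [h0|h0] := leP 0 (h t);
  [rewrite ger0_norm// max_l// ge0_cp|rewrite ltr0_norm// max_r// lt0_cp].
Qed.

Lemma dcl_sum (I : Type) (s : seq I) (g : I -> 'rV[R]_n -> R) (v : I -> X) :
  (forall i, dcl (g i) (v i)) ->
  dcl (fun t => \sum_(i <- s) g i t) (\sum_(i <- s) v i).
Proof.
move=> gv; elim: s => [|i s ih].
  rewrite big_nil -lin0; apply: eq_dcl (dcl_sublin (sublin_lin 0)) => t.
  by rewrite big_nil dot0l.
rewrite big_cons; apply: eq_dcl (dclD (gv i) ih) => t.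
by rewrite big_cons.
Qed.

Lemma dcl_coord i : dcl (fun t => t ord0 i) (x i).
Proof.
have -> : x i = lin (delta_mx 0 i).
  rewrite /lin (bigD1 i)//= mxE !eqxx scale1r big1 ?addr0// => j ji.
  by rewrite mxE eqxx (negPf ji) scale0r.
apply: eq_dcl (dcl_sublin (sublin_lin _)) => t.
rewrite /dot (bigD1 i)//= mxE !eqxx mul1r big1 ?addr0// => j ji.
by rewrite mxE eqxx (negPf ji) mul0r.
Qed.

Definition l1n t : R := \sum_(i < n) `|t ord0 i|.
Definition l1x : X := \sum_(i < n) labs (x i).

Lemma dcl_l1 : dcl l1n l1x.
Proof. by apply: dcl_sum => i; apply: dcl_abs; exact: dcl_coord. Qed.

Lemma l1n_ge0 t : 0 <= l1n t.
Proof. exact: sumr_ge0. Qed.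

(** [l1n] and [l1x] act as an order unit: closeness of functions relative to [l1n] becomes closeness
    in norm. *)
Lemma dcl_norm (e : R) h v : 0 <= e -> dcl h v ->
  (forall t, `|h t| <= e * l1n t) -> `|v| <= e * `|l1x|.
Proof.
move=> e0 hv he.
have -> : e * `|l1x| = `|e *: l1x| by rewrite normrZ ger0_norm.
have de := dclZ e dcl_l1.
apply: bl_norm_le.
- apply: bl_scale_ge0 => //.
  rewrite -[0](_ : \sum_(i < n) 0 = 0); last by rewrite big1.
  by apply: bl_le_sum => i _; exact: labs_ge0.
- by apply: dcl_mono hv de _ => t; apply: le_trans (he t); exact: ler_norm.
- apply: dcl_mono (dclN hv) de _ => t; apply: le_trans (he t).
  by rewrite -normrN ler_norm.
Qed.

End Krivine.

Lemma eq_ler (R : realType) (a b : R) : a = b -> a <= b.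
Proof. by move=> ->. Qed.

Lemma continuous_sumr (R : realType) (T : topologicalType) (I : Type)
    (l : seq I) (f : I -> T -> R) :
  (forall i, continuous (f i)) -> continuous (fun t => \sum_(i <- l) f i t).
Proof.
move=> fc; elim: l => [|i l ih].
  have -> : (fun t => \sum_(i <- [::]) f i t) = fun=> 0.
    by apply/funext => t; rewrite big_nil.
  exact: cst_continuous.
have -> : (fun t => \sum_(j <- i :: l) f j t) = fun t => f i t + \sum_(j <- l) f j t.
  by apply/funext => t; rewrite big_cons.
by move=> t; apply: cvgD; [exact: fc|exact: ih].
Qed.

(** * Extension of the calculus by density *)

Section KrivineExistence.
Context {R : realType} {X : banachLatticeType R} {n : nat} (x : 'I_n -> X).
Implicit Types (t s : 'rV[R]_n) (g h : 'rV[R]_n -> R) (v w : X).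
Local Notation l1n := (@l1n R n).
Local Notation homogeneous g :=
  (forall (a : R) t, 0 <= a -> g (a *: t) = a * g t).

(* Vanishes exactly on the ray through [s] when [l1n s = 1]; a large negative
   multiple of [gap s] pushes a constant below [h] away from [s]. *)
Definition gap (s t : 'rV[R]_n) : R := \sum_(i < n) `|t ord0 i - l1n t * s ord0 i|.

Lemma l1nZ (a : R) t : 0 <= a -> l1n (a *: t) = a * l1n t.
Proof.
move=> a0; rewrite /l1n mulr_sumr; apply: eq_bigr => i _.
by rewrite mxE normrM ger0_norm.
Qed.

Lemma gapZ s (a : R) t : 0 <= a -> gap s (a *: t) = a * gap s t.
Proof.
move=> a0; rewrite /gap mulr_sumr; apply: eq_bigr => i _.
by rewrite l1nZ// mxE -mulrA -mulrBr normrM ger0_norm.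
Qed.

Lemma dcl_gap s : exists w, dcl x (gap s) w.
Proof.
have h i : dcl x (fun t => `|t ord0 i - l1n t * s ord0 i|)
    (labs (x i + (- s ord0 i) *: l1x x)).
  apply: dcl_abs; apply: eq_dcl (dclD (dcl_coord x i) (dclZ _ (dcl_l1 x))) => t.
  by rewrite mulNr mulrC.
by exists (\sum_(i < n) labs (x i + (- s ord0 i) *: l1x x)); exact: dcl_sum.
Qed.

Lemma l1n_le1 t : l1n t = 1 -> forall i, `|t ord0 i| <= 1.
Proof.
by move=> <- i; rewrite /l1n (bigD1 i)//= lerDl; exact: sumr_ge0.
Qed.

Let K := [set t : 'rV[R]_n | forall i, `[-1, 1]%classic (t ord0 i)].

Lemma l1n_K t : l1n t = 1 -> K t.
Proof. by move=> /l1n_le1 h i; rewrite /= in_itv/= -ler_norml. Qed.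

Lemma compact_K : compact K.
Proof.
exact: (@rV_compact R n (fun=> `[-1, 1]%classic) (fun=> @segment_compact R _ _)).
Qed.

(** Local step of a Stone-Weierstrass argument: a constant slightly below [h s], minus a steep
    multiple of [gap s]. Homogeneity is recorded so that estimates on the [l1n] sphere extend to all
    vectors. *)
Lemma approx_from_below h (e : R) : homogeneous_continuous h -> 0 < e ->
  forall s, exists g v, [/\ dcl x g v, homogeneous g,
    (forall t, l1n t = 1 -> g t <= h t) &
    nbhs s [set t | l1n t = 1 -> h t <= g t + e]].
Proof.
move=> [hc hh] e0 s.
have Kc := compact_K.
have /compact_bounded[B [_ hB]] : compact (h @` K).
  by apply: continuous_compact => //; exact: continuous_subspaceT.
have {hB} [C [C0 hC]] : exists C, 0 < C /\ forall t, K t -> `|h t| <= C.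
  exists (`|B| + 1); split; first by rewrite ltr_wpDl.
  by move=> t Kt; apply: (hB (`|B| + 1)); [rewrite ltr_pwDr// ler_norm|exists t].
have e3 : 0 < e / 3 by rewrite divr_gt0.
have hs : nbhs s [set t | `|h s - h t| < e / 3].
  by have /cvgrPdist_lt/(_ _ e3) := hc s.
have /nbhs_ballP[d /= d0 hd] := hs.
(* [s] may lie outside [K], where [C] does not bound [h]; hence the truncation. The slope [k] makes
   the penalty at least [2 * C + e] once [gap s t >= d], enough to fall below [- C]. *)
pose hs' := Num.min (h s) C.
pose k := (2 * C + e) / d.
have k0 : 0 <= k by rewrite divr_ge0 ?ltW// addr_gt0// mulr_gt0.
have [w gw] := dcl_gap s.
exists (fun t => (hs' - e / 3) * l1n t + (- k) * gap s t).
exists ((hs' - e / 3) *: l1x x + (- k) *: w); split.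
- by apply: dclD; apply: dclZ => //; exact: dcl_l1.
- by move=> a t a0; rewrite l1nZ// gapZ//; ring.
- move=> t t1; rewrite t1 mulr1.
  have [gd|gd] := ltP (gap s t) d.
    have : `|h s - h t| < e / 3.
      apply: hd; split => // i j; rewrite /ball/= ord1 -normrN opprB.
      apply: le_lt_trans gd; rewrite /gap t1 (bigD1 j)//= mul1r lerDl.
      exact: sumr_ge0.
    rewrite ltr_norml => /andP[h1 h2].
    have := sumr_ge0 (index_enum 'I_n) (fun i (_ : true) => normr_ge0 (t ord0 i - l1n t * s ord0 i)).
    rewrite -/(gap s t) => g0; have : hs' <= h s by rewrite ge_min lexx.
    by have := mulr_ge0 k0 g0; lra.
  have : 2 * C + e <= k * gap s t.
    by rewrite /k mulrAC ler_pdivlMr// ler_pM2l// addr_gt0// mulr_gt0.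
  have : hs' <= C by rewrite ge_min lexx orbT.
  have := hC t (l1n_K t1); rewrite ler_norml => /andP[]; lra.
- pose dist t := \sum_(i < n) `|t ord0 i - s ord0 i|.
  have dc : dist t @[t --> s] --> dist s.
    apply: continuous_sumr => i t.
    exact: (cvg_norm (cvgB (@coord_continuous R 1 n ord0 i t) (cvg_cst (s ord0 i)))).
  have dist0 : k * dist s = 0.
    by rewrite /dist big1 ?mulr0// => i _; rewrite subrr normr0.
  have kdc : k * dist t @[t --> s] --> k * dist s by exact: (cvgMl_tmp dc).
  have /cvgrPdist_lt/(_ _ e3) h2 := kdc.
  near=> t => t1; rewrite t1 mulr1.
  have a1 : `|h s - h t| < e / 3 by near: t.
  have : `|k * dist s - k * dist t| < e / 3 by near: t.
  rewrite dist0; have -> : dist t = gap s t.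
    by apply: eq_bigr => i _; rewrite t1 mul1r.
  have := hC t (l1n_K t1).
  move: a1; rewrite ler_norml sub0r normrN !ltr_norml => /andP[? ?] /andP[? ?] /andP[? ?].
  by rewrite /hs'; case: (leP (h s) C) => ? ; lra.
Unshelve. all: by end_near.
Qed.

Lemma dcl_dense h (e : R) : homogeneous_continuous h -> 0 < e ->
  exists g v, dcl x g v /\ forall t, `|h t - g t| <= e * l1n t.
Proof.
move=> hh e0.
have /choice[G /choice[V hGV]] := approx_from_below hh e0.
have Kc := compact_K.
pose U s := [set t | l1n t = 1 -> h t <= G s t + e]^°.
have : cover_compact K by rewrite -compact_cover.
move=> /(_ _ K U)[s _|t Kt|D DK cov]; first exact: open_interior.
  by exists t => //; have [_ _ _] := hGV t.
(* The start of the maximum has to lie below [h] as well, so one of the [G s] serves as default. *)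
pose g t := \big[Num.max/G 0 t]_(s <- enum_fset D) G s t.
pose v := \big[bl_join/V 0]_(s <- enum_fset D) V s.
have gv : dcl x g v.
  rewrite /g /v; elim: (enum_fset D) => [|s l ih].
    rewrite big_nil; apply: eq_dcl (_ : dcl x (G 0) (V 0)) => [t|].
      by rewrite big_nil.
    by have [] := hGV 0.
  rewrite big_cons; have [gs _ _ _] := hGV s.
  by apply: eq_dcl (dcl_max gs ih) => t; rewrite big_cons.
have key t : l1n t = 1 -> `|h t - g t| <= e.
  move=> t1; have gh : g t <= h t.
    rewrite /g; elim: (enum_fset D) => [|s l ih].
      by rewrite big_nil; have [_ _ + _] := hGV 0; apply.
    by rewrite big_cons ge_max ih andbT; have [_ _ + _] := hGV s; apply.
  rewrite ger0_norm ?subr_ge0// lerBlDr addrC.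
  have [s sD] := cov t (l1n_K t1).
  move=> /interior_subset /= /(_ t1) h1; apply: le_trans h1 _; rewrite lerD2r.
  move: sD; rewrite /= /g -[_ \in D]/(_ \in enum_fset D).
  elim: (enum_fset D) => // r l ih; rewrite in_cons => /predU1P[->|sl].
    by rewrite big_cons le_max lexx.
  by rewrite big_cons le_max ih ?orbT.
have gZ a t : 0 <= a -> g (a *: t) = a * g t.
  move=> a0; rewrite /g; elim: (enum_fset D) => [|s l ih].
    by rewrite !big_nil; have [_ + _ _] := hGV 0; apply.
  rewrite !big_cons ih maxr_pMr//; congr Num.max.
  by have [_ + _ _] := hGV s; apply.
exists g, v; split => // t.
have [_ hhom] := hh.
have [t0|t0] := eqVneq (l1n t) 0.
  rewrite t0 mulr0; have -> : t = 0 *: 0.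
    rewrite scale0r; apply/rowP => i; rewrite mxE.
    apply/eqP; rewrite -normr_eq0.
    have abs0 j : true -> 0 <= `|t ord0 j| by [].
    by apply/eqP; exact: (psumr_eq0P abs0 t0).
  by rewrite hhom// gZ// !mul0r subrr normr0.
have tp : 0 < l1n t by rewrite lt0r t0 l1n_ge0.
have tE : t = l1n t *: ((l1n t)^-1 *: t) by rewrite scalerA mulfV// scale1r.
rewrite [in h t]tE [in g t]tE hhom ?(ltW tp)// gZ ?(ltW tp)//.
rewrite -mulrBr normrM (ger0_norm (ltW tp)) mulrC ler_wpM2r ?(ltW tp)//.
by apply: key; rewrite l1nZ ?invr_ge0 ?(ltW tp)// mulVf.
Qed.

(** Closure of the graph of the calculus on [dcl]: the same pair approximates the function, relative
    to [l1n], and the element of [X]. *)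
Definition kr h v := forall e : R, 0 < e -> exists g w,
  [/\ dcl x g w, (forall t, `|h t - g t| <= e * l1n t) & `|v - w| <= e].

Local Notation N := `|l1x x|.

Lemma kr_inj h v w : kr h v -> kr h w -> v = w.
Proof.
move=> hv hw; apply/eqP; rewrite -subr_eq0 -normr_le0; apply/ler_addgt0Pr => e e0.
have N0 : 0 < 2 * (N + 1) by rewrite mulr_gt0// ltr_wpDl.
have d0 : 0 < e / (2 * (N + 1)) by rewrite divr_gt0.
have [g1 [v1 [gv1 hg1 vv1]]] := hv _ d0.
have [g2 [v2 [gv2 hg2 vv2]]] := hw _ d0.
have h12 : `|v1 - v2| <= (2 * (e / (2 * (N + 1)))) * N.
  apply: dcl_norm (dclD gv1 (dclN gv2)) _ => [|t].
    by rewrite mulr_ge0// ltW.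
  rewrite mulr_natl mulr2n mulrDl; apply: le_trans (lerD (hg1 t) (hg2 t)).
  by rewrite (distrC (h t) (g1 t)); exact: ler_distD.
rewrite add0r; have -> : v - w = (v - v1) + (v1 - v2) - (w - v2).
  by rewrite addrA subrK opprB addrA subrK.
apply: le_trans (ler_normB _ _) _; apply: le_trans (lerD (ler_normD _ _) (lexx _)) _.
apply: le_trans (lerD (lerD vv1 h12) vv2) _.
by apply: eq_ler; field; rewrite gt_eqF// ltr_wpDl.
Qed.

(** The elements belonging to a sequence of approximants of [h] are Cauchy by [dcl_norm], and [X] is
    complete. *)
Lemma kr_exists h : homogeneous_continuous h -> exists v, kr h v.
Proof.
move=> hh.
have /choice[g /choice[w hgw]] : forall k : nat, exists g w,
    dcl x g w /\ forall t, `|h t - g t| <= k.+1%:R^-1 * l1n t.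
  by move=> k; apply: dcl_dense.
have dist j k : `|w j - w k| <= (j.+1%:R^-1 + k.+1%:R^-1) * N.
  have [gj hj] := hgw j; have [gk hk] := hgw k.
  apply: dcl_norm (dclD gj (dclN gk)) _ => [|t]; first by rewrite addr_ge0.
  rewrite mulrDl; apply: le_trans (lerD (hj t) (hk t)).
  by rewrite (distrC (h t) (g j t)); exact: ler_distD.
have small (e : R) : 0 < e -> \forall k \near \oo, k.+1%:R^-1 < e.
  move=> e0; have /cvgrPdist_lt/(_ _ e0) := @cvg_harmonic R.
  by apply: filterS => k /=; rewrite sub0r normrN ger0_norm.
have cw : cvg (w @ \oo).
  apply/cauchy_cvgP/cauchy_exP => e e0.
  have d0 : 0 < e / (2 * (N + 1)) by rewrite divr_gt0// mulr_gt0// ltr_wpDl.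
  have [k0 _ hk0] := small _ d0.
  exists (w k0); suff : \forall k \near \oo, `|w k0 - w k| < e.
    by apply: filterS => k; rewrite -ball_normE.
  near=> k; apply: le_lt_trans (dist _ _) _.
  have a1 := hk0 k0 (leqnn _).
  have a2 : k.+1%:R^-1 < e / (2 * (N + 1)) by apply: hk0; near: k; exists k0.
  apply: (@le_lt_trans _ _ ((e / (2 * (N + 1)) + e / (2 * (N + 1))) * N)).
    by apply: ler_wpM2r => //; rewrite lerD// ltW.
  rewrite [ltRHS](_ : _ = (e / (2 * (N + 1)) + e / (2 * (N + 1))) * (N + 1)).
    by rewrite ltr_pM2l ?addr_gt0// ltrDl.
  by field; rewrite gt_eqF// ltr_wpDl.
exists (lim (w @ \oo)) => e e0.
have /cvgrPdist_le/(_ _ e0) cl := cw.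
near \oo => k; exists (g k), (w k); have [gk hk] := hgw k.
split=> // [t|]; last by near: k.
apply: le_trans (hk t) _; apply: ler_wpM2r; first exact: l1n_ge0.
by apply/ltW; near: k; exact: small.
Unshelve. all: by end_near.
Qed.

Lemma krP (a : R) g h v w : kr g v -> kr h w ->
  kr (fun t => a * g t + h t) (a *: v + w).
Proof.
move=> gv hw e e0.
have a0 : 0 < `|a| + 1 by rewrite ltr_wpDl.
have d0 : 0 < e / (`|a| + 1) by rewrite divr_gt0.
have [g1 [v1 [gv1 hg1 vv1]]] := gv _ d0.
have [g2 [v2 [gv2 hg2 vv2]]] := hw _ d0.
exists (fun t => a * g1 t + g2 t), (a *: v1 + v2); split.
- by apply: dclD => //; exact: dclZ.
- move=> t; rewrite opprD addrACA -mulrBr.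
  apply: le_trans (ler_normD _ _) _; rewrite normrM.
  apply: le_trans (lerD (ler_wpM2l _ (hg1 t)) (hg2 t)) _ => //.
  by apply: eq_ler; field; exact: lt0r_neq0.
- rewrite opprD addrACA -scalerBr; apply: le_trans (ler_normD _ _) _.
  rewrite normrZ; apply: le_trans (lerD (ler_wpM2l _ vv1) vv2) _ => //.
  by apply: eq_ler; field; exact: lt0r_neq0.
Qed.

Lemma kr_max g h v w : kr g v -> kr h w ->
  kr (fun t => Num.max (g t) (h t)) (bl_join v w).
Proof.
move=> gv hw e e0.
have d0 : 0 < e / 2 by rewrite divr_gt0.
have [g1 [v1 [gv1 hg1 vv1]]] := gv _ d0.
have [g2 [v2 [gv2 hg2 vv2]]] := hw _ d0.
exists (fun t => Num.max (g1 t) (g2 t)), (bl_join v1 v2); split.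
- exact: dcl_max.
- move=> t; have := hg1 t; have := hg2 t.
  have := l1n_ge0 t; rewrite !ler_norml => l0 /andP[+ +] /andP[+ +].
  have := mulr_ge0 (ltW e0) l0.
  have -> : e * l1n t = 2 * (e / 2 * l1n t) by field.
  move: (e / 2 * l1n t) => d ? ? ? ? ?.
  case: (leP (g t) (h t)) => ?; case: (leP (g1 t) (g2 t)) => ?;
  apply/andP; split; lra.
- apply: le_trans (bl_norm_join _ _ _ _) _; apply: le_trans (lerD vv1 vv2) _.
  by rewrite -splitr.
Qed.

Lemma kr_dcl h v : dcl x h v -> kr h v.
Proof.
move=> hv e e0; exists h, v; split=> // [t|]; rewrite subrr normr0; last exact: ltW.
by apply: mulr_ge0; [exact: ltW|exact: l1n_ge0].
Qed.

Lemma homogeneous_continuous_lin (a : R) g h :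
  homogeneous_continuous g -> homogeneous_continuous h ->
  homogeneous_continuous (fun t => a * g t + h t).
Proof.
move=> [gc gh] [hc hh]; split=> [t|b t b0]; last by rewrite gh// hh//; ring.
exact: (cvgD (cvgMl_tmp (gc t)) (hc t)).
Qed.

Lemma homogeneous_continuous_max g h :
  homogeneous_continuous g -> homogeneous_continuous h ->
  homogeneous_continuous (fun t => Num.max (g t) (h t)).
Proof.
move=> [gc gh] [hc hh]; split=> [t|b t b0]; last by rewrite gh// hh// maxr_pMr.
by apply: continuous_max; [exact: gc|exact: hc].
Qed.

Lemma homogeneous_continuous_coord i :
  homogeneous_continuous (fun t : 'rV[R]_n => t ord0 i).
Proof. by split=> [t|b t b0]; [exact: coord_continuous|rewrite mxE]. Qed.

Lemma homogeneous_continuous0 :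
  homogeneous_continuous (fun t : 'rV[R]_n => 0).
Proof. by split=> [t|b t b0]; [exact: cst_continuous|rewrite mulr0]. Qed.

Lemma krivine_exists : exists Phi, is_krivine_calculus x Phi.
Proof.
have krE h v : kr h v -> xget 0 (kr h) = v.
  by move=> hv; apply: (@kr_inj h) => //; exact: xgetI hv.
have krX h : homogeneous_continuous h -> kr h (xget 0 (kr h)).
  by move=> /kr_exists[v hv]; rewrite (krE _ _ hv).
have krN h v : kr h v -> kr (fun t => - h t) (- v).
  move=> hv; have k0 : kr (fun=> 0) 0.
    apply: kr_dcl; rewrite -(lin0 x).
    by apply: eq_dcl (dcl_sublin (sublin_lin x 0)) => t; rewrite dot0l.
  have := krP (-1) hv k0; rewrite scaleN1r addr0.
  by congr (kr _ _); apply/funext => t; rewrite mulN1r addr0.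
exists (fun h => xget 0 (kr h)); split=> [i|a g h gc hc|g h gc hc|g h gc hc].
- by apply: krE; apply: kr_dcl; exact: dcl_coord.
- by apply: krE; apply: krP; exact: krX.
- by apply: krE; apply: kr_max; exact: krX.
- apply: krE; rewrite bl_meetE.
  have := krN _ _ (kr_max (krN _ _ (krX _ gc)) (krN _ _ (krX _ hc))).
  by congr (kr _ _); apply/funext => t; rewrite -oppr_min opprK.
Qed.

End KrivineExistence.

Lemma krivineP (R : realType) (X : banachLatticeType R) (n : nat)
  (x : 'I_n -> X) : is_krivine_calculus x (krivine x).
Proof. by have [Phi hPhi] := krivine_exists x; exact: xgetI hPhi. Qed.

(** * Random signs *)

Section PowR.
Context {R : realType}.
Implicit Types a b q : R.

Lemma powR_le q a b : 0 <= q -> 0 <= a -> a <= b -> a `^ q <= b `^ q.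
Proof.
move=> q0 a0 ab; apply: ge0_ler_powR => //; rewrite nnegrE//.
exact: le_trans ab.
Qed.

(** Convexity of the power as a supporting line at [b]: Young's inequality for [a] and the power
    [q - 1] of [b], with conjugate exponent [q / (q - 1)]. *)
Lemma powR_tangent q a b : 1 < q -> 0 <= a -> 0 <= b ->
  b `^ q + q * b `^ (q - 1) * (a - b) <= a `^ q.
Proof.
move=> q1 a0 b0; have q0 : 0 < q by apply: lt_trans q1.
have r0 : 0 < q - 1 by rewrite subr_gt0.
have := @conjugate_powR R a (b `^ (q - 1)) q (q / (q - 1)) a0 (powR_ge0 _ _) q0.
have -> : (b `^ (q - 1)) `^ (q / (q - 1)) = b `^ q.
  by rewrite -powRrM mulrC divfK ?gt_eqF.
rewrite -(mulr_powRB1 b0 q0) => /(_ _ _)h.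
have {h} := h (divr_gt0 q0 r0) ltac:(by field; rewrite !gt_eqF).
rewrite -(ler_pM2l q0); set c := b `^ (q - 1).
have -> : q * (a `^ q / q + b * c / (q / (q - 1))) = a `^ q + (q - 1) * (b * c).
  by field; rewrite !gt_eqF.
lra.
Qed.

Lemma powR_add_le q a b : 0 < q -> 0 <= a -> 0 <= b ->
  (a + b) `^ q <= 2 `^ q * (a `^ q + b `^ q).
Proof.
move=> q0 a0 b0; wlog ab : a b a0 b0 / a <= b.
  move=> h; have [|/ltW] := leP a b; first exact: h.
  by rewrite addrC [_ `^ q + _]addrC; exact: h.
apply: (@le_trans _ _ ((2 * b) `^ q)).
  by apply: powR_le; [exact: ltW|exact: addr_ge0|lra].
rewrite powRM//; apply: ler_wpM2l; first exact: powR_ge0.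
by rewrite lerDr powR_ge0.
Qed.

End PowR.

Section Cube.
Context {R : realType}.

Definition cube (N : nat) := {ffun 'I_N -> bool}.

(** Total in [n]: beyond the dimension the bit is [false], so [rad] is [1] there. *)
Definition bit N (w : cube N) (n : nat) : bool :=
  if insub n is Some i then w i else false.

Definition flip N (P : pred nat) (w : cube N) : cube N := [ffun i => w i (+) P i].

Definition flip1 N (n : nat) : cube N -> cube N := flip (pred1 n).

Definition rad N (w : cube N) (n : nat) : R := (-1) ^+ bit w n.

Lemma bitE N (w : cube N) (i : 'I_N) : bit w i = w i.
Proof. by rewrite /bit valK. Qed.

Lemma bit_flip N P (w : cube N) n : (n < N)%N -> bit (flip P w) n = bit w n (+) P n.
Proof. by move=> nN; rewrite -[n]/(val (Ordinal nN)) !bitE ffunE. Qed.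

Lemma flipK N P : involutive (@flip N P).
Proof. by move=> w; apply/ffunP => i; rewrite !ffunE addbK. Qed.

Lemma flipC N P Q (w : cube N) : flip P (flip Q w) = flip Q (flip P w).
Proof. by apply/ffunP => i; rewrite !ffunE addbAC. Qed.

Lemma flip1_ge N n (w : cube N) : (N <= n)%N -> flip1 n w = w.
Proof.
move=> Nn; apply/ffunP => i; rewrite !ffunE/=.
by rewrite (_ : (i == n :> nat) = false) ?addbF// ltn_eqF// (leq_trans _ Nn).
Qed.

Lemma bit_flip1_neq N n j (w : cube N) : n != j -> bit (flip1 j w) n = bit w n.
Proof.
move=> nj; rewrite /bit; case: insubP => // i _ ni.
by rewrite ffunE/= ni (negPf nj) addbF.
Qed.

Lemma rad_flip1 N n (w : cube N) : (n < N)%N -> rad (flip1 n w) n = - rad w n.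
Proof.
by move=> nN; rewrite /rad bit_flip//= eqxx addbT; case: bit; rewrite ?expr1 ?expr0 ?opprK.
Qed.

Lemma rad_flip1_neq N n j (w : cube N) : n != j -> rad (flip1 j w) n = rad w n.
Proof. by move=> nj; rewrite /rad bit_flip1_neq. Qed.

Lemma rad_flip N M (e : cube M) (w : cube N) n : (n < N)%N ->
  rad (flip (bit e) w) n = rad e n * rad w n.
Proof. by move=> nN; rewrite /rad bit_flip// signr_addb mulrC. Qed.

Lemma rad_sqr N (w : cube N) n : rad w n * rad w n = 1.
Proof. by rewrite /rad; case: bit; rewrite ?expr1 ?expr0 ?mulrNN mulr1. Qed.

Lemma norm_rad N (w : cube N) n : `|rad w n| = 1.
Proof. by rewrite /rad normr_sign. Qed.

Lemma sum_flip (V : nmodType) N P (f : cube N -> V) :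
  \sum_w f (flip P w) = \sum_w f w.
Proof. by rewrite [RHS](reindex_inj (can_inj (@flipK N P))). Qed.

Lemma card_cube N : #|{: cube N}| = (2 ^ N)%N.
Proof. by rewrite card_ffun card_bool card_ord. Qed.

Definition vavg (V : lmodType R) N (f : cube N -> V) : V :=
  (2 ^+ N)^-1 *: \sum_w f w.

Definition avg N (f : cube N -> R) : R := (2 ^+ N)^-1 * \sum_w f w.

Lemma exp2_gt0 N : 0 < 2 ^+ N :> R. Proof. by rewrite exprn_gt0. Qed.

Lemma exp2V_ge0 N : 0 <= (2 ^+ N)^-1 :> R.
Proof. by rewrite invr_ge0 ltW// exp2_gt0. Qed.

Lemma eq_avg N (f g : cube N -> R) : f =1 g -> avg f = avg g.
Proof. by move=> /funext->. Qed.

Lemma le_avg N (f g : cube N -> R) : (forall w, f w <= g w) -> avg f <= avg g.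
Proof. by move=> fg; apply: ler_wpM2l; [exact: exp2V_ge0|exact: ler_sum]. Qed.

Lemma avg_ge0 N (f : cube N -> R) : (forall w, 0 <= f w) -> 0 <= avg f.
Proof. by move=> f0; apply: mulr_ge0; [exact: exp2V_ge0|exact: sumr_ge0]. Qed.

Lemma avg_cst N (c : R) : avg (fun _ : cube N => c) = c.
Proof.
by rewrite /avg sumr_const card_cube -[c *+ _]mulr_natl natrX mulrA mulVf ?mul1r.
Qed.

Lemma avgD N (f g : cube N -> R) : avg (fun w => f w + g w) = avg f + avg g.
Proof. by rewrite /avg big_split mulrDr. Qed.

Lemma avgZ N (c : R) (f : cube N -> R) : avg (fun w => c * f w) = c * avg f.
Proof. by rewrite /avg -mulr_sumr mulrCA. Qed.

Lemma avgB N (f g : cube N -> R) : avg (fun w => f w - g w) = avg f - avg g.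
Proof. by rewrite /avg sumrB mulrBr. Qed.

Lemma avg_sum N (I : Type) (l : seq I) (f : I -> cube N -> R) :
  avg (fun w => \sum_(i <- l) f i w) = \sum_(i <- l) avg (f i).
Proof. by rewrite /avg exchange_big mulr_sumr. Qed.

Lemma avg_flip N P (f : cube N -> R) : avg (fun w => f (flip P w)) = avg f.
Proof. by rewrite /avg (@sum_flip R N P f). Qed.

Lemma avg_exchange N M (f : cube N -> cube M -> R) :
  avg (fun w => avg (f w)) = avg (fun e => avg (f^~ e)).
Proof.
rewrite /avg -!mulr_sumr exchange_big /= !mulrA; congr (_ * _).
by rewrite mulrC.
Qed.

Lemma avg_eq0_antisym N j (f : cube N -> R) :
  (forall w, f (flip1 j w) = - f w) -> avg f = 0.
Proof.
move=> fj; have : avg f = - avg f.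
  rewrite -[LHS](avg_flip (pred1 j)) (eq_avg fj) -[RHS]mulN1r -avgZ.
  by apply: eq_avg => w; rewrite mulN1r.
by move/eqP; rewrite -addr_eq0 -mulr2n mulrn_eq0 => /eqP.
Qed.

Lemma avg_antisym (V : lmodType R) N j (f : cube N -> V) :
  (forall w, f (flip1 j w) = - f w) -> \sum_w f w = 0.
Proof.
move=> fj; have : \sum_w f w = - \sum_w f w.
  by rewrite -[LHS](sum_flip (pred1 j)) -sumrN; apply: eq_bigr => w _; exact: fj.
move/eqP; rewrite -addr_eq0 -mulr2n -scaler_nat scaler_eq0 pnatr_eq0 => /eqP.
exact.
Qed.

(** Tangent line at the mean [m] of the norms; its linear term has mean zero. *)
Lemma jensen (V : normedModType R) N (q : R) (f : cube N -> V) : 1 < q ->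
  `|vavg f| `^ q <= avg (fun w => `|f w| `^ q).
Proof.
move=> q1; have q0 : 0 <= q by apply: ltW; apply: lt_trans q1.
set m := avg (fun w => `|f w|).
have m0 : 0 <= m by exact: avg_ge0.
apply: (@le_trans _ _ (m `^ q)).
  apply: powR_le => //; rewrite /vavg normrZ ger0_norm ?exp2V_ge0//.
  by apply: ler_wpM2l; [exact: exp2V_ge0|exact: ler_norm_sum].
have := le_avg (fun w => powR_tangent q1 (normr_ge0 (f w)) m0).
by rewrite avgD avg_cst avgZ avgB avg_cst subrr mulr0 addr0.
Qed.

End Cube.
Arguments bit_flip {N} P w n.

(** * Moments of Rademacher sums *)

Section Rademacher.
Context {R : realType}.
Implicit Types (N : nat) (c : nat -> R).

Lemma avg_rad_rad N i j : (i < N)%N -> (j < N)%N ->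
  avg (fun w : cube N => rad w i * rad w j) = (i == j)%:R :> R.
Proof.
move=> iN jN; have [<-|ij] := eqVneq i j.
  by rewrite -[RHS](avg_cst N); apply: eq_avg => w; rewrite rad_sqr.
apply: (avg_eq0_antisym (j := i)) => w.
by rewrite rad_flip1// rad_flip1_neq 1?eq_sym// mulNr.
Qed.

(** The number [n] of terms is separate from the dimension [N], so that induction on [n] can run on
    a fixed cube. *)
Definition rsum (V : lmodType R) N (n : nat) (y : nat -> V) (w : cube N) : V :=
  \sum_(i < n) rad w i *: y i.

Lemma rsumS (V : lmodType R) N n (y : nat -> V) (w : cube N) :
  rsum n.+1 y w = rsum n y w + rad w n *: y n.
Proof. by rewrite /rsum big_ord_recr. Qed.

Lemma rsum_flip1 (V : lmodType R) N n (y : nat -> V) (w : cube N) :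
  rsum n y (flip1 n w) = rsum n y w.
Proof.
by apply: eq_bigr => i _; rewrite rad_flip1_neq// neq_ltn ltn_ord.
Qed.

Lemma rsum_moments N c n : (n <= N)%N ->
  avg (fun w : cube N => rsum (V := R^o) n c w ^+ 2) = \sum_(i < n) c i ^+ 2 /\
  avg (fun w : cube N => rsum (V := R^o) n c w ^+ 4) <= 3 * (\sum_(i < n) c i ^+ 2) ^+ 2.
Proof.
pose g n (w : cube N) : R := rsum (V := R^o) n c w.
rewrite -/(g n); elim: n => [_|n ih nN].
  rewrite big_ord0 expr0n mulr0 (eq_avg (g := fun=> 0)) ?avg_cst.
    split => //; rewrite (eq_avg (g := fun=> 0)) ?avg_cst// => w.
    by rewrite /rsum big_ord0 expr0n.
  by move=> w; rewrite /rsum big_ord0 expr0n.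
have [m2 m4] := ih (ltnW nN).
have gS w : rsum (V := R^o) n.+1 c w = g n w + rad w n * c n by rewrite rsumS.
(* Pairing each [w] with its flip in sign [n] removes the odd powers of that sign. *)
have half (phi : R -> R) : avg (fun w => phi (g n w + rad w n * c n)) =
    2^-1 * avg (fun w => phi (g n w + rad w n * c n) + phi (g n w - rad w n * c n)).
  rewrite avgD.
  have -> : avg (fun w => phi (g n w - rad w n * c n)) =
            avg (fun w => phi (g n w + rad w n * c n)).
    rewrite -[RHS](avg_flip (pred1 n)); apply: eq_avg => w.
    by rewrite -/(flip1 n w) rad_flip1// mulNr /g rsum_flip1.
  by field.
have r2 (w : cube N) : (rad w n * c n) ^+ 2 = c n ^+ 2.
  by rewrite exprMn [rad _ _ ^+ 2]rad_sqr mul1r.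
split.
  rewrite (eq_avg (fun w => congr1 (fun x => x ^+ 2) (gS w))) (half (fun x => x ^+ 2)).
  rewrite (eq_avg (g := fun w => 2 * g n w ^+ 2 + 2 * c n ^+ 2)); last first.
    by move=> w; rewrite -(r2 w); ring.
  by rewrite avgD avg_cst avgZ m2 big_ord_recr/=; field.
rewrite (eq_avg (fun w => congr1 (fun x => x ^+ 4) (gS w))) (half (fun x => x ^+ 4)).
rewrite (eq_avg (g := fun w => 2 * g n w ^+ 4 + (12 * c n ^+ 2 * g n w ^+ 2 + 2 * (c n ^+ 2) ^+ 2))).
  rewrite avgD avgD avg_cst !avgZ m2 big_ord_recr/=.
  set s := \sum_(i < n) _; have := sqr_ge0 (c n ^+ 2).
  have : 0 <= s by apply: sumr_ge0 => i _; exact: sqr_ge0.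
  have := sqr_ge0 (c n); move: m4; rewrite -/s; nra.
by move=> w; rewrite -(r2 w); ring.
Qed.

(** Bessel's inequality for the orthonormal functions [rad _ i]: expand the second moment of [f]
    minus its projection [g]. *)
Lemma rademacher_bessel N (f : cube N -> R) :
  \sum_(i < N) avg (fun w => rad w i * f w) ^+ 2 <= avg (fun w => f w ^+ 2).
Proof.
pose a i := avg (fun w => rad w i * f w).
pose g (w : cube N) : R := rsum (V := R^o) N a w.
have fg : avg (fun w => g w * f w) = \sum_(i < N) a i ^+ 2.
  rewrite (eq_avg (g := fun w => \sum_(i < N) a i * (rad w i * f w))); last first.
    move=> w; rewrite /g /rsum mulr_suml; apply: eq_bigr => i _.
    by rewrite -[_ *: _]/(_ * _); ring.
  by rewrite avg_sum; apply: eq_bigr => i _; rewrite avgZ expr2.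
have [g2 _] := rsum_moments a (leqnn N).
have : 0 <= avg (fun w => (f w - g w) ^+ 2) by apply: avg_ge0 => w; exact: sqr_ge0.
rewrite (eq_avg (g := fun w => f w ^+ 2 + (g w ^+ 2 - 2 * (g w * f w)))).
  by rewrite avgD avgB avgZ fg g2; rewrite /a; lra.
by move=> w; ring.
Qed.

(** The second moment is [s ^ 2] and the fourth at most [3 * s ^ 4], so the pointwise bound below
    gives a mean of at least [s - 3 * s / 6 = s / 2]. *)
Lemma khintchine N c :
  Num.sqrt (\sum_(i < N) c i ^+ 2) <= 2 * avg (fun w : cube N => `|rsum (V := R^o) N c w|).
Proof.
set S := \sum_(i < N) _; have S0 : 0 <= S by apply: sumr_ge0 => i _; exact: sqr_ge0.
have [s0|s0] := eqVneq (Num.sqrt S) 0.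
  by rewrite s0 mulr_ge0// avg_ge0.
have sp : 0 < Num.sqrt S by rewrite lt0r s0 sqrtr_ge0.
pose s := Num.sqrt S; have s2 : s ^+ 2 = S by rewrite sqr_sqrtr.
have [m2 m4] := rsum_moments c (leqnn N); rewrite -/S in m2 m4.
(* Pointwise [|u| >= u^2 - u^4/6], applied to [u = rsum / s]. *)
have key (u : R) : s ^+ 2 * u ^+ 2 - u ^+ 4 / 6 <= s ^+ 3 * `|u|.
  rewrite -(real_normK (num_real u)) (_ : u ^+ 4 = `|u| ^+ 4); last first.
    by rewrite -[4%N]/(2 * 2)%N !exprM real_normK ?num_real.
  have := normr_ge0 u; set v := `|u| => v0.
  have : 0 <= v * (s ^+ 3 - s ^+ 2 * v + v ^+ 3 / 6); last by lra.
  apply: mulr_ge0 => //; have sp' : 0 < s by [].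
  (* The cubic is smallest at [v = sqrt 2 * s]. [17 / 12] is a rational stand-in for [sqrt 2], and
     the last factor carries twice that number so that the term in [v ^ 2] cancels. *)
  have : 0 <= (v - 17 / 12 * s) ^+ 2 * (v + 17 / 6 * s).
    by rewrite mulr_ge0 ?sqr_ge0// addr_ge0// mulr_ge0// ltW.
  have := mulr_ge0 (sqr_ge0 s) v0; have := exprn_gt0 3 sp'; lra.
have := le_avg (fun w : cube N => key (rsum (V := R^o) N c w)).
rewrite avgZ (eq_avg (g := fun w => s ^+ 2 * rsum (V := R^o) N c w ^+ 2 + (- 6^-1) * rsum (V := R^o) N c w ^+ 4)); last first.
  by move=> w; rewrite mulNr [_^-1 * _]mulrC.
rewrite avgD !avgZ m2; set A := avg _; set B := avg _ => h.
rewrite -/s -(ler_pM2l (exprn_gt0 3 sp)) -/s.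
have : s ^+ 2 * S + - 6^-1 * (3 * S ^+ 2) <= s ^+ 3 * B.
  by apply: le_trans h; rewrite lerD2l ler_nM2l// oppr_lt0 invr_gt0.
rewrite -s2; lra.
Qed.

End Rademacher.

(** * The UMD inequality on the sign cube *)

Section Partition.
Context {d : measure_display} {T : measurableType d} {R : realType}.
Context (I : finType) (D : set T) (E : I -> set T).
Context (mE : forall i, measurable (E i)) (tE : trivIset setT E)
  (DE : D = \bigcup_i E i).

Let DEbig : D = \big[setU/set0]_(i <- index_enum I) E i.
Proof.
rewrite DE -bigcup_seq; apply/seteqP; split=> [x [i _ Eix]|x [i _ Eix]].
  by exists i => //=; rewrite mem_index_enum.
by exists i.
Qed.

Let tEi : trivIset [set` index_enum I] E.
Proof. exact: sub_trivIset tE. Qed.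

Lemma measurable_partition : measurable D.
Proof. by rewrite DEbig; exact: bigsetU_measurable. Qed.

Lemma measurable_fun_partition d' (T' : sigmaRingType d') (phi : T -> T') (c : I -> T') :
  (forall i x, E i x -> phi x = c i) -> measurable_fun D phi.
Proof.
move=> phic _ Y _.
have -> : D `&` phi @^-1` Y = \big[setU/set0]_(i <- index_enum I | `[< Y (c i) >]) E i.
  rewrite -bigcup_seq_cond DE; apply/seteqP; split=> [x [[i _ Eix] Yx]|x [i]].
    exists i => //=; rewrite mem_index_enum/=; apply/asboolP.
    by rewrite -(phic _ _ Eix).
  move=> /= /andP[_ /asboolP Yi] Eix; split; first by exists i.
  by rewrite /preimage/= (phic _ _ Eix).
exact: bigsetU_measurable.
Qed.

Lemma integral_partition (mu : {measure set T -> \bar R}) (phi : T -> \bar R) (c : I -> \bar R) :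
  (forall i, 0 <= c i)%E -> (forall i x, E i x -> phi x = c i) ->
  (\int[mu]_(x in D) phi x = \sum_i c i * mu (E i))%E.
Proof.
move=> c0 phic.
rewrite DEbig ge0_integral_bigsetU//=; last 3 first.
- exact: index_enum_uniq.
- rewrite -DEbig. exact: measurable_fun_partition phic.
- by rewrite -DEbig DE => x [i _ Eix]; rewrite (phic _ _ Eix).
apply: eq_bigr => i _; rewrite -integral_cst//; apply: eq_integral => x /set_mem.
exact: phic.
Qed.

Lemma simple_on_partition (X : normedModType R) (s : T -> X) (c : I -> X) :
  (forall i x, E i x -> s x = c i) -> simple_on D measurable s.
Proof.
move=> sc; split.
  apply: (@sub_finite_set _ _ (c @` setT)); last exact: finite_image.
  by move=> _ [x + <-]; rewrite DE => -[i _ Eix]; exists i => //; rewrite -(sc _ _ Eix).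
move=> v.
have -> : D `&` s @^-1` [set v] = \big[setU/set0]_(i <- index_enum I | c i == v) E i.
  rewrite -bigcup_seq_cond DE; apply/seteqP; split=> [x [[i _ Eix] sx]|x [i]].
    by exists i => //=; rewrite mem_index_enum/= -(sc _ _ Eix) -sx.
  move=> /= /andP[_ /eqP ci] Eix; split; first by exists i.
  by rewrite /preimage/= (sc _ _ Eix).
exact: bigsetU_measurable.
Qed.

(** Several cells may share a value, so the sum over values is regrouped by cells. An empty cell may
    carry a value that [s] never takes, but its measure is zero. *)
Lemma simple_integral_partition (X : normedModType R) (mu : {measure set T -> \bar R})
    (s : T -> X) (c : I -> X) :
  (forall i, mu (E i) \is a fin_num) ->
  (forall i x, E i x -> s x = c i) ->
  simple_integral mu D s = \sum_i fine (mu (E i)) *: c i.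
Proof.
move=> muE sc; rewrite /simple_integral.
have [finD mD] := simple_on_partition sc.
rewrite fsbig_finite//=.
have muE' v : mu (D `&` s @^-1` [set v]) = (\sum_(i | c i == v) mu (E i))%E.
  have ms := mD v.
  have -> : D `&` s @^-1` [set v] = (D `&` s @^-1` [set v]) `&` D.
    by rewrite setIAC setIid.
  rewrite -(integral_indic mu measurable_partition ms).
  rewrite (@integral_partition mu _ (fun i => (c i == v)%:R%:E)).
  - rewrite [RHS]big_mkcond; apply: eq_bigr => i _.
    by case: eqP => _; rewrite ?mul1e ?mul0e.
  - by move=> i; rewrite lee_fin.
  - move=> i x Eix; rewrite indicE; congr (_%:R%:E); congr nat_of_bool.
    apply/idP/eqP => [/set_mem[_ <-]|civ]; first by rewrite (sc _ _ Eix).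
    by apply/mem_set; split; [rewrite DE; exists i|rewrite /= (sc _ _ Eix)].
transitivity (\sum_(v <- fset_set (s @` D)) \sum_(i | c i == v) fine (mu (E i)) *: v).
  apply: eq_bigr => v _; rewrite muE' -scaler_suml; congr (_ *: _).
  by rewrite sum_fine.
rewrite (exchange_big_dep xpredT)//=; apply: eq_bigr => i _.
have [->|/set0P[x Eix]] := eqVneq (E i) set0.
  by rewrite measure0 scale0r big1// => v _; rewrite scale0r.
have ci : c i \in fset_set (s @` D).
  by rewrite in_fset_set// inE; exists x; [rewrite DE; exists i|exact: sc].
rewrite (bigID (pred1 (c i)))/= [X in _ + X]big1 ?addr0; last first.
  by move=> v /andP[/eqP ->]; rewrite eqxx.
rewrite (eq_bigl (fun v => v == c i)); last first.
  by move=> v; rewrite eq_sym; case: eqP.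
by rewrite -big_filter filter_pred1_uniq ?fset_uniq// big_seq1.
Qed.

End Partition.

Section BochnerSimple.
Context {R : realType} {X : normedModType R} {d : measure_display}
  {T : measurableType d} (mu : {measure set T -> \bar R}).
Implicit Types (D : set T) (g s : T -> X).

(** The triangle inequality on the common refinement of the two partitions into level sets. *)
Lemma simple_integral_dist D g s :
  measurable D -> (mu D < +oo)%E ->
  simple_on D measurable g -> simple_on D measurable s ->
  (`|simple_integral mu D g - simple_integral mu D s|%:E <=
   \int[mu]_(x in D) `|g x - s x|%:E)%E.
Proof.
move=> mD muD [fg mg] [fs ms].
pose I := (fset_set (g @` D) * fset_set (s @` D))%type.
pose E (i : I) := (D `&` g @^-1` [set val i.1]) `&` (D `&` s @^-1` [set val i.2]).
have mE i : measurable (E i) by exact: measurableI.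
have tE : trivIset setT E.
  apply/trivIsetP => -[u v] [u' v'] _ _ uv; apply/seteqP; split => // x.
  move=> [[[_ /= gu] [_ sv]] [[_ gu'] [_ sv']]]; move/eqP: uv; apply.
  by congr pair; apply: val_inj; rewrite /= -?gu -?sv.
have DE : D = \bigcup_i E i.
  apply/seteqP; split=> [x Dx|x [i _ [[]]]//].
  have gx : g x \in fset_set (g @` D) by rewrite in_fset_set// inE; exists x.
  have sx : s x \in fset_set (s @` D) by rewrite in_fset_set// inE; exists x.
  by exists ([` gx]%fset, [` sx]%fset).
have muE i : mu (E i) \is a fin_num.
  rewrite ge0_fin_numE//; apply: le_lt_trans muD.
  by apply: le_measure; rewrite ?inE// => x [[]].
rewrite (simple_integral_partition mE tE DE (c := fun i => val i.1))//; last first.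
  by move=> i x [[_ ->]].
rewrite (simple_integral_partition mE tE DE (s := s) (c := fun i => val i.2))//; last first.
  by move=> i x [_ [_ ->]].
rewrite (integral_partition mE tE DE mu (c := fun i => `|val i.1 - val i.2|%:E))//; last first.
  by move=> i x [[_ ->] [_ ->]].
rewrite -sumrB (eq_bigr (fun i => (`|val i.1 - val i.2| * fine (mu (E i)))%:E)); last first.
  by move=> i _; rewrite EFinM fineK.
rewrite sumEFin lee_fin; apply: le_trans (ler_norm_sum _ _ _) _.
apply: ler_sum => i _; by rewrite -scalerBr normrZ mulrC ger0_norm// fine_ge0.
Qed.

(** The integral is chosen by [xget], so uniqueness is the point: by [simple_integral_dist], the
    integrals of every approximating sequence tend to that of [g]. *)
Lemma bochner_integral_simple D g :
  measurable D -> (mu D < +oo)%E -> simple_on D measurable g ->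
  bochner_integral mu D g = simple_integral mu D g.
Proof.
move=> mD muD sg; apply: xget_unique.
  exists (fun=> g); split=> //; last exact: cvg_cst.
  have -> : (fun=> \int[mu]_(x in D) `|g x - g x|%:E)%E = (fun _ : nat => 0%E).
    apply/funext => _; apply: integral0_eq => x _; by rewrite subrr normr0.
  exact: (@cvg_cst (\bar R)).
move=> v [s [ss cs cv]].
suff cv' : simple_integral mu D (s k) @[k --> \oo] --> simple_integral mu D g.
  exact: (cvg_unique _ cv cv').
apply/cvgrPdist_le => e e0.
have /fine_cvgP[fin] := cs.
move=> /cvgrPdist_le/(_ _ e0) h; near=> k.
have fk : (\int[mu]_(x in D) `|g x - s k x|%:E)%E \is a fin_num by near: k.
rewrite -lee_fin; apply: le_trans (simple_integral_dist mD muD sg (ss k)) _.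
rewrite -(fineK fk) lee_fin; have : `|0 - fine (\int[mu]_(x in D) `|g x - s k x|%:E)%E| <= e.
  by near: k.
by rewrite sub0r normrN; apply: le_trans; exact: ler_norm.
Unshelve. all: by end_near.
Qed.

End BochnerSimple.

HB.instance Definition _ (N : nat) := Finite.on (cube N).
HB.instance Definition _ (N : nat) := isPointed.Build (cube N) [ffun=> false].
HB.instance Definition _ (N : nat) := @isMeasurable.Build default_measure_display
  (cube N) discrete_measurable discrete_measurable0
  discrete_measurableC discrete_measurableU.

Section UniformCube.
Context {R : realType} (N : nat).

Lemma exp2V_nng : 0 <= (2 ^+ N)^-1 :> R. Proof. exact: exp2V_ge0. Qed.

Definition cube_prob : set (cube N) -> \bar R :=
  mscale (NngNum exp2V_nng)
    (msum (fun i => \d_(nth (point : cube N) (enum {: cube N}) i)) #|{: cube N}|).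

HB.instance Definition _ := Measure.on cube_prob.

Lemma cube_probE (A : set (cube N)) :
  cube_prob A = (avg (fun w => \1_A w))%:E.
Proof.
rewrite /cube_prob /mscale /avg EFinM; congr (_ * _)%E.
transitivity (\sum_(k < #|{: cube N}|)
    \d_(nth (point : cube N) (enum {: cube N}) k) A : \bar R)%E; first by [].
rewrite -sumEFin -[RHS]big_enum (big_nth (point : cube N)) big_mkord -cardE.
by apply: eq_bigr => i _; rewrite diracE indicE.
Qed.

Let cube_prob_setT : cube_prob setT = 1%E.
Proof. by rewrite cube_probE (eq_avg (g := fun=> 1)) ?avg_cst// => w; rewrite indicT. Qed.

HB.instance Definition _ := Measure_isProbability.Build _ _ _ cube_prob cube_prob_setT.

Lemma cube_prob_set1 w : cube_prob [set w] = ((2 ^+ N)^-1)%:E.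
Proof.
rewrite cube_probE /avg (bigD1 w)//= indicE mem_set// big1 ?addr0 ?mulr1//.
by move=> v vw; rewrite indicE memNset// => /= /eqP; rewrite (negPf vw).
Qed.

Lemma integral_cube_prob (phi : cube N -> R) : (forall w, 0 <= phi w) ->
  (\int[cube_prob]_w (phi w)%:E = (avg phi)%:E)%E.
Proof.
move=> phi0.
rewrite (@integral_partition _ (cube N) R {: cube N} setT (fun w => [set w])
  _ _ _ cube_prob _ (fun w => (phi w)%:E))//.
- rewrite /avg mulr_sumr -sumEFin; apply: eq_bigr => w _.
  by rewrite [in RHS]mulrC EFinM; congr (_ * _)%E; exact: cube_prob_set1.
- by apply/trivIsetP => u v _ _ uv; apply/seteqP; split=> // x [/= -> vu]; rewrite vu eqxx in uv.
- by apply/seteqP; split=> // w _; exists w.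
- by move=> u v ->.
Qed.

End UniformCube.

(* Martingale differences for the filtration of the coordinates: [D n] depends on
   the first [n] signs only, and is odd in the last of them. *)
Definition mdiffs (R : realType) (X : normedModType R) N (D : nat -> cube N -> X) :=
  (forall n j w, (n <= j)%N -> D n (flip1 j w) = D n w) /\
  (forall n w, (n < N)%N -> D n.+1 (flip1 n w) = - D n.+1 w).

(** The form in which the UMD hypothesis is used from here on: in [q]-th powers and for martingales
    on the sign cube. *)
Definition umd_cube_bound (R : realType) (X : normedModType R) (q B : R) :=
  forall N (D : nat -> cube N -> X), mdiffs D ->
  forall eps : nat -> R, (forall n, `|eps n| <= 1) ->
  avg (fun w => `|\sum_(n < N.+1) eps n *: D n w| `^ q) <=
  B * avg (fun w => `|\sum_(n < N.+1) D n w| `^ q).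

Section UMDCube.
Context {R : realType} {X : completeNormedModType R}.

Section Martingale.
Context (N : nat) (D : nat -> cube N -> X) (hD : mdiffs D).

(** [mdiffs] gives oddness up to index [N] only; later differences are set to zero so that the
    partial sums form a martingale for all times. *)
Let D' n w := if (n <= N)%N then D n w else 0.
Let f n w := \sum_(k < n.+1) D' k w.
Let G n : set (set (cube N)) := [set A | forall j w, (n <= j)%N -> A (flip1 j w) = A w].

Let f_flip n j w : (n <= j)%N -> f n (flip1 j w) = f n w.
Proof.
move=> nj; apply: eq_bigr => k _; rewrite /D'; case: ifP => // _.
by apply: hD.1; rewrite (leq_trans _ nj)// -ltnS.
Qed.

Let fS n w : f n.+1 w = f n w + D' n.+1 w.
Proof. by rewrite /f big_ord_recr. Qed.

Lemma cube_filtration : filtration [set: cube N] G.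
Proof.
split=> [n|n A _|n A GA j w nj]; last by apply: GA; exact: ltnW.
  split=> [|A GA j w nj|A GA j w nj]; first by [].
    by rewrite /setD/= GA.
  by rewrite /bigcup/=; apply/propext; split=> -[k _ Ak]; exists k => //; rewrite ?GA// -(GA k j w).
by split.
Qed.

Let simple_cube (A : set (cube N)) (H : set (set (cube N))) (g : cube N -> X) :
  (forall v, H (A `&` g @^-1` [set v])) -> simple_on A H g.
Proof.
by move=> Hg; split => //; apply: finite_image; exact: finite_finset.
Qed.

Let bochner_cube (H : set (set (cube N))) (g : cube N -> X) :
  (forall v, H (setT `&` g @^-1` [set v])) ->
  bochner_integrable (@cube_prob R N) setT H g.
Proof.
move=> Hg; split.
  exists (fun=> g); split=> [k|x _]; first exact: simple_cube.
  exact: cvg_cst.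
by rewrite (integral_cube_prob (phi := fun w => `|g w|))// ltry.
Qed.

Let Gf n v : G n (setT `&` f n @^-1` [set v]).
Proof. by move=> j w nj; rewrite !setTI /preimage/= f_flip. Qed.

Lemma cube_martingale : martingale (@cube_prob R N) setT G f.
Proof.
split=> n; first exact/bochner_cube/Gf.
split=> [||A GA]; [exact: bochner_cube|exact/bochner_cube/Gf|].
have PA : (cube_prob (R := R) A < +oo)%E by rewrite cube_probE ltry.
rewrite !bochner_integral_simple//; try exact: simple_cube.
pose E w := A `&` [set w].
have tE : trivIset setT E.
  apply/trivIsetP => u v _ _ uv; apply/seteqP; split=> // x [[_ /= ->] [_ vu]].
  by rewrite vu eqxx in uv.
have AE : A = \bigcup_w E w.
  by apply/seteqP; split=> [w Aw|w [v _ []]//]; exists w.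
have PE w : cube_prob (R := R) (E w) \is a fin_num by rewrite cube_probE.
have mE w : measurable (E w) by [].
have SI (g : cube N -> X) : simple_integral (@cube_prob R N) A g =
    \sum_w fine (@cube_prob R N (E w)) *: g w.
  by apply: (@simple_integral_partition _ (cube N) R {: cube N} A E mE tE AE X
      (@cube_prob R N) g g PE) => w x [_ ->].
rewrite !SI.
apply/eqP; rewrite eq_sym -subr_eq0 -sumrB.
have [nN|nN] := ltnP n N; last first.
  by apply/eqP/big1 => w _; rewrite fS /D' leqNgt ltnS nN/= addr0 subrr.
(* The integral of the increment over [A] is a sum odd in sign [n]: [A] ignores this sign, so a
   point and its flip carry equal mass, and [D n.+1] is odd. *)
apply/eqP; apply: (avg_antisym (j := n)) => w.
have -> : fine (cube_prob (R := R) (E (flip1 n w))) = fine (cube_prob (R := R) (E w)).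
  rewrite !cube_probE /= -[LHS](avg_flip (pred1 n)); apply: eq_avg => v.
  rewrite !indicE; congr (_%:R); congr nat_of_bool.
  apply/idP/idP => /set_mem[Av vw]; apply/mem_set; split.
  - by rewrite -(GA n)//.
  - by rewrite -[v](flipK (pred1 n)) [flip _ v]vw flipK.
  - by rewrite -[flip _ v]/(flip1 n v) GA.
  - by rewrite vw.
rewrite -!scalerBr -scalerN; congr (_ *: _).
by rewrite !fS f_flip// ![f n w + _]addrC !addrK /D' nN hD.2.
Qed.

End Martingale.

Lemma umd_cube : UMD X ->
  exists2 q : R, 1 < q & exists2 B : R, 0 < B & umd_cube_bound X q B.
Proof.
move=> [q [q1 [beta hb]]]; exists q => //.
have q0 : 0 < q by apply: lt_trans q1.
(* [beta] may be negative or zero, while [B] has to be positive. *)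
exists (`|beta| `^ q + 1); first by rewrite ltr_wpDl// powR_ge0.
move=> N D hD eps heps.
have := hb _ _ (@cube_prob R N) _ _ (cube_filtration N) (cube_martingale hD) eps N heps.
set D' := fun n w => if (n <= N)%N then D n w else 0.
have NE (g : cube N -> X) : ('N[@cube_prob R N]_q%:E[(fun x => `|g x|%:E)] =
    ((avg (fun w => `|g w| `^ q)%R) `^ q^-1)%R%:E)%E.
  rewrite unlock /Lnorm (eq_integral (fun w => (`|g w| `^ q)%R%:E)); last first.
    by move=> w _; rewrite abse_EFin normr_id poweR_EFin.
  rewrite integral_cube_prob ?poweR_EFin// => w; exact: powR_ge0.
rewrite !NE -EFinM lee_fin.
have E1 w : \sum_(n < N.+1) eps n *: mdiff (fun n w => \sum_(k < n.+1) D' k w) n w =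
    \sum_(n < N.+1) eps n *: D n w.
  apply: eq_bigr => -[[|n] /= nN] _; congr (_ *: _).
    by rewrite big_ord1.
  by rewrite [X in X - _]big_ord_recr/= addrAC subrr add0r /D' -ltnS nN.
have E2 w : \sum_(k < N.+1) D' k w = \sum_(n < N.+1) D n w.
  by apply: eq_bigr => k _; rewrite /D' -ltnS ltn_ord.
under eq_avg do rewrite E1.
under [X in _ <= _ * X `^ _ -> _]eq_avg do rewrite E2.
set a := avg _; set b := avg _ => h.
have a0 : 0 <= a by apply: avg_ge0 => w; exact: powR_ge0.
have b0 : 0 <= b by apply: avg_ge0 => w; exact: powR_ge0.
have rK c : 0 <= c -> (c `^ q^-1) `^ q = c.
  by move=> c0; rewrite -powRrM mulVf ?gt_eqF// powRr1.
have : a <= (`|beta| * b `^ q^-1) `^ q.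
  rewrite -[leLHS](rK _ a0); apply: powR_le; rewrite ?powR_ge0//; first exact: ltW.
  by apply: le_trans h _; rewrite ler_wpM2r ?powR_ge0// ler_norm.
rewrite powRM ?powR_ge0// rK// => /le_trans; apply.
by rewrite ler_wpM2r// lerDl.
Qed.

End UMDCube.

Lemma half_double (R : realType) (V : lmodType R) (v : V) : 2^-1 *: (v + v) = v.
Proof.
have -> : v + v = 2 *: v by rewrite scaler_nat mulr2n.
by rewrite scalerA mulVf ?scale1r.
Qed.

(** * Random norms in UMD spaces *)

Section RademacherNorm.
Context {R : realType} {X : completeNormedModType R}.
Context (q B : R) (q1 : 1 < q).
Context (umd : umd_cube_bound X q B).

Let q0 : 0 < q. Proof. exact: lt_trans q1. Qed.

Definition rq N (y : nat -> X) : R := avg (fun w : cube N => `|rsum N y w| `^ q).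

Definition mask (a : pred nat) (y : nat -> X) n := if a n then y n else 0.

Lemma rq_ge0 N y : 0 <= rq N y.
Proof. by apply: avg_ge0 => w; exact: powR_ge0. Qed.

Lemma eq_rq N (y z : nat -> X) : (forall n, (n < N)%N -> y n = z n) -> rq N y = rq N z.
Proof.
move=> yz; apply: eq_avg => w; congr (`| _ | `^ q).
by apply: eq_bigr => i _; rewrite yz.
Qed.

Lemma rq_scale N (c : R) y : rq N (fun n => c *: y n) = `|c| `^ q * rq N y.
Proof.
rewrite /rq -avgZ; apply: eq_avg => w; rewrite -powRM//; congr (_ `^ q).
rewrite -normrZ /rsum scaler_sumr; congr (`| _ |); apply: eq_bigr => i _.
by rewrite !scalerA mulrC.
Qed.

Lemma rq_add N y z : rq N (fun n => y n + z n) <= 2 `^ q * (rq N y + rq N z).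
Proof.
rewrite /rq -avgD -avgZ; apply: le_avg => w.
rewrite (_ : rsum N (fun n => y n + z n) w = rsum N y w + rsum N z w); last first.
  by rewrite /rsum -big_split; apply: eq_bigr => i _; rewrite scalerDr.
apply: le_trans (powR_add_le q0 (normr_ge0 _) (normr_ge0 _)).
by apply: powR_le; [exact: ltW| |exact: ler_normD].
Qed.

(** UMD for the differences [rad w n *: y n], shifted by one index because it is [D n.+1] that is
    odd in sign [n]. *)
Lemma rq_mult N (a : nat -> R) y : (forall n, `|a n| <= 1) ->
  rq N (fun n => a n *: y n) <= B * rq N y.
Proof.
move=> a1; pose D n (w : cube N) := if n is k.+1 then
  if (k < N)%N then rad w k *: y k else 0 else 0 : X.
have hD : mdiffs D.
  split=> [[|n] j w nj//=|n w nN /=]; last by rewrite nN rad_flip1// scaleNr.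
  by case: ifP => // nN; rewrite rad_flip1_neq// neq_ltn nj.
pose eps n := if n is k.+1 then a k else 0 : R.
have heps n : `|eps n| <= 1 by case: n => [|n] //=; rewrite normr0.
have := umd hD heps; congr (_ <= _ * _); apply: eq_avg => w; congr (`| _ | `^ q).
  rewrite big_ord_recl/= scale0r add0r; apply: eq_bigr => i _.
  by rewrite /= ltn_ord !scalerA mulrC.
by rewrite big_ord_recl/= add0r; apply: eq_bigr => i _; rewrite /= ltn_ord.
Qed.

Lemma powR_midpoint (V : normedModType R) (u v : V) :
  `|2^-1 *: (u + v)| `^ q <= 2^-1 * (`|u| `^ q + `|v| `^ q).
Proof.
set m := 2^-1 * (`|u| + `|v|).
have m0 : 0 <= m by rewrite mulr_ge0// addr_ge0.
apply: (@le_trans _ _ (m `^ q)).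
  apply: powR_le => //; first exact: ltW.
  by rewrite normrZ ger0_norm// ler_wpM2l// ler_normD.
have := powR_tangent q1 (normr_ge0 u) m0.
have := powR_tangent q1 (normr_ge0 v) m0.
have -> : `|v| - m = - (`|u| - m) by rewrite /m; field.
rewrite mulrN; lra.
Qed.

(** The masked sum is the mean of the full sum and the sum with signs reversed off [a]. Convexity
    gives the constant [1], which makes [rq] monotone in [N]. *)
Lemma rq_mask N (a : pred nat) y : rq N (mask a y) <= rq N y.
Proof.
have half (w : cube N) : rsum N (mask a y) w =
    2^-1 *: (rsum N y w + rsum N y (flip (predC a) w)).
  rewrite /rsum -big_split/= scaler_sumr; apply: eq_bigr => i _.
  rewrite /mask /rad bit_flip//=; case: (a i) => /=; rewrite ?addbF ?addbT.
    by rewrite half_double.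
  by rewrite scaler0 -scalerDl; case: bit; rewrite ?expr0 ?expr1 ?subrr ?addNr scale0r scaler0.
have -> : rq N y = avg (fun w : cube N => 2^-1 * (`|rsum N y w| `^ q +
    `|rsum N y (flip (predC a) w)| `^ q)).
  rewrite avgZ avgD (avg_flip (predC a) (fun w => `|rsum N y w| `^ q)).
  by rewrite -/(rq N y); field.
by apply: le_avg => w; rewrite half; exact: powR_midpoint.
Qed.

(** The larger cube consists of two copies of the smaller one, and the new sign has coefficient
    zero. *)
Lemma rqS N y : y N = 0 -> rq N.+1 y = rq N y.
Proof.
move=> yN; pose h (u : cube N * bool) : cube N.+1 :=
  [ffun i => if unlift ord_max i is Some j then u.1 j else u.2].
pose h' (w : cube N.+1) : cube N * bool :=
  ([ffun j => w (lift ord_max j)], w ord_max).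
have hK : cancel h h'.
  move=> [u b]; rewrite /h' /h; congr pair; last by rewrite ffunE unlift_none.
  by apply/ffunP => j; rewrite !ffunE liftK.
have h'K : cancel h' h.
  move=> w; apply/ffunP => i; rewrite !ffunE /=.
  by case: unliftP => [j ->|->]; rewrite ?ffunE.
rewrite /rq /avg (reindex h)/=; last by exists h' => ? _.
have E u b : `|rsum N.+1 y (h (u, b))| `^ q = `|rsum N y u| `^ q.
  rewrite rsumS yN scaler0 addr0; congr (`| _ | `^ q); apply: eq_bigr => i _.
  congr (_ *: _); rewrite /rad; congr (_ ^+ nat_of_bool _).
  rewrite bitE -[nat_of_ord i]/(nat_of_ord (widen_ord (leqnSn N) i)) bitE ffunE.
  case: unliftP => [j /(congr1 val)|/(congr1 val)] /=.
    by rewrite /bump leqNgt ltn_ord add0n => /val_inj ->.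
  by move=> /= iN; have := ltn_ord i; rewrite iN ltnn.
rewrite (eq_bigr (fun u => `|rsum N y u.1| `^ q)); last by case=> u b _; exact: E.
rewrite -(pair_bigA _ (fun u b => `|rsum N y u| `^ q))/=.
rewrite (eq_bigr (fun u => 2 * `|rsum N y u| `^ q)); last first.
  by move=> u _; rewrite big_bool/=; ring.
by rewrite -mulr_sumr exprS invfM mulrACA mulVf// mul1r.
Qed.

Lemma rq_widen N M y : (N <= M)%N -> (forall n, (N <= n)%N -> y n = 0) ->
  rq M y = rq N y.
Proof.
move=> NM y0; rewrite -(subnK NM); elim: (M - N)%N => [|k ih]; first by rewrite add0n.
by rewrite addSn rqS// y0// leq_addl.
Qed.

Lemma rq_mono N M y : (N <= M)%N -> rq N y <= rq M y.
Proof.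
move=> NM; rewrite (eq_rq (z := mask (fun n => n < N)%N y)); last first.
  by move=> n nN; rewrite /mask nN.
rewrite -(rq_widen NM); first exact: rq_mask.
by move=> n Nn; rewrite /mask ltnNge Nn.
Qed.

(* The UMD inequality for the differences [D] of the martingale generated by
   [f], with random signs independent of [D]; antisymmetry turns these signs
   into Rademacher variables decoupled from [D], and Jensen averages [D] out. *)
Lemma kconvex N (f : cube N -> X) :
  rq N (fun i => vavg (fun w => rad w i *: f w)) <= B * avg (fun w => `|f w| `^ q).
Proof.
(* [P i] averages out sign [i]; [E n], with the signs [N - 1] down to [n] averaged out, is the
   conditional expectation of [f] on the first [n] signs. *)
pose P i (g : cube N -> X) w := 2^-1 *: (g w + g (flip1 i w)).
pose fix cexp k := if k is k'.+1 then P (N - k)%N (cexp k') else f.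
pose E n := cexp (N - n)%N.
have EN : E N = f by rewrite /E subnn.
have ES n : (n < N)%N -> E n = P n (E n.+1).
  by move=> nN; rewrite /E subnS -[in LHS](prednK (n := N - n)) ?subn_gt0//=
    prednK ?subn_gt0// subKn// ltnW.
have Pflip i j g w : (forall w, g (flip1 j w) = g w) -> P i g (flip1 j w) = P i g w.
  by move=> gj; rewrite /P gj /flip1 flipC -!/(flip1 _ _) gj.
have Pflip_id i g w : P i g (flip1 i w) = P i g w.
  by rewrite /P /flip1 flipK addrC.
have Einv n j w : (n <= j)%N -> E n (flip1 j w) = E n w.
  have [|Nn] := leqP n N; last first.
    by move=> nj; rewrite flip1_ge// ltnW// (leq_trans Nn).
  move=> nN; rewrite -(subKn nN); elim: (N - n)%N j w => [|k ih] j w.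
    by rewrite subn0 => Nj; rewrite flip1_ge.
  have [kN|kN] := ltnP k N; last first.
    by move: ih; rewrite (eqP (kN : N - k == 0)%N) subnS (eqP (kN : N - k == 0)%N); apply.
  have kS : (N - k.+1).+1 = (N - k)%N by rewrite -subSn.
  have lt : (N - k.+1 < N)%N by rewrite -[X in (_ < X)%N](subnK kN) addnS ltnS leq_addr.
  rewrite (ES _ lt) kS leq_eqVlt => /predU1P[<-|lj]; first exact: Pflip_id.
  by apply: Pflip => v; apply: ih; rewrite -kS.
pose D n w := if n is k.+1 then E k.+1 w - E k w else E 0%N w.
have hD : mdiffs D.
  split=> [[|n] j w nj|n w nN] /=; first exact: Einv.
    by rewrite !Einv// ltnW.
  rewrite [E n _]Einv// opprB; apply/eqP.
  rewrite subr_eq addrAC eq_sym subr_eq; apply/eqP.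
  by rewrite ES// /P -scalerDr half_double addrC.
have sumD w : \sum_(n < N.+1) D n w = f w.
  rewrite -EN; have : forall n, \sum_(k < n.+1) D k w = E n w; last exact.
  by elim=> [|n ih]; [rewrite big_ord1|rewrite big_ord_recr/= ih addrC subrK].
(* Averaging out signs beyond [i] keeps the correlation with sign [i], while [E i] does not see that
   sign. Hence [D i.+1] has the same [i]-th Rademacher coefficient as [f]. *)
have radE i n : (i < n)%N -> (n <= N)%N ->
    \sum_w rad w i *: E n w = \sum_w rad w i *: f w.
  move=> + nN; rewrite -EN -{1 2}(subKn nN); elim: (N - n)%N => [|k ih]; first by rewrite subn0.
  have [kN|kN] := ltnP k N; last first.
    by move: ih; rewrite (eqP (kN : N - k == 0)%N) subnS (eqP (kN : N - k == 0)%N); apply.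
  move=> iN; have kS : (N - k.+1).+1 = (N - k)%N by rewrite -subSn.
  have lt : (N - k.+1 < N)%N by rewrite -[X in (_ < X)%N](subnK kN) addnS ltnS leq_addr.
  rewrite -ih ?(leq_trans iN)// -?kS// (ES _ lt) kS.
  rewrite /P (eq_bigr (fun w => 2^-1 *: (rad w i *: E (N - k)%N w) +
     2^-1 *: (rad (flip1 (N - k.+1) w) i *: E (N - k)%N (flip1 (N - k.+1) w)))); last first.
    move=> w _; rewrite rad_flip1_neq ?neq_ltn ?iN//.
    by rewrite -scalerDr -scalerDr !scalerA mulrC.
  rewrite big_split/= (sum_flip (pred1 (N - k.+1)%N) (fun w => 2^-1 *: (rad w i *: E (N - k)%N w))).
  rewrite -big_split/=; apply: eq_bigr => w _; rewrite -scalerDl.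
  by rewrite (_ : 2^-1 + 2^-1 = 1) ?scale1r//; field.
have radD i : (i < N)%N -> vavg (fun w => rad w i *: D i.+1 w) = vavg (fun w => rad w i *: f w).
  move=> iN; rewrite /vavg; congr (_ *: _).
  under eq_bigr do rewrite /= scalerBr.
  rewrite sumrB radE// [X in _ - X](avg_antisym (j := i)) ?subr0// => w.
  by rewrite rad_flip1// scaleNr Einv.
have step (e : cube N) : avg (fun w => `|\sum_(i < N) rad e i *: D i.+1 w| `^ q) <=
    B * avg (fun w => `|f w| `^ q).
  pose eps n := if n is k.+1 then rad e k else 0 : R.
  have heps n : `|eps n| <= 1 by case: n => [|n] /=; rewrite ?normr0 ?norm_rad.
  have := umd hD heps; congr (_ <= _ * _); apply: eq_avg => w; last by rewrite sumD.
  by rewrite big_ord_recl/= scale0r add0r.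
have := le_avg step; rewrite avg_cst avg_exchange.
(* Translating [e] by [w] inserts the factor [rad w i] into each term without changing the average
   over [e]. *)
apply: le_trans; rewrite (eq_avg (g := fun w => avg (fun e : cube N =>
    `|\sum_(i < N) rad e i *: (rad w i *: D i.+1 w)| `^ q))); last first.
  move=> w; rewrite -[LHS](avg_flip (bit w)); apply: eq_avg => e.
  congr (`| _ | `^ q); apply: eq_bigr => i _.
  by rewrite rad_flip// scalerA mulrC.
rewrite avg_exchange; apply: le_avg => e.
apply: le_trans (jensen _ q1); rewrite le_eqVlt; apply/orP; left; apply/eqP.
congr (`| _ | `^ q); rewrite /rsum /vavg exchange_big scaler_sumr.
apply: eq_bigr => i _; rewrite -[X in _ *: X](radD i)// /vavg -scaler_sumr.
by rewrite !scalerA mulrC.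
Qed.

End RademacherNorm.

(** * Vanishing tails of bounded Rademacher series *)

Section Tails.
Context {R : realType} {X : completeNormedModType R}.
Context (q B : R) (q1 : 1 < q) (B0 : 0 < B) (umd : umd_cube_bound X q B).

Lemma rq_zero N : rq q N (fun=> 0 : X) = 0.
Proof.
rewrite /rq (eq_avg (g := fun=> 0)) ?avg_cst// => w.
rewrite /rsum big1; first by rewrite normr0 powR0// gt_eqF// (lt_trans _ q1).
by move=> i _; rewrite scaler0.
Qed.

(* If the conclusion fails there are [2 ^ J] consecutive blocks [Y_k] of the
   Rademacher series, indexed by the vertices [k] of the cube, of size at least
   [delta].  The Rademacher projection of the bounded function
   [eta |-> \sum_k sgn (eta . k) Y_k] has at [eta] a [Y_eta]-component of
   order [sqrt J]. *)
Lemma rq_tail (y : nat -> X) (C delta : R) : 0 < delta ->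
  (forall N, rq q N y <= C) ->
  exists N0, forall m, rq q m (mask (leq N0) y) <= delta.
Proof.
move=> delta0 yC; apply: contrapT => /forallNP h.
have /choice[g hg] : forall a, exists m, delta < rq q m (mask (leq a) y).
  by move=> a; have /existsNP[m] := h a; move/negP; rewrite -ltNge; exists m.
have ag a : (a < g a)%N.
  rewrite ltnNge; apply/negP => ga; have := hg a.
  rewrite (@eq_rq _ _ q _ _ (fun=> 0)); first by rewrite rq_zero ltNge (ltW delta0).
  by move=> n nga; rewrite /mask leqNgt (leq_trans nga ga).
pose Nk k := iter k g 0%N.
have NkS k : (Nk k < Nk k.+1)%N by exact: ag.
have Nk_mono k l : (k <= l)%N -> (Nk k <= Nk l)%N.
  move=> /subnK <-; elim: (l - k)%N => [|i ih]; first by rewrite add0n.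
  by rewrite addSn; apply: leq_trans ih (ltnW _); exact: NkS.
(* [j * delta] is to exceed the K-convexity bound. With [J = 4 * j ^ 2] signs, Khintchine's lower
   bound [sqrt J / 2] is exactly [j]. *)
pose j := (Num.truncn (B * (B * C) / delta)).+1.
have jP : B * (B * C) < j%:R * delta.
  by rewrite -ltr_pdivrMr//; exact: truncnS_gt.
pose J := (4 * j ^ 2)%N; pose K := #|{: cube J}|; pose M := Nk K.
pose blk n := count (fun k => Nk k.+1 <= n)%N (iota 0 K).
have blkE k n : (k < K)%N -> (Nk k <= n < Nk k.+1)%N -> blk n = k.
  move=> kK /andP[kn nk]; rewrite /blk -(subnKC (ltnW kK)) iotaD count_cat.
  rewrite (eq_in_count (a2 := xpredT)) ?count_predT ?size_iota.
    rewrite (eq_in_count (a2 := xpred0)) ?count_pred0 ?addn0// => i.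
    rewrite mem_iota add0n => /andP[ki _]; apply/negbTE; rewrite -ltnNge.
    by apply: leq_trans nk _; exact: Nk_mono.
  move=> i; rewrite mem_iota add0n => /= ik; apply: leq_trans kn.
  exact: (Nk_mono i.+1 k).
pose idx n : cube J := nth [ffun=> false] (enum {: cube J}) (blk n).
pose sg (eta k : cube J) : R := Num.sg (\sum_(i < J) rad eta i * rad k i).
have sg1 eta k : `|sg eta k| <= 1 by rewrite normr_sg lern1 leq_b1.
pose f (e : cube M) (eta : cube J) := rsum M (fun n => sg eta (idx n) *: y n) e.
pose b (eta : cube J) n :=
  \sum_(i < J) rad eta i * avg (fun eta' : cube J => rad eta' i * sg eta' (idx n)).
(* On the block of [eta] itself the projection of the sign function, taken at [eta], is the mean of
   the absolute value of [\sum_i rad w i * rad eta i], since a number times its sign is its absolute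
   value. *)
have bE eta n : idx n = eta -> j%:R <= b eta n.
  move=> idxn; have := khintchine J (fun i => rad eta i : R).
  rewrite (eq_bigr (fun=> 1)); last by move=> i _; rewrite expr2 rad_sqr.
  rewrite sumr_const card_ord /J -[_ *+ _]/(_%:R) natrM natrX.
  rewrite (_ : 4%:R * j%:R ^+ 2 = (2 * j%:R) ^+ 2 :> R); last by ring.
  rewrite sqrtr_sqr ger0_norm ?mulr_ge0// ler_pM2l// => /le_trans; apply.
  rewrite /b idxn (eq_bigr (fun i : 'I_J => avg (fun w : cube J =>
      rad eta i * (rad w i * sg w eta)))); last by move=> i _; rewrite avgZ.
  rewrite -avg_sum; apply: le_avg => w.
  set u : R := \sum_(i < J) rad w i * rad eta i.
  rewrite (_ : `|rsum J _ w| = `|u|)// normrEsg -[Num.sg u]/(sg w eta) /u mulr_sumr.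
  by apply: eq_ler; apply: eq_bigr => i _; ring.
have fE e i : vavg (fun eta : cube J => rad eta i *: f e eta) =
    rsum M (fun n => avg (fun eta : cube J => rad eta i * sg eta (idx n)) *: y n) e.
  rewrite /vavg /f /rsum; under eq_bigr do rewrite scaler_sumr.
  rewrite exchange_big scaler_sumr; apply: eq_bigr => n _.
  rewrite (eq_bigr (fun eta : cube J => (rad eta i * sg eta (idx n)) *: (rad e n *: y n))).
    by rewrite -scaler_suml /avg !scalerA; congr (_ *: _); ring.
  by move=> eta _; rewrite !scalerA; congr (_ *: _); ring.
(* K-convexity in [eta], for each fixed [e], bounds the projection; the multipliers [sg] cost the
   other factor [B]. *)
have upper : avg (fun eta => rq q M (fun n => b eta n *: y n)) <= B * (B * C).
  have h1 (e : cube M) := kconvex q1 umd (f e).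
  have := le_avg h1; rewrite avgZ.
  rewrite (avg_exchange (fun (e : cube M) (eta : cube J) => `|f e eta| `^ q)).
  have h2 : avg (fun eta : cube J => avg (fun e : cube M => `|f e eta| `^ q)) <= B * C.
    rewrite -(avg_cst J (B * C)); apply: le_avg => eta.
    apply: le_trans (@rq_mult _ _ q B umd M (fun n => sg eta (idx n)) y _) _ => //.
    by rewrite ler_pM2l.
  move=> h3; apply: le_trans (ler_wpM2l (ltW B0) h2); apply: le_trans h3.
  rewrite /rq avg_exchange; apply: le_avg => e; apply: le_avg => eta.
  apply: powR_le => //; first by apply: ltW; apply: lt_trans q1.
  rewrite le_eqVlt; apply/orP; left; apply/eqP; congr `| _ |.
  rewrite [RHS]/rsum; under [RHS]eq_bigr do rewrite fE.
  rewrite /rsum; under [RHS]eq_bigr do rewrite scaler_sumr.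
  rewrite exchange_big; apply: eq_bigr => n _ /=.
  rewrite /b scaler_suml scaler_sumr; apply: eq_bigr => i _.
  by rewrite !scalerA; congr (_ *: _); ring.
(* Only the block of [eta] is kept. There the coefficient is constant and at least [j], and [j >= 1]
   makes its [q]-th power at least [j]. *)
have lower (eta : cube J) : j%:R * delta <= rq q M (fun n => b eta n *: y n).
  pose k := index eta (enum {: cube J}).
  have kK : (k < K)%N by rewrite /K cardE index_mem mem_enum.
  pose P n := (Nk k <= n < Nk k.+1)%N.
  have Pidx n : P n -> idx n = eta.
    by move=> Pn; rewrite /idx (blkE _ _ kK Pn) nth_index// mem_enum.
  apply: le_trans (rq_mask q1 _ P _).
  have b0 n : P n -> b eta n = b eta (Nk k).
    move=> Pn; rewrite /b (Pidx _ Pn) Pidx// /P leqnn/=; exact: NkS.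
  rewrite (@eq_rq _ _ q _ _ (fun n => b eta (Nk k) *: mask P y n)); last first.
    by move=> n _; rewrite /mask; case: ifPn => [/b0->//|]; rewrite scaler0.
  rewrite rq_scale.
  have jb : j%:R <= b eta (Nk k) by apply: bE; apply: Pidx; rewrite /P leqnn; exact: NkS.
  apply: ler_pM; rewrite ?(ltW delta0)//.
    apply: (@le_trans _ _ (j%:R `^ q)).
      by apply: le1r_powR; [rewrite ler1n|exact: ltW].
    apply: powR_le => //; first by apply: ltW; apply: lt_trans q1.
    by apply: le_trans jb _; exact: ler_norm.
  rewrite (@rq_widen _ _ q (Nk k.+1)); last 2 first.
  - exact: (Nk_mono k.+1 K).
  - by move=> n kn; rewrite /mask /P [(n < _)%N]ltnNge kn andbF.
  rewrite (@eq_rq _ _ q _ _ (mask (leq (Nk k)) y)); first exact/ltW/hg.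
  by move=> n nk; rewrite /mask /P nk andbT.
have := le_avg lower; rewrite avg_cst => /le_trans/(_ upper).
by rewrite leNgt jP.
Qed.

End Tails.

(** * The lattice square function *)

Section SquareFunction.
Context {R : realType} {X : banachLatticeType R}.
Context (q B : R) (q1 : 1 < q) (B0 : 0 < B) (umd : umd_cube_bound X q B).
Context (N : nat) (x : 'I_N -> X) (y : nat -> X) (xy : forall i : 'I_N, x i = y i).
Implicit Types (t : 'rV[R]_N) (g h : 'rV[R]_N -> R).
Local Notation "u <=_L v" := (bl_le u v) (at level 70).
Local Notation hc := homogeneous_continuous.

Let q0 : 0 < q. Proof. exact: lt_trans q1. Qed.

Let Phi := krivine x.
Let s t : R := Num.sqrt (\sum_(i < N) `|t ord0 i| ^+ 2).

Let coor n t : R := if insub n is Some i then t ord0 i else 0.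

Let coorE (i : 'I_N) t : coor i t = t ord0 i.
Proof. by rewrite /coor valK. Qed.

Let hc_coor n : hc (coor n).
Proof.
rewrite /coor; case: insub => [i|]; first exact: homogeneous_continuous_coord.
exact: homogeneous_continuous0.
Qed.

Let hc_lin (a : R) g h : hc g -> hc h -> hc (fun t => a * g t + h t).
Proof. exact: homogeneous_continuous_lin. Qed.

Let hcZ (a : R) g : hc g -> hc (fun t => a * g t).
Proof.
move=> hg; have := hc_lin a hg (@homogeneous_continuous0 R N).
by congr hc; apply/funext => t; rewrite addr0.
Qed.

Let hc_sum (I : Type) (l : seq I) (g : I -> 'rV[R]_N -> R) :
  (forall i, hc (g i)) -> hc (fun t => \sum_(i <- l) g i t).
Proof.
move=> hg; elim: l => [|i l ih].
  have := @homogeneous_continuous0 R N; congr hc; apply/funext => t.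
  by rewrite big_nil.
have := hc_lin 1 (hg i) ih; congr hc; apply/funext => t.
by rewrite big_cons mul1r.
Qed.

Let hc_max g h : hc g -> hc h -> hc (fun t => Num.max (g t) (h t)).
Proof. exact: homogeneous_continuous_max. Qed.

Let hc_min g h : hc g -> hc h -> hc (fun t => Num.min (g t) (h t)).
Proof.
move=> hg hh; have := hcZ (-1) (hc_max (hcZ (-1) hg) (hcZ (-1) hh)).
by congr hc; apply/funext => t; rewrite !mulN1r -oppr_min opprK.
Qed.

Let hc_s : hc s.
Proof.
split=> [t|a t a0]; last first.
  rewrite /s (eq_bigr (fun i => a ^+ 2 * `|t ord0 i| ^+ 2)).
    by rewrite -mulr_sumr sqrtrM ?sqr_ge0// sqrtr_sqr ger0_norm.
  by move=> i _; rewrite mxE normrM exprMn (ger0_norm a0).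
apply: (@continuous_comp _ _ _ (fun t : 'rV[R]_N => \sum_(i < N) `|t ord0 i| ^+ 2) Num.sqrt).
  apply: continuous_sumr => i u.
  have nc : `|t ord0 i| @[t --> u] --> `|u ord0 i|.
    exact: (cvg_norm (@coord_continuous R 1 N ord0 i u)).
  exact: (cvgM nc nc).
exact: sqrt_continuous.
Qed.

Let PhiP : is_krivine_calculus x Phi. Proof. exact: krivineP. Qed.

Let Phi_lin (a : R) g h : hc g -> hc h ->
  Phi (fun t => a * g t + h t) = a *: Phi g + Phi h.
Proof. by case: PhiP => _ + _ _; apply. Qed.

Let Phi0 : Phi (fun=> 0) = 0.
Proof.
have h0 := @homogeneous_continuous0 R N.
have := Phi_lin (-1) h0 h0; rewrite scaleN1r addNr => <-.
by congr Phi; apply/funext => t; rewrite mulr0 addr0.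
Qed.

Let PhiZ (a : R) g : hc g -> Phi (fun t => a * g t) = a *: Phi g.
Proof.
move=> hg; have := Phi_lin a hg (@homogeneous_continuous0 R N).
rewrite Phi0 addr0 => <-; by congr Phi; apply/funext => t; rewrite addr0.
Qed.

Let Phi_sum (I : Type) (l : seq I) (g : I -> 'rV[R]_N -> R) :
  (forall i, hc (g i)) ->
  Phi (fun t => \sum_(i <- l) g i t) = \sum_(i <- l) Phi (g i).
Proof.
move=> hg; elim: l => [|i l ih].
  by rewrite big_nil -[RHS]Phi0; congr Phi; apply/funext => t; rewrite big_nil.
rewrite big_cons -ih -[Phi (g i)]scale1r -Phi_lin//; last exact: hc_sum.
by congr Phi; apply/funext => t; rewrite big_cons mul1r.
Qed.

Let Phi_mono g h : hc g -> hc h -> (forall t, g t <= h t) -> Phi g <=_L Phi h.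
Proof.
move=> hg hh gh; have [_ _ Pmax _] := PhiP.
have <- : Phi (fun t => Num.max (g t) (h t)) = Phi h.
  by congr Phi; apply/funext => t; rewrite max_r.
by rewrite Pmax//; exact: bl_joinl.
Qed.

Let hcN g : hc g -> hc (fun t => - g t).
Proof.
by move=> /(hcZ (-1)); congr hc; apply/funext => t; rewrite mulN1r.
Qed.

Let PhiN g : hc g -> Phi (fun t => - g t) = - Phi g.
Proof.
move=> hg; rewrite -scaleN1r -PhiZ//; congr Phi; apply/funext => t.
by rewrite mulN1r.
Qed.

Let absE g : (fun t => `|g t|) = (fun t => Num.max (g t) (- g t)).
Proof.
apply/funext => t; have [g0|g0] := leP 0 (g t).
  by rewrite ger0_norm// max_l// ge0_cp.
by rewrite ltr0_norm// max_r// lt0_cp.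
Qed.

Let hc_abs g : hc g -> hc (fun t => `|g t|).
Proof. by move=> hg; rewrite absE; apply: hc_max => //; exact: hcN. Qed.

Let Phi_abs g : hc g -> Phi (fun t => `|g t|) = labs (Phi g).
Proof.
move=> hg; have [_ _ Pmax _] := PhiP.
by rewrite absE Pmax ?PhiN//; exact: hcN.
Qed.

Let Phi_norm_le g h : hc g -> hc h -> (forall t, `|g t| <= h t) ->
  `|Phi g| <= `|Phi h|.
Proof.
move=> hg hh gh; apply: bl_norm_le.
- rewrite -Phi0; apply: Phi_mono => // [|t]; first exact: homogeneous_continuous0.
  by apply: le_trans (gh t).
- by apply: Phi_mono => // t; apply: le_trans (gh t); exact: ler_norm.
- rewrite -PhiN//; apply: Phi_mono => // [|t]; first exact: hcN.
  by apply: le_trans (gh t); rewrite -normrN ler_norm.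
Qed.

Let gsum (b : nat -> 'rV[R]_N -> R) (w : cube N) t : R :=
  rsum (V := R^o) N (fun n => b n t) w.

Let hc_gsum b w : (forall n, hc (b n)) -> hc (gsum b w).
Proof. by move=> hb; apply: hc_sum => i; exact: hcZ. Qed.

Let Phi_gsum b w : (forall n, hc (b n)) ->
  Phi (gsum b w) = rsum N (fun n => Phi (b n)) w.
Proof.
move=> hb; rewrite /gsum /rsum Phi_sum; last by move=> i; exact: hcZ.
by apply: eq_bigr => i _; exact: PhiZ.
Qed.

Let s_sqr t : s t ^+ 2 = \sum_(i < N) t ord0 i ^+ 2.
Proof.
rewrite sqr_sqrtr; last by apply: sumr_ge0 => i _; exact: sqr_ge0.
by apply: eq_bigr => i _; rewrite real_normK ?num_real.
Qed.

Let s_ge0 t : 0 <= s t. Proof. exact: sqrtr_ge0. Qed.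

(** The cube is finite, so both sides of the scalar Khintchine inequality lie in the domain of the
    calculus. After applying [Phi], the triangle inequality in [X] and Jensen move the norm and the
    power inside the average. *)
Lemma lattice_l2_le_rq : `|lattice_l2 x| `^ q <= 2 `^ q * rq q N y.
Proof.
rewrite -[lattice_l2 x]/(Phi s).
have key : `|Phi s| <= 2 * avg (fun w : cube N => `|rsum N y w|).
  have hg (w : cube N) : hc (fun t => `|gsum coor w t|).
    by apply: hc_abs; exact: hc_gsum.
  pose A t := 2 * ((2 ^+ N)^-1 * \sum_(w : cube N) `|gsum coor w t|).
  have hA : hc A by do 2 apply: hcZ; exact: hc_sum.
  have sA : `|Phi s| <= `|Phi A|.
    apply: Phi_norm_le; [exact: hc_s|exact: hA|move=> t]; rewrite ger0_norm//.
    rewrite -[A t]/(2 * avg (fun w : cube N => `|gsum coor w t|)).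
    apply: le_trans (khintchine N (fun n => coor n t)); apply: eq_ler.
    congr Num.sqrt; apply: eq_bigr => i _.
    by rewrite coorE real_normK ?num_real.
  apply: le_trans sA _.
  rewrite /A PhiZ ?PhiZ ?Phi_sum//; [|exact: hc_sum|by apply: hcZ; exact: hc_sum].
  rewrite !normrZ !ger0_norm// ?exp2V_ge0//; rewrite ler_pM2l// /avg.
  apply: ler_wpM2l; first exact: exp2V_ge0.
  apply: le_trans (ler_norm_sum _ _ _) _; apply: ler_sum => w _.
  rewrite Phi_abs; last exact: hc_gsum.
  rewrite norm_labs Phi_gsum// le_eqVlt; apply/orP; left; apply/eqP.
  congr `| _ |; apply: eq_bigr => i _; rewrite -xy; congr (_ *: _).
  have [<- _ _ _] := PhiP; congr Phi; apply/funext => t; exact: coorE.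
apply: (@le_trans _ _ ((2 * avg (fun w : cube N => `|rsum N y w|)) `^ q)).
  by apply: powR_le => //; exact: ltW.
rewrite powRM//; last exact: avg_ge0.
apply: ler_wpM2l; first exact: powR_ge0.
have a0 : 0 <= avg (fun w : cube N => `|rsum N y w|) by exact: avg_ge0.
have := jensen (V := R^o) (fun w : cube N => `|rsum N y w|) q1.
rewrite -[vavg _]/(avg (fun w : cube N => `|rsum N y w|)) (ger0_norm a0) => /le_trans; apply.
by apply: le_avg => w; rewrite normr_id.
Qed.

Let clip (g : 'rV[R]_N -> R) t := Num.max (Num.min (g t) (7 * s t)) (- (7 * s t)).

Let hc_clip g : hc g -> hc (clip g).
Proof.
by move=> hg; apply: hc_max; [apply: hc_min; [exact: hg|exact: hcZ hc_s]|
  by apply: hcN; exact: hcZ hc_s].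
Qed.

Let clip_le g t : `|clip g t| <= 7 * s t.
Proof.
rewrite /clip ler_norml; have := s_ge0 t.
case: (leP (g t) (7 * s t)) => h1 s0;
  case: (leP _ (- (7 * s t))) => h2; apply/andP; split; lra.
Qed.

(** Where the cut at [7 * s] is active, the excess is at most [g ^ 2 / (7 * s)]: the fourth moment
    pays for the mean square error. The second bound serves the points with [s t = 0]. *)
Let clip_err g t : 49 * s t ^+ 2 * (g t - clip g t) ^+ 2 <= g t ^+ 4 /\
  (g t - clip g t) ^+ 2 <= g t ^+ 2.
Proof.
rewrite /clip; have := s_ge0 t; set u := g t; set L := s t => L0.
case: (leP u (7 * L)) => h1; [case: (leP u (- (7 * L))) => h2|
  case: (leP (7 * L) (- (7 * L))) => h2].
- have h3 : 0 <= - u by lra.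
  have h4 : 0 <= - u - 7 * L by lra.
  have k1 : 0 <= - u * (7 * L) by rewrite mulr_ge0//; lra.
  have k2 : (- u - 7 * L) * (7 * L) <= u ^+ 2 by nra.
  have k3 : 0 <= (- u - 7 * L) * (7 * L) by rewrite mulr_ge0//; lra.
  split; last by nra.
  have := ler_pM k3 k3 k2 k2.
  rewrite (_ : u ^+ 4 = u ^+ 2 * u ^+ 2); last by ring.
  by apply: le_trans; apply: eq_ler; ring.
- by rewrite subrr expr0n mulr0 sqr_ge0 (_ : u ^+ 4 = (u ^+ 2) ^+ 2) ?sqr_ge0//; ring.
- have L00 : L = 0 by lra.
  by rewrite L00 !(mulr0, expr0n, mul0r, oppr0, subr0) lexx (_ : u ^+ 4 = (u ^+ 2) ^+ 2) ?sqr_ge0//; ring.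
- have k1 : 0 <= u * (7 * L) by rewrite mulr_ge0//; lra.
  have k2 : (u - 7 * L) * (7 * L) <= u ^+ 2 by nra.
  have k3 : 0 <= (u - 7 * L) * (7 * L) by rewrite mulr_ge0//; lra.
  split; last by nra.
  have := ler_pM k3 k3 k2 k2.
  rewrite (_ : u ^+ 4 = u ^+ 2 * u ^+ 2); last by ring.
  by apply: le_trans; apply: eq_ler; ring.
Qed.

(* Truncating the scalar Rademacher sums at [7 s] changes the coefficients [b]
   by at most [s / 4] in the Euclidean norm, while the truncated sums, being
   bounded by [7 s] in the lattice, are controlled by [kconvex]. *)
Let rest (b : nat -> 'rV[R]_N -> R) n t : R :=
  b n t - avg (fun w : cube N => rad w n * clip (gsum b w) t).

Let hc_rest b n : (forall n, hc (b n)) -> hc (rest b n).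
Proof.
move=> hb; have h1 : hc (fun t => avg (fun w : cube N => rad w n * clip (gsum b w) t)).
  by apply: hcZ; apply: hc_sum => w; apply: hcZ; apply: hc_clip; exact: hc_gsum.
have := hc_lin (-1) h1 (hb n); congr hc; apply/funext => t.
by rewrite mulN1r addrC.
Qed.

(** Bessel bounds the left side by [16] times the mean square of the truncation error, which is at
    most [3 / 49 * s ^ 2] by the fourth moment; [7] is large enough because [16 * 3 <= 49]. The
    coefficients [4 * rest] satisfy the hypothesis on [b] again, which allows iteration. *)
Let rest_small (b : nat -> 'rV[R]_N -> R) t : \sum_(i < N) b i t ^+ 2 <= s t ^+ 2 ->
  \sum_(i < N) (4 * rest b i t) ^+ 2 <= s t ^+ 2.
Proof.
move=> bs; pose E (w : cube N) := gsum b w t - clip (gsum b w) t.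
have [m2 m4] := rsum_moments (fun n => b n t) (leqnn N).
have restE (i : 'I_N) : rest b i t = avg (fun w => rad w i * E w).
  rewrite (eq_avg (g := fun w : cube N => rad w i * gsum b w t -
      rad w i * clip (gsum b w) t)); last by move=> w; rewrite /E mulrBr.
  rewrite avgB /rest; congr (_ - _).
  rewrite (eq_avg (g := fun w : cube N => \sum_(j < N) b j t * (rad w i * rad w j))).
    rewrite avg_sum (bigD1 i)//= avgZ avg_rad_rad// eqxx mulr1 big1 ?addr0// => j ji.
    by rewrite avgZ avg_rad_rad// eq_sym (inj_eq val_inj) (negPf ji) mulr0.
  move=> w; rewrite /gsum /rsum mulr_sumr; apply: eq_bigr => j _.
  by rewrite -[_ *: _]/(_ * _); ring.
have bes : \sum_(i < N) rest b i t ^+ 2 <= avg (fun w => E w ^+ 2).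
  apply: le_trans (rademacher_bessel _); apply: eq_ler; apply: eq_bigr => i _.
  by rewrite restE.
rewrite (eq_bigr (fun i : 'I_N => 16 * rest b i t ^+ 2)); last by move=> i _; ring.
rewrite -mulr_sumr.
have e2 : avg (fun w => E w ^+ 2) <= s t ^+ 2.
  by apply: le_trans bs; rewrite -m2; apply: le_avg => w; have [] := clip_err (gsum b w) t.
have e4 : 49 * s t ^+ 2 * avg (fun w => E w ^+ 2) <= 3 * (s t ^+ 2) ^+ 2.
  rewrite -avgZ; apply: (@le_trans _ _ (3 * (\sum_(i < N) b i t ^+ 2) ^+ 2)).
    by apply: le_trans m4; apply: le_avg => w; have [] := clip_err (gsum b w) t.
  rewrite ler_pM2l// ler_sqr ?nnegrE ?sqr_ge0//.
  by apply: sumr_ge0 => i _; exact: sqr_ge0.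
have [s0|s0] := eqVneq (s t) 0.
  by move: e2 bes; rewrite s0 expr0n /=; lra.
have sp : 0 < s t ^+ 2 by rewrite exprn_even_gt0.
have : 49 * avg (fun w => E w ^+ 2) <= 3 * s t ^+ 2.
  rewrite -(ler_pM2r sp); move: e4; lra.
move: bes sp; lra.
Qed.

Let S := `|Phi s| `^ q.

(** One truncation costs a multiple of [S] through [kconvex] and leaves [4^-1] times coefficients of
    the same kind, with weight [2 ^ q * 4 ^ (- q) <= 1 / 2]; the geometric series gives the factor
    [2]. The iteration starts from a crude triangle inequality over [N] terms. *)
Let rq_Phi_le k : forall b : nat -> 'rV[R]_N -> R, (forall n, hc (b n)) ->
  (forall t, \sum_(i < N) b i t ^+ 2 <= s t ^+ 2) ->
  rq q N (fun n => Phi (b n)) <=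
  2 * (2 `^ q * B * 7 `^ q) * S + 2^-1 ^+ k * (N%:R `^ q * S).
Proof.
have S0 : 0 <= S by exact: powR_ge0.
have K0 : 0 <= 2 `^ q * B * 7 `^ q.
  by rewrite mulr_ge0 ?powR_ge0// mulr_ge0 ?powR_ge0// ltW.
elim: k => [|k ih] b hb bs.
  rewrite expr0 mul1r; apply: (@le_trans _ _ (N%:R `^ q * S)); last first.
    by rewrite lerDr mulr_ge0// mulr_ge0.
  rewrite /S -powRM// -[leRHS](avg_cst N); apply: le_avg => w.
  apply: powR_le => //; first exact: ltW.
  apply: le_trans (ler_norm_sum _ _ _) _.
  rewrite mulr_natl -[N in _ *+ N]card_ord -sumr_const; apply: ler_sum => i _.
  rewrite normrZ norm_rad mul1r; apply: Phi_norm_le; [exact: hb|exact: hc_s|move=> t].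
  rewrite -(ler_sqr (x := `|b i t|)) ?nnegrE// real_normK ?num_real//.
  apply: le_trans (bs t); rewrite (bigD1 i)//= lerDl.
  by apply: sumr_ge0 => j _; exact: sqr_ge0.
have hG w : hc (clip (gsum b w)) by apply: hc_clip; exact: hc_gsum.
have hr n : hc (rest b n) by exact: hc_rest.
have PhibE n : Phi (b n) = vavg (fun w : cube N => rad w n *: Phi (clip (gsum b w))) +
    4^-1 *: Phi (fun t => 4 * rest b n t).
  have h1 : hc (fun t => avg (fun w : cube N => rad w n * clip (gsum b w) t)).
    by apply: hcZ; apply: hc_sum => w; exact: hcZ.
  rewrite PhiZ// scalerA mulVf// scale1r /vavg.
  have -> : (2 ^+ N)^-1 *: \sum_w rad w n *: Phi (clip (gsum b w)) =
      Phi (fun t => avg (fun w : cube N => rad w n * clip (gsum b w) t)).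
    rewrite /avg PhiZ; last by apply: hc_sum => w; exact: hcZ.
    rewrite Phi_sum; last by move=> w; exact: hcZ.
    by congr (_ *: _); apply: eq_bigr => w _; rewrite PhiZ.
  rewrite -[X in X + _]scale1r -Phi_lin//; congr Phi; apply/funext => t.
  by rewrite /rest mul1r addrC subrK.
rewrite (@eq_rq _ _ q N _ _ (fun n _ => PhibE n)).
apply: le_trans (rq_add q1 _ _ _) _.
rewrite [rq q N (fun n => 4^-1 *: _)]rq_scale.
have h1 := kconvex q1 umd (fun w : cube N => Phi (clip (gsum b w))).
have h2 : avg (fun w : cube N => `|Phi (clip (gsum b w))| `^ q) <= 7 `^ q * S.
  rewrite -[leRHS](avg_cst N); apply: le_avg => w; rewrite -powRM//.
  apply: powR_le => //; first exact: ltW.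
  rewrite (_ : 7 * `|Phi s| = `|Phi (fun t => 7 * s t)|); last first.
    by rewrite PhiZ ?normrZ ?ger0_norm//; exact: hc_s.
  apply: Phi_norm_le; [exact: hG|exact: hcZ hc_s|move=> t; exact: clip_le].
have h3 := ih (fun n t => 4 * rest b n t) (fun n => hcZ 4 (hr n))
  (fun t => rest_small (bs t)).
have h4 : 2 `^ q * `|4^-1| `^ q <= 2^-1 :> R.
  rewrite -powRM// ger0_norm// (_ : 2 * 4^-1 = 2^-1 :> R); last by field.
  by apply: ge1r_powR; [rewrite invr_gt0 ltr0n invf_le1// ler1n|exact: ltW].
have p2 : 0 <= 2 `^ q :> R by exact: powR_ge0.
apply: (@le_trans _ _ (2 `^ q * (B * (7 `^ q * S)) + (2 `^ q * `|4^-1| `^ q) *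
    (2 * (2 `^ q * B * 7 `^ q) * S + 2^-1 ^+ k * (N%:R `^ q * S)))).
  rewrite mulrDr; apply: lerD.
    by apply: ler_wpM2l => //; apply: le_trans h1 _; rewrite ler_pM2l.
  by rewrite -mulrA; apply: ler_wpM2l => //; apply: ler_wpM2l h3; exact: powR_ge0.
apply: (@le_trans _ _ (2 `^ q * (B * (7 `^ q * S)) + 2^-1 *
    (2 * (2 `^ q * B * 7 `^ q) * S + 2^-1 ^+ k * (N%:R `^ q * S)))).
  rewrite lerD2l; apply: ler_wpM2r => //; apply: addr_ge0.
    by rewrite mulr_ge0// mulr_ge0.
  by rewrite mulr_ge0 ?exprn_ge0 ?invr_ge0// mulr_ge0 ?powR_ge0.
by apply: eq_ler; rewrite exprS; field.
Qed.

(** Letting the number of iterations grow removes the term that depends on [N]. *)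
Lemma rq_le_lattice_l2 :
  rq q N y <= 2 * (2 `^ q * B * 7 `^ q) * `|lattice_l2 x| `^ q.
Proof.
have Phiy n : (n < N)%N -> y n = Phi (coor n).
  move=> nN; rewrite -[n]/(val (Ordinal nN)) -xy.
  have [<- _ _ _] := PhiP; congr Phi; apply/funext => t; exact/esym/coorE.
rewrite (@eq_rq _ _ q N y _ Phiy) -[lattice_l2 x]/(Phi s) -/S.
rewrite leNgt; apply/negP => lt; set K := 2 * _ * S in lt.
set a := rq _ _ _ in lt; set Q := N%:R `^ q * S.
have d0 : 0 < a - K by rewrite subr_gt0.
pose k := (Num.truncn (Q / (a - K))).+1.
have := rq_Phi_le k hc_coor; rewrite -/a -/Q -/K => h.
have {h}h : a <= K + 2^-1 ^+ k * Q.
  by apply: h => t; rewrite s_sqr; apply: eq_ler; apply: eq_bigr => i _; rewrite coorE.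
have k2 : (k%:R : R) < 2 ^+ k by rewrite -natrX ltr_nat ltn_expl.
have Qk : Q < k%:R * (a - K) by rewrite -ltr_pdivrMr// truncnS_gt.
have : 2 ^+ k * (a - K) <= Q.
  have -> : Q = 2 ^+ k * (2^-1 ^+ k * Q) by rewrite mulrA -exprMn mulfV// expr1n mul1r.
  by rewrite ler_pM2l ?exprn_gt0// lerBlDl.
apply/negP; rewrite -ltNge; apply: lt_trans Qk _.
by rewrite ltr_pM2r.
Qed.

End SquareFunction.

(** * Extrapolation to small exponents *)

Section Extrapolation.
Context {R : realType} (p q : R) (p0 : 0 < p) (p1 : p <= 1) (q1 : 1 < q).

Let pq : p < q. Proof. exact: le_lt_trans q1. Qed.

Let pow1 (r : R) : 1 `^ r = 1 :> R. Proof. by rewrite powR1. Qed.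

Let two_p : 1 < 2 `^ p :> R.
Proof. by rewrite -[ltLHS](pow1 p) gt0_ltr_powR ?nnegrE// ltr1n. Qed.

Let two_pq : 2 `^ (p - q) < 1 :> R.
Proof.
have -> : p - q = - (q - p) by ring.
rewrite powRN invf_lt1 ?powR_gt0// -[ltLHS](pow1 (q - p)).
by rewrite gt0_ltr_powR ?nnegrE ?subr_gt0// ltr1n.
Qed.

(** The series of levels above [y], the one level where the two regimes meet, and the series of
    levels below [y]. *)
Definition extrapolation_const : R := (1 - 2 `^ (p - q))^-1 + 1 + (2 `^ p - 1)^-1.

Let C2 : R := (1 - 2 `^ (p - q))^-1.
Let C1 : R := (2 `^ p - 1)^-1.

Let C1_gt0 : 0 < C1. Proof. by rewrite /C1 invr_gt0 subr_gt0 two_p. Qed.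
Let C2_gt0 : 0 < C2. Proof. by rewrite /C2 invr_gt0 subr_gt0 two_pq. Qed.

Let powD (y : R) : 0 < y -> y `^ q * y `^ (p - q) = y `^ p.
Proof.
move=> y0; rewrite -powRD; last by rewrite (gt_eqF y0) implybT.
by congr (_ `^ _); ring.
Qed.

Lemma sum_levels_above (eta y : R) L : 0 < eta -> 0 <= y ->
  \sum_(k < L) (eta * 2 ^+ k) `^ (p - q) * y `^ q <= C2 * (y `^ q * eta `^ (p - q)).
Proof.
elim: L eta => [|L ih] eta eta0 y0.
  by rewrite big_ord0 mulr_ge0 ?(ltW C2_gt0)// mulr_ge0 ?powR_ge0.
rewrite big_ord_recl expr0 mulr1.
rewrite (eq_bigr (fun k : 'I_L => ((eta * 2) * 2 ^+ k) `^ (p - q) * y `^ q)); last first.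
  by move=> k _; rewrite exprS mulrA.
have e2 : 0 < eta * 2 by rewrite mulr_gt0.
apply: le_trans (lerD (lexx _) (ih _ e2 y0)) _.
rewrite powRM ?(ltW eta0)//; apply: eq_ler; rewrite /C2.
by field; rewrite subr_eq0 gt_eqF.
Qed.

(* Levels above [y] form a geometric series of ratio [2 `^ (p - q) < 1], levels
   below one of ratio [2 `^ p > 1]. *)
Lemma sum_levels (eta y : R) L : 0 < eta -> 0 <= y ->
  \sum_(k < L) (eta * 2 ^+ k) `^ (p - q) * Num.min y (eta * 2 ^+ k) `^ q <=
  extrapolation_const * y `^ p.
Proof.
have small eta' L' : 0 < eta' -> 0 <= y -> y <= eta' ->
    \sum_(k < L') (eta' * 2 ^+ k) `^ (p - q) * Num.min y (eta' * 2 ^+ k) `^ q <= C2 * y `^ p.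
  move=> eta0 y0 ye; have [y00|yp] := eqVneq y 0.
    rewrite big1 ?mulr_ge0 ?powR_ge0 ?(ltW C2_gt0)// => k _.
    rewrite y00 min_l ?powR0 ?mulr0//; first by rewrite gt_eqF// (lt_trans _ q1).
    by rewrite mulr_ge0 ?exprn_ge0// ltW.
  have {yp y0}y0 : 0 < y by rewrite lt0r yp.
  rewrite (eq_bigr (fun k : 'I_L' => (eta' * 2 ^+ k) `^ (p - q) * y `^ q)); last first.
    move=> k _; rewrite min_l//; apply: le_trans ye _.
    by rewrite ler_peMr ?(ltW eta0)// exprn_ege1// ler1n.
  apply: le_trans (sum_levels_above _ eta0 (ltW y0)) _.
  rewrite ler_pM2l// -(powD y0) ler_pM2l ?powR_gt0//.
  have -> : p - q = - (q - p) by ring.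
  rewrite !powRN lef_pV2 ?posrE ?powR_gt0//.
  by apply: powR_le => //; [rewrite subr_ge0 ltW|exact: ltW].
move=> eta0 y0.
(* The term subtracted makes the induction close: a further level contributes the power [p] of
   [eta], and [C1 * (2 ^ p - 1) = 1] absorbs it. *)
suff key : \sum_(k < L) (eta * 2 ^+ k) `^ (p - q) * Num.min y (eta * 2 ^+ k) `^ q <=
    if y <= eta then C2 * y `^ p else (C2 + 1 + C1) * y `^ p - C1 * eta `^ p.
  apply: le_trans key _; rewrite /extrapolation_const -/C1 -/C2.
  have := powR_ge0 y p; have := powR_ge0 eta p.
  case: ifP => _; have := C1_gt0; have := C2_gt0; nra.
elim: L eta eta0 => [|L ih] eta eta0.
  rewrite big_ord0; case: ifPn => [_|]; first by rewrite mulr_ge0 ?powR_ge0// ltW.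
  rewrite -ltNge => ey; have := powR_ge0 y p; have : eta `^ p <= y `^ p.
    by apply: powR_le; exact: ltW.
  have := C1_gt0; have := C2_gt0; nra.
case: ifPn => [ye|]; first exact: small.
rewrite -ltNge => ey; rewrite big_ord_recl expr0 mulr1 min_r ?(ltW ey)//.
rewrite [X in X + _]mulrC powD//.
rewrite (eq_bigr (fun k : 'I_L => ((eta * 2) * 2 ^+ k) `^ (p - q) *
    Num.min y ((eta * 2) * 2 ^+ k) `^ q)); last by move=> k _; rewrite exprS mulrA.
have e2 : 0 < eta * 2 by rewrite mulr_gt0.
apply: le_trans (lerD (lexx _) (ih _ e2)) _.
have ep : eta `^ p <= y `^ p by apply: powR_le; exact: ltW.
have c0 := C1_gt0; have := powR_ge0 y p.
case: ifPn => _ yp; first by have := C2_gt0; nra.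
rewrite powRM ?(ltW eta0)//.
have : C1 * (2 `^ p - 1) = 1 by rewrite mulVf// subr_eq0 gt_eqF.
have := powR_ge0 eta p; nra.
Qed.

(** Layer-cake summation over the levels [l = eta * 2 ^ k]: the hypothesis is weighted by
    [l ^ (p - q)] and [sum_levels] evaluates the right side. Rounding [F] to dyadic levels costs
    [2 ^ p]. *)
Lemma extrapolation (T : finType) (F Y : T -> R) (b : R) : 0 <= b ->
  (forall t, 0 <= F t) -> (forall t, 0 <= Y t) ->
  (forall l, 0 < l -> l `^ q * \sum_(t | l < F t) 1 <= b * \sum_t Num.min (Y t) l `^ q) ->
  \sum_t F t `^ p <= 2 `^ p * extrapolation_const * b * \sum_t Y t `^ p.
Proof.
move=> b0 F0 Y0 hl; set W := 2 `^ p * _ * _ * _.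
apply/ler_addgt0Pr => e e0.
pose n1 : R := #|T|.+1%:R; have n10 : 0 < n1 by [].
(* What lies below the lowest level contributes [e / n1] at each point, in all at most [e]; the
   successor in [n1] covers an empty [T]. *)
pose eta := (e / n1) `^ p^-1.
have en : 0 < e / n1 by rewrite divr_gt0.
have eta0 : 0 < eta by rewrite powR_gt0.
have etap : eta `^ p = e / n1.
  by rewrite /eta -powRrM mulVf ?gt_eqF// powRr1// ltW.
pose m := \sum_t F t.
pose L := (Num.truncn (m / eta)).+1.
have FL t : F t <= eta * 2 ^+ L.
  apply: (@le_trans _ _ m); first by rewrite /m (bigD1 t)//= lerDl sumr_ge0.
  have : m / eta < L%:R by exact: truncnS_gt.
  rewrite ltr_pdivrMr// mulrC => /ltW/le_trans; apply.
  by rewrite ler_pM2l// -natrX ler_nat ltnW// ltn_expl.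
have Fdec t : F t `^ p <= eta `^ p + \sum_(k < L) (2 * (eta * 2 ^+ k)) `^ p *
    (eta * 2 ^+ k < F t)%R%:R.
  have sge n : 0 <= \sum_(k < n) (2 * (eta * 2 ^+ k)) `^ p * (eta * 2 ^+ k < F t)%R%:R.
    by apply: sumr_ge0 => k _; rewrite mulr_ge0 ?powR_ge0.
  move: L FL => L' /(_ t); elim: L' => [|n ih] Fn.
    rewrite big_ord0 addr0; apply: powR_le => //; first exact: ltW.
    by rewrite expr0 mulr1 in Fn.
  have [Fn'|Fn'] := leP (F t) (eta * 2 ^+ n).
    apply: le_trans (ih Fn') _; rewrite lerD2l big_ord_recr/= lerDl.
    by rewrite mulr_ge0 ?powR_ge0.
  rewrite big_ord_recr/= Fn' mulr1; apply: (@le_trans _ _ ((2 * (eta * 2 ^+ n)) `^ p)).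
    by apply: powR_le => //; [exact: ltW|rewrite mulrCA -exprS].
  by rewrite addrA lerDr addr_ge0 ?powR_ge0 ?sge.
apply: le_trans (ler_sum _ (fun t _ => Fdec t)) _.
rewrite big_split/= addrC; apply: lerD; last first.
  rewrite sumr_const -[_ *+ _]mulr_natl etap mulrCA ger_pMr//.
  by rewrite ler_pdivrMr// mul1r ler_nat leqnSn.
rewrite exchange_big/= /W.
apply: (@le_trans _ _ (\sum_(k < L) 2 `^ p * b * \sum_t
   (eta * 2 ^+ k) `^ (p - q) * Num.min (Y t) (eta * 2 ^+ k) `^ q)).
  apply: ler_sum => k _; set l := eta * 2 ^+ k.
  have l0 : 0 < l by rewrite mulr_gt0// exprn_gt0.
  rewrite -mulr_sumr -mulr_sumr powRM ?(ltW l0)// -(powD l0).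
  have := hl l l0.
  have -> : \sum_(t | l < F t) 1 = \sum_t (l < F t)%R%:R :> R.
    by rewrite big_mkcond; apply: eq_bigr => t _; case: ifP.
  set u := \sum_t (l < F t)%R%:R; set v := \sum_t _ => uv.
  have -> : 2 `^ p * (l `^ q * l `^ (p - q)) * u = (2 `^ p * l `^ (p - q)) * (l `^ q * u) by ring.
  have -> : 2 `^ p * b * (l `^ (p - q) * v) = (2 `^ p * l `^ (p - q)) * (b * v) by ring.
  by apply: ler_wpM2l uv; rewrite mulr_ge0 ?powR_ge0.
rewrite -mulr_sumr exchange_big/=.
have -> : 2 `^ p * extrapolation_const * b * \sum_t Y t `^ p =
    2 `^ p * b * \sum_t extrapolation_const * Y t `^ p.
  by rewrite -mulr_sumr; ring.
apply: ler_wpM2l; first by rewrite mulr_ge0 ?powR_ge0.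
by apply: ler_sum => t _; exact: sum_levels.
Qed.

Lemma extrapolation_const_gt0 : 0 < extrapolation_const.
Proof. by rewrite /extrapolation_const -/C1 -/C2 addr_gt0// addr_gt0. Qed.

End Extrapolation.

(** * Stopping arguments for martingales on the sign cube *)

Section CubeMartingales.
Context {R : realType} {X : completeNormedModType R}.
Context (p q B : R) (p0 : 0 < p) (p1 : p <= 1) (q1 : 1 < q) (B0 : 0 < B).
Context (umd : umd_cube_bound X q B).
Context (N : nat) (D : nat -> cube N -> X) (hD : mdiffs D).

Let q0 : 0 < q. Proof. exact: lt_trans q1. Qed.

Definition psum n w := \sum_(k < n.+1) D k w.
Definition maximal (w : cube N) : R := \big[Num.max/0]_(n < N.+1) `|psum n w|.
Definition radnorm k (w : cube N) : R := rq q N.+1 (mask (geq k) (D^~ w)) `^ q^-1.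
Local Notation A := radnorm.

(** Sign changes of the vectors are absorbed by a reflection of the random signs. *)
Lemma rq_sign M (y z : nat -> X) : (forall n, z n = y n \/ z n = - y n) ->
  rq q M z = rq q M y.
Proof.
move=> zy; rewrite /rq -[RHS](avg_flip (fun n => z n != y n)); apply: eq_avg => w.
congr (`| _ | `^ q); apply: eq_bigr => i _; rewrite /rad bit_flip//.
have [->|zny] := eqVneq (z i) (y i); first by rewrite addbF.
have -> : z i = - y i by case: (zy i) zny => // ->; rewrite eqxx.
by rewrite addbT; case: bit; rewrite ?expr0 ?expr1 ?scaleN1r ?scale1r ?opprK.
Qed.

Let radnorm_powR k w : A k w `^ q = rq q N.+1 (mask (geq k) (D^~ w)).
Proof. by rewrite -powRrM mulVf ?gt_eqF// powRr1// rq_ge0. Qed.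

Let radnorm_ge0 k w : 0 <= A k w. Proof. exact: powR_ge0. Qed.

Lemma radnormN w : A N w = rq q N.+1 (D^~ w) `^ q^-1.
Proof.
congr (_ `^ _); apply: eq_rq => n; rewrite ltnS => nN.
by rewrite /mask /= nN.
Qed.

(** The difference of index [j.+1] only changes sign under the flip, which [rq] does not notice. So
    [A k] is known one step before [D k] is revealed. *)
Let radnorm_flip k j w : (k <= j.+1)%N -> A k (flip1 j w) = A k w.
Proof.
move=> kj; congr (_ `^ _); apply: rq_sign => n; rewrite /mask /=.
case: leqP => nk; last by left.
have [nj|nj] := leqP n j; first by left; exact: hD.1.
have {nj} -> : n = j.+1 by apply/eqP; rewrite eqn_leq nj (leq_trans nk kj).
have [jN|Nj] := ltnP j N; first by right; exact: hD.2.
by left; rewrite flip1_ge.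
Qed.

Let radnorm_mono k l w : (k <= l)%N -> A k w <= A l w.
Proof.
move=> kl; apply: powR_le; rewrite ?invr_ge0 ?(ltW q0)// ?rq_ge0//.
rewrite (@eq_rq _ _ q _ _ (mask (geq k) (mask (geq l) (D^~ w)))).
  exact: rq_mask.
by move=> n _; rewrite /mask /=; case: leqP => // nk; rewrite (leq_trans nk kl).
Qed.

Let psum_flip n j w : (n <= j)%N -> psum n (flip1 j w) = psum n w.
Proof.
move=> nj; apply: eq_bigr => k _; apply: hD.1.
by rewrite (leq_trans _ nj)// -ltnS.
Qed.

(** [c n] depends on the first [n - 1] signs only, one fewer than [D n]; [c 0] is constant. *)
Definition predictable (c : nat -> cube N -> bool) :=
  forall n j w, (n <= j.+1)%N -> c n (flip1 j w) = c n w.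

Definition stopped (c : nat -> cube N -> bool) n w := if c n w then D n w else 0.

Lemma mdiffs_stopped c : predictable c -> mdiffs (stopped c).
Proof.
move=> cp; split=> [n j w nj|n w nN]; rewrite /stopped cp//; last 2 first.
- exact: leq_trans nj _.
- by case: ifP => _; rewrite ?oppr0//; exact: hD.2.
by rewrite hD.1.
Qed.

(** For fixed [e] the functions [rad e n *: E n] are again martingale differences, and the
    multipliers [rad e n] restore [E]. *)
Lemma umd_rq_ge (E : nat -> cube N -> X) : mdiffs E ->
  avg (fun w => `|\sum_(n < N.+1) E n w| `^ q) <= B * avg (fun w => rq q N.+1 (E^~ w)).
Proof.
move=> hE; rewrite /rq avg_exchange -avgZ -[leLHS](avg_cst N.+1).
apply: le_avg => e.
have hE' : mdiffs (fun n w => rad e n *: E n w).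
  by split=> [n j w nj|n w nN]; rewrite ?(hE.1 _ _ _ nj)// (hE.2 _ _ nN) scalerN.
have := umd hE' (eps := fun n => rad e n) (fun n => eq_ler (norm_rad e n)).
congr (_ <= _); apply: eq_avg => w; congr (`| _ | `^ q); apply: eq_bigr => n _.
by rewrite scalerA rad_sqr scale1r.
Qed.

Lemma umd_rq_le (E : nat -> cube N -> X) : mdiffs E ->
  avg (fun w => rq q N.+1 (E^~ w)) <= B * avg (fun w => `|\sum_(n < N.+1) E n w| `^ q).
Proof.
move=> hE; rewrite /rq avg_exchange -[leRHS](avg_cst N.+1); apply: le_avg => e.
exact: (umd hE (fun n => eq_ler (norm_rad e n))).
Qed.

Let le_sum_avg (f g : cube N -> R) (b : R) : avg f <= b * avg g ->
  \sum_w f w <= b * \sum_w g w.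
Proof. by rewrite /avg mulrCA ler_pM2l// invr_gt0 exp2_gt0. Qed.

Let rq_stopped_le (c : nat -> cube N -> bool) (l : R) w : 0 <= l -> (forall n, c n w -> A n w <= l) ->
  rq q N.+1 (stopped c ^~ w) <= l `^ q.
Proof.
move=> l0 cA; have key n : rq q N.+1 (mask (geq n) (stopped c ^~ w)) <= l `^ q.
  elim: n => [|n ih].
    have [c0|c0] := boolP (c 0%N w).
      rewrite (@eq_rq _ _ q _ _ (mask (geq 0%N) (D^~ w))); last first.
        by move=> [|n] _ //; rewrite /mask /= /stopped c0.
      by rewrite -radnorm_powR; apply: powR_le => //; [exact: ltW|exact: cA].
    rewrite (@eq_rq _ _ q _ _ (fun=> 0)) ?rq_zero ?powR_ge0//.
    by move=> [|n] _; rewrite /mask /= /stopped ?(negPf c0).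
  have [cn|cn] := boolP (c n.+1 w).
    apply: (@le_trans _ _ (A n.+1 w `^ q)); last first.
      by apply: powR_le => //; [exact: ltW|exact: cA].
    rewrite radnorm_powR.
    rewrite (@eq_rq _ _ q _ _ (mask (fun k => c k w) (mask (geq n.+1) (D^~ w)))).
      exact: rq_mask.
    by move=> k _; rewrite /mask /stopped; case: ifP; case: ifP.
  apply: le_trans ih; apply: eq_ler; apply: eq_rq => k _; rewrite /mask /=.
  have [->|kn] := eqVneq k n.+1; first by rewrite leqnn ltnn /stopped (negPf cn).
  by rewrite leq_eqVlt (negPf kn).
apply: le_trans (key N); apply: eq_ler; apply: eq_rq => k kN.
by rewrite /mask /= -ltnS kN.
Qed.

Let sum_lt (F : cube N -> R) (l : R) (G : cube N -> R) :
  (forall w, 0 <= G w) -> (forall w, l < F w -> l `^ q <= G w) ->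
  l `^ q * \sum_(w | l < F w) 1 <= \sum_w G w.
Proof.
move=> G0 FG; rewrite mulr_sumr big_mkcond; apply: ler_sum => w _.
by rewrite mulr1; case: ifP => [/FG//|_].
Qed.

(* Keep the differences up to the first time at which the martingale exceeds
   [l], as long as the random norm stays below [l]. *)
Lemma maximal_le_radnorm :
  avg (fun w => maximal w `^ p) <=
  2 `^ p * extrapolation_const p q * (1 + B) * avg (fun w => A N w `^ p).
Proof.
rewrite /avg mulrCA; apply: ler_wpM2l; first exact: exp2V_ge0.
apply: extrapolation => //.
- by rewrite addr_ge0// ltW.
- by move=> w; apply: bigmax_ge_id.
move=> l l0.
pose c k w := (A k w <= l) && [forall j : 'I_k, `|psum j w| <= l].
have cp : predictable c.
  move=> n j w nj; rewrite /c radnorm_flip//; congr andb.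
  by apply: eq_forallb => i; rewrite psum_flip// -ltnS (leq_trans _ nj).
pose g w := \sum_(n < N.+1) stopped c n w.
have gl : \sum_w `|g w| `^ q <= B * \sum_w Num.min (A N w) l `^ q.
  apply: le_trans (le_sum_avg (umd_rq_ge (mdiffs_stopped cp))) _.
  rewrite ler_pM2l//; apply: ler_sum => w _.
  case: (leP (A N w) l) => _; last by apply: rq_stopped_le; [exact: ltW|move=> n /andP[]].
  rewrite radnormN -powRrM mulVf ?gt_eqF// powRr1 ?rq_ge0//.
  exact: (rq_mask q1 N.+1 (fun n => c n w) (D^~ w)).
(* The [1] accounts for the points with [A N w > l], where the minimum equals [l]; the [B] for the
   others, where [g] is the partial sum at the first passage above [l]. *)
rewrite mulrDl mul1r; apply: le_trans (lerD (lexx _) gl).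
rewrite -big_split/=; apply: sum_lt => w; first by rewrite addr_ge0 ?powR_ge0.
move=> lF; have [Al|lA] := leP (A N w) l; last by rewrite lerDl powR_ge0.
rewrite -[leLHS]add0r; apply: lerD; first exact: powR_ge0.
apply: powR_le; [exact: ltW|exact: ltW|].
have [n nN ln] : exists2 n, (n <= N)%N & l < `|psum n w|.
  apply: contrapT => h; move: lF; rewrite ltNge => /negP; apply.
  apply/bigmax_leP; split=> [|i _]; first exact: ltW.
  rewrite leNgt; apply/negP => li; apply: h; exists i => //.
  by rewrite -ltnS.
pose n0 := ex_minn (ex_intro (fun n => l < `|psum n w|) n ln).
have [ln0 n0min] : l < `|psum n0 w| /\ forall k, l < `|psum k w| -> (n0 <= k)%N.
  by rewrite /n0; case: ex_minnP.
have n0N : (n0 <= N)%N by exact: leq_trans (n0min _ ln) nN.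
apply/ltW; rewrite (_ : g w = psum n0 w)//.
have ck k : c k w = (k <= n0)%N.
  apply/idP/idP => [/andP[_ /forallP h]|kn].
    rewrite leqNgt; apply/negP => nk; have := h (Ordinal nk).
    by rewrite leNgt ln0.
  apply/andP; split.
    by apply: le_trans Al; apply: radnorm_mono; exact: leq_trans n0N.
  apply/forallP => j; rewrite leNgt; apply/negP => /n0min.
  by rewrite leqNgt (leq_trans (ltn_ord j) kn).
rewrite /g /psum -[N.+1](subnKC (n0N : n0 < N.+1)%N) big_split_ord/=.
rewrite [X in _ + X]big1 ?addr0; last first.
  by move=> k _; rewrite /stopped ck leqNgt ltnS leq_addr.
by apply: eq_bigr => k _; rewrite /stopped ck -ltnS ltn_ord.
Qed.

(* Including the sibling makes the maximal function predictable. *)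
Let pairmax j w : R := Num.max `|psum j w| `|psum j (flip1 j.-1 w)|.
Definition pmaximal n w : R := \big[Num.max/0]_(j < n.+1) pairmax j w.

Let pairmax_flip j i w : (j <= i.+1)%N -> pairmax j (flip1 i w) = pairmax j w.
Proof.
rewrite leq_eqVlt => /predU1P[->|]; first by rewrite /pairmax/= /flip1 flipK maxC.
rewrite ltnS => ji; rewrite /pairmax psum_flip//; congr (Num.max _ `| _ |).
by rewrite /flip1 flipC -!/(flip1 _ _) psum_flip.
Qed.

Let pmaximal_flip n i w : (n <= i.+1)%N -> pmaximal n (flip1 i w) = pmaximal n w.
Proof.
move=> ni; apply: eq_bigr => j _; apply: pairmax_flip.
by rewrite (leq_trans _ ni)// -ltnS.
Qed.

Let pmaximal_ge0 n w : 0 <= pmaximal n w. Proof. exact: bigmax_ge_id. Qed.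

Let pmaximal_leP n w (l : R) : 0 <= l ->
  (pmaximal n w <= l) <-> (forall j, (j <= n)%N -> pairmax j w <= l).
Proof.
move=> l0; split=> [/bigmax_leP[_ h] j jn|h].
  exact: (h (Ordinal (jn : (j < n.+1)%N))).
by apply/bigmax_leP; split=> // i _; apply: h; rewrite -ltnS.
Qed.

Let pmaximal_mono k n w : (k <= n)%N -> pmaximal k w <= pmaximal n w.
Proof.
move=> kn; apply/pmaximal_leP => // j jk.
by have /pmaximal_leP := lexx (pmaximal n w); apply => //; exact: leq_trans kn.
Qed.

Let psum_le_pmaximal n w : `|psum n w| <= pmaximal n w.
Proof.
apply: (@le_trans _ _ (pairmax n w)); first by rewrite le_max lexx.
by have /pmaximal_leP := lexx (pmaximal n w); apply.
Qed.

Lemma radnorm_le_pmaximal :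
  \sum_w A N w `^ p <=
  2 `^ p * extrapolation_const p q * (1 + B) * \sum_w pmaximal N w `^ p.
Proof.
apply: extrapolation => //; first by rewrite addr_ge0// ltW.
move=> l l0; pose c k w := pmaximal k w <= l.
have cp : predictable c by move=> n j w nj; rewrite /c pmaximal_flip.
pose h n w := \sum_(k < n.+1) stopped c k w.
have hS n w : h n.+1 w = h n w + stopped c n.+1 w by rewrite /h big_ord_recr.
have hc n w : c n w -> h n w = psum n w.
  move=> cn; apply: eq_bigr => k _; rewrite /stopped /c (le_trans _ cn)//.
  by apply: pmaximal_mono; rewrite -ltnS.
have hle n w : `|h n w| <= Num.min (pmaximal n w) l.
  elim: n => [|n ih].
    have [c0|c0] := boolP (c 0%N w).
      by rewrite hc// le_min psum_le_pmaximal (le_trans (psum_le_pmaximal _ _)).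
    by rewrite /h big_ord1 /stopped (negPf c0) normr0 le_min pmaximal_ge0 ltW.
  have [cn|cn] := boolP (c n.+1 w).
    by rewrite hc// le_min psum_le_pmaximal (le_trans (psum_le_pmaximal _ _)).
  rewrite hS /stopped (negPf cn) addr0; apply: le_trans ih _.
  by rewrite le_min !ge_min lexx orbT pmaximal_mono.
have hl : \sum_w rq q N.+1 (stopped c ^~ w) <= B * \sum_w Num.min (pmaximal N w) l `^ q.
  apply: le_trans (le_sum_avg (umd_rq_le (mdiffs_stopped cp))) _.
  rewrite ler_pM2l//; apply: ler_sum => w _.
  by apply: powR_le; [exact: ltW| |exact: hle].
rewrite mulrDl mul1r; apply: le_trans (lerD (lexx _) hl).
rewrite -big_split/=; apply: sum_lt => w; first by rewrite addr_ge0 ?powR_ge0 ?rq_ge0.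
move=> lA; have [Ml|lM] := leP (pmaximal N w) l; last by rewrite lerDl rq_ge0.
rewrite -[leLHS]add0r; apply: lerD; first exact: powR_ge0.
apply: (@le_trans _ _ (A N w `^ q)).
  by apply: powR_le; [exact: ltW|exact: ltW|exact: ltW].
rewrite radnorm_powR; apply: eq_ler; apply: eq_rq => n; rewrite ltnS => nN.
by rewrite /mask /= nN /stopped /c (le_trans _ Ml)// pmaximal_mono.
Qed.

(* A cell where [pairmax] first exceeds [l] has [maximal > l] on at least one of
   the two siblings, so the measures of the level sets differ by at most a
   factor [2]. *)
Lemma pmaximal_le_maximal :
  \sum_w pmaximal N w `^ p <=
  2 `^ p * extrapolation_const p q * 2 * \sum_w maximal w `^ p.
Proof.
have mx0 w : 0 <= maximal w by exact: bigmax_ge_id.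
apply: extrapolation => // l l0.
(* [b j] selects the first index at which [pairmax] exceeds [l]: at most one [j] for each point, and
   the same for its sibling. *)
pose b j w := (l < pairmax j w) && [forall i : 'I_j, pairmax i w <= l].
have bflip j w : b j (flip1 j.-1 w) = b j w.
  rewrite /b pairmax_flip ?leqSpred//; congr andb; apply: eq_forallb => i.
  rewrite pairmax_flip// (leq_trans _ (leqSpred j))//; exact: ltnW.
have b_le1 n w : \sum_(j < n) (b j w)%:R <= 1 :> R.
  elim: n => [|n ih]; first by rewrite big_ord0.
  rewrite big_ord_recr/=; have [bn|bn] := boolP (b n w); last by rewrite addr0.
  rewrite big1 ?add0r// => i _; apply/eqP; rewrite pnatr_eq0 eqb0.
  apply/negP => /andP[+ _]; move/andP: bn => [_ /forallP/(_ i)].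
  by rewrite leNgt => /negP.
have b_ge w : l < pmaximal N w -> 1 <= \sum_(j < N.+1) (b j w)%:R :> R.
  move=> lM; have [n nN ln] : exists2 n, (n <= N)%N & l < pairmax n w.
    apply: contrapT => h; move: lM; rewrite ltNge => /negP; apply.
    apply/pmaximal_leP; first exact: ltW.
    by move=> i iN; rewrite leNgt; apply/negP => li; apply: h; exists i.
  pose n0 := ex_minn (ex_intro (fun n => l < pairmax n w) n ln).
  have [ln0 n0min] : l < pairmax n0 w /\ forall k, l < pairmax k w -> (n0 <= k)%N.
    by rewrite /n0; case: ex_minnP.
  have n0N : (n0 < N.+1)%N by rewrite ltnS; exact: leq_trans (n0min _ ln) nN.
  rewrite (bigD1 (Ordinal n0N))//= (_ : b n0 w) ?lerDl ?sumr_ge0//.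
  rewrite /b ln0; apply/forallP => i; rewrite leNgt; apply/negP => /n0min.
  by rewrite leqNgt ltn_ord.
have bsum j : (j <= N)%N -> \sum_w (b j w)%:R <= 2 * \sum_w (b j w)%:R * (l < maximal w)%R%:R :> R.
  move=> jN; pose u w : R := (b j w)%:R * (l < `|psum j w|)%R%:R.
  apply: (@le_trans _ _ (\sum_w (u w + u (flip1 j.-1 w)))).
    apply: ler_sum => w _; rewrite /u bflip; have [bj|] := boolP (b j w); last first.
      by rewrite !mul0r addr0.
    move/andP: bj => [+ _]; rewrite lt_max => /orP[->|->]; rewrite !mul1r.
      by rewrite lerDl.
    by rewrite lerDr.
  rewrite big_split/= (sum_flip (pred1 j.-1) u) -mulr2n -[leLHS]mulr_natl.
  apply: ler_wpM2l => //; apply: ler_sum => w _; apply: ler_wpM2l => //.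
  rewrite ler_nat; case lj : (l < `|psum j w|) => //.
  rewrite (lt_le_trans lj)//; have /bigmax_leP[_] := lexx (maximal w).
  exact: (fun h => h (Ordinal (jN : (j < N.+1)%N)) isT).
have count : \sum_(w | l < pmaximal N w) 1 <= 2 * \sum_w (l < maximal w)%R%:R :> R.
  apply: (@le_trans _ _ (\sum_w \sum_(j < N.+1) (b j w)%:R)).
    rewrite big_mkcond; apply: ler_sum => w _; case: ifP => [/b_ge//|_].
    exact: sumr_ge0.
  rewrite exchange_big/=.
  apply: (@le_trans _ _ (\sum_(j < N.+1) 2 * \sum_w (b j w)%:R * (l < maximal w)%R%:R)).
    by apply: ler_sum => j _; apply: bsum; rewrite -ltnS.
  rewrite -mulr_sumr; apply: ler_wpM2l => //; rewrite exchange_big/=.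
  by apply: ler_sum => w _; rewrite -mulr_suml ler_piMl// b_le1.
apply: (@le_trans _ _ (l `^ q * (2 * \sum_w (l < maximal w)%R%:R))).
  by apply: ler_wpM2l; rewrite ?powR_ge0.
rewrite mulrCA; apply: ler_wpM2l => //; rewrite mulr_sumr; apply: ler_sum => w _.
have [lm|lm] := ltP l (maximal w); first by rewrite mulr1.
by rewrite mulr0 powR_ge0.
Qed.

Lemma radnorm_le_maximal :
  avg (fun w => A N w `^ p) <=
  (2 `^ p * extrapolation_const p q * (1 + B)) *
  (2 `^ p * extrapolation_const p q * 2) * avg (fun w => maximal w `^ p).
Proof.
rewrite /avg mulrCA; apply: ler_wpM2l; first exact: exp2V_ge0.
apply: le_trans radnorm_le_pmaximal _; rewrite -[leRHS]mulrA; apply: ler_wpM2l.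
  have := extrapolation_const_gt0 p0 p1 q1 => e0.
  by rewrite mulr_ge0 ?addr_ge0 ?mulr_ge0 ?powR_ge0 ?ltW.
exact: pmaximal_le_maximal.
Qed.

End CubeMartingales.

(** * Transfer to the interval *)

Section DyadicCells.
Context {R : realType}.
Local Notation I := (unitI R).
Local Notation cell := (dyadic_interval R).
Implicit Types (n k N : nat) (x y : R).

Lemma cellP n k x : cell n k x <-> k%:R <= (x + 2^-1) * 2 ^+ n < k.+1%:R.
Proof.
rewrite /dyadic_interval /= in_itv /=.
have e : 0 < 2 ^+ n :> R by rewrite exprn_gt0.
rewrite -lerBrDl opprK ler_pdivrMr// -ltrBlDl opprK ltr_pdivlMr//.
Qed.

Lemma unitIP x : I x <-> 0 <= x + 2^-1 < 1.
Proof.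
rewrite /unitI /= in_itv/= -lerBlDr sub0r -ltrBrDr.
by rewrite (_ : 1 - 2^-1 = 2^-1 :> R)//; field.
Qed.

Lemma measurable_cell n k : measurable (cell n k).
Proof. exact: measurable_itv. Qed.

Lemma cell_sub_unitI n k : (k < 2 ^ n)%N -> cell n k `<=` I.
Proof.
move=> kn x /cellP /andP[h1 h2]; apply/unitIP; apply/andP; split.
  by rewrite -(pmulr_lge0 _ (exprn_gt0 n (ltr0n R 2))) (le_trans _ h1).
rewrite -(ltr_pM2r (exprn_gt0 n (ltr0n R 2))) mul1r; apply: lt_le_trans h2 _.
by rewrite -natrX ler_nat.
Qed.

Lemma cell_inj n k l x : cell n k x -> cell n l x -> k = l.
Proof.
move=> /cellP /andP[h1 h2] /cellP /andP[h3 h4].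
have := le_lt_trans h1 h4; have := le_lt_trans h3 h2.
rewrite !ltr_nat !ltnS => lk kl; by apply/eqP; rewrite eqn_leq lk kl.
Qed.

Lemma exists_cell n x : I x -> exists2 k, (k < 2 ^ n)%N & cell n k x.
Proof.
move=> /unitIP /andP[x0 x1]; pose u := (x + 2^-1) * 2 ^+ n.
have u0 : 0 <= u by rewrite mulr_ge0// exprn_ge0.
have /andP[h1 h2] := truncn_itv u0.
exists (Num.truncn u); last by apply/cellP; rewrite h1.
rewrite -(ltr_nat R) natrX; apply: le_lt_trans h1 _.
by rewrite -[ltRHS]mul1r ltr_pM2r// exprn_gt0.
Qed.

Lemma cellS n k x :
  cell n k x <-> cell n.+1 k.*2 x \/ cell n.+1 k.*2.+1 x.
Proof.
rewrite !cellP exprSr mulrA; set u := _ * 2 ^+ n.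
have e1 : k.*2%:R = k%:R * 2 :> R by rewrite -muln2 natrM.
have e2 : k.*2.+1%:R = k%:R * 2 + 1 :> R by rewrite -natr1 e1.
have e3 : k.+1.*2%:R = k%:R * 2 + 2 :> R by rewrite -muln2 natrM -natr1; ring.
have e4 : k.+1%:R = k%:R + 1 :> R by rewrite -natr1.
rewrite -[k.*2.+2]/(k.+1.*2) e1 e2 e3 e4.
split=> [/andP[h1 h2]|[]/andP[h1 h2]]; last 2 first.
- by apply/andP; split; lra.
- by apply/andP; split; lra.
by have [h3|h3] := ltP (u * 2) (k%:R * 2 + 1); [left|right]; apply/andP; split; lra.
Qed.

Lemma leb_cell n k : leb R (cell n k) = ((2 ^+ n)^-1)%:E.
Proof.
rewrite /leb /= lebesgue_measure_itv /= lte_fin ltrD2l ltr_pM2r ?invr_gt0 ?exprn_gt0//.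
rewrite ltr_nat leqnn -EFinD; congr (_%:E).
rewrite -[k.+1%:R]natr1; ring.
Qed.

Lemma lebI_cell n k : (k < 2 ^ n)%N -> lebI R (cell n k) = ((2 ^+ n)^-1)%:E.
Proof.
move=> kn; rewrite /lebI /= /mrestr setIidl; first exact: leb_cell.
exact: cell_sub_unitI.
Qed.

Lemma Delta_cell n k : (k < 2 ^ n)%N -> Delta R n (cell n k).
Proof. by move=> kn; apply: sub_sigma_algebra; exists k. Qed.

(** Good-set argument: unions of whole cells form a sigma-algebra on [I] that contains the
    generators. *)
Lemma Delta_cst n A : Delta R n A -> A `<=` I /\
  forall k x y, cell n k x -> cell n k y -> A x -> A y.
Proof.
apply: (smallest_sub (C := sigma_algebra I)
  (X := [set A | A `<=` I /\ forall k x y, cell n k x -> cell n k y -> A x -> A y])).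
  split.
  - by split.
  - move=> B [BI hB]; split=> [x []//|k x y kx ky [Ix nBx]]; split.
      have [l ln lx] := exists_cell n Ix.
      have kl := cell_inj kx lx; rewrite -kl in ln.
      exact: cell_sub_unitI ln _ ky.
    by move=> By; apply: nBx; exact: hB ky kx By.
  - move=> B hB; split=> [x [i _ Bx]|k x y kx ky [i _ Bx]]; first exact: (hB i).1.
    by exists i => //; exact: (hB i).2 kx ky Bx.
move=> _ [k kn ->]; split; first exact: cell_sub_unitI.
by move=> l x y lx ly kx; rewrite (cell_inj kx lx).
Qed.

Lemma Delta_sub n A (G : set (set R)) : sigma_algebra I G ->
  (forall k, (k < 2 ^ n)%N -> G (cell n k)) -> Delta R n A -> G A.
Proof. by move=> sG hG; apply: smallest_sub => // _ [k kn ->]; exact: hG. Qed.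

Lemma sigma_algebra_measurable_I :
  sigma_algebra I [set A : set R | measurable A /\ A `<=` I].
Proof.
split=> [|A [mA AI]|A hA]; first by split; [exact: measurable0|].
  split=> [|x []//]; apply: measurableD => //; exact: measurable_unitI.
split=> [|x [i _]]; last exact: (hA i).2.
by apply: bigcup_measurable => i _; exact: (hA i).1.
Qed.

Lemma Delta_measurable n A : Delta R n A -> measurable A.
Proof.
move=> /(Delta_sub sigma_algebra_measurable_I); case => // k kn.
by split; [exact: measurable_cell|exact: cell_sub_unitI].
Qed.

Lemma Delta_sigma_algebra n : sigma_algebra I (Delta R n).
Proof. exact: smallest_sigma_algebra. Qed.

Lemma Delta_mono n m A : (n <= m)%N -> Delta R n A -> Delta R m A.
Proof.
move=> /subnK <-; elim: (m - n)%N A => [|i ih] A; first by rewrite add0n.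
move=> /ih; rewrite addSn; apply: Delta_sub; first exact: Delta_sigma_algebra.
move=> k kn; set N := (i + n)%N in kn *.
have -> : cell N k = cell N.+1 k.*2 `|` cell N.+1 k.*2.+1.
  by apply/seteqP; split=> x /cellS.
rewrite -bigcup2E; have [h0 _ hU] := Delta_sigma_algebra N.+1; apply: hU => -[|[|j]] //=.
- by apply: Delta_cell; rewrite expnS mul2n ltn_double.
- by apply: Delta_cell; rewrite expnS mul2n ltn_Sdouble.
Qed.

End DyadicCells.

Section CubeCells.
Context {R : realType} (N : nat).
Local Notation I := (unitI R).
Local Notation cell := (dyadic_interval R).
Implicit Types (w : cube N).

(* The index of the dyadic interval of length [2 ^- n] whose binary digits are the
   first [n] signs of [w]. *)
Fixpoint cidx w n : nat := if n is m.+1 then (bit w m + (cidx w m).*2)%N else 0%N.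

Lemma cidx_lt w n : (cidx w n < 2 ^ n)%N.
Proof.
elim: n => [|n ih] //=; rewrite expnS mul2n; case: bit => /=.
  by rewrite add1n ltn_Sdouble.
by rewrite add0n ltn_double.
Qed.

Lemma cidx_flip w j n : (n <= j)%N -> cidx (flip1 j w) n = cidx w n.
Proof.
elim: n => [|n ih] //= nj; rewrite ih ?(ltnW nj)// bit_flip1_neq//.
by rewrite neq_ltn nj.
Qed.

Lemma cidx_inj : injective (cidx^~ N).
Proof.
move=> w v wv; apply/ffunP => i; rewrite -!bitE.
have key : forall n, cidx w n = cidx v n -> forall i, (i < n)%N -> bit w i = bit v i.
  elim=> [|n ih] //= wvn k; have b2 : bit w n = bit v n.
    by have := congr1 odd wvn; rewrite !oddD !odd_double !addbF !oddb.
  have /ih h : cidx w n = cidx v n.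
    by move: wvn; rewrite b2 => /addnI /(congr1 half); rewrite !doubleK.
  by rewrite ltnS leq_eqVlt => /predU1P[->|/h].
exact: key wv _ (ltn_ord i).
Qed.

Lemma cidx_surj n k : (n <= N)%N -> (k < 2 ^ n)%N -> exists w, cidx w n = k.
Proof.
elim: n k => [|n ih] k nN.
  by rewrite expn0 ltnS leqn0 => /eqP ->; exists [ffun=> false].
rewrite expnS mul2n => kn.
have kh : (k./2 < 2 ^ n)%N by rewrite ltn_half_double.
have [w wk] := ih _ (ltnW nN) kh.
exists (if bit w n == odd k then w else flip1 n w) => /=.
case: eqP => [->|/eqP bk]; first by rewrite wk odd_double_half.
rewrite cidx_flip// wk bit_flip//= eqxx addbT.
by rewrite (_ : ~~ bit w n = odd k) ?odd_double_half//; move: bk; case: bit; case: odd.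
Qed.

(** The left endpoint lies in the cell of [w] and in all its dyadic ancestors, so it represents [w]
    in every generation up to [N]. *)
Definition cpt w : R := - 2^-1 + (cidx w N)%:R / 2 ^+ N.

Lemma cell_cidx_mono w n m : (n <= m)%N -> cell m (cidx w m) `<=` cell n (cidx w n).
Proof.
move=> /subnK <-; elim: (m - n)%N => [|k ih]; first by rewrite add0n.
apply: subset_trans ih => x h; apply/cellS; move: h; rewrite addSn /=.
by case: bit; rewrite ?add0n ?add1n; [right|left].
Qed.

Lemma cpt_cell w n : (n <= N)%N -> cell n (cidx w n) (cpt w).
Proof.
move=> nN; apply: (cell_cidx_mono nN); apply/cellP; rewrite /cpt.
rewrite addrAC addNr add0r divfK ?lexx ?ltr_nat// ?ltnSn//.
Qed.

(* Constant off the unit interval too, because of the convention that martingales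
   vanish there. *)
Definition step (T : Type) (phi : measurableTypeR R -> T) :=
  (forall k x y, cell N k x -> cell N k y -> (k < 2 ^ N)%N -> phi x = phi y) /\
  (forall x y, ~ I x -> ~ I y -> phi x = phi y).

Lemma step_comp (T U : Type) (f : T -> U) (phi : measurableTypeR R -> T) :
  step phi -> step (fun x => f (phi x)).
Proof.
move=> [h1 h2]; split=> [k x y kx ky kN|x y nx ny]; first by rewrite (h1 k x y).
by rewrite (h2 x y).
Qed.

Let E (o : option (cube N)) : set (measurableTypeR R) :=
  if o is Some w then cell N (cidx w N) else ~` I.

Let mE o : measurable (E o).
Proof.
by case: o => [w|]; [exact: measurable_cell|apply: measurableC; exact: measurable_unitI].
Qed.

Let tE : trivIset setT E.
Proof.
apply/trivIsetP => -[w|] [v|] _ _ //= wv; apply/seteqP; split=> // x [].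
- move=> wx vx; move/eqP: wv; apply; congr Some; apply: cidx_inj.
  exact: cell_inj wx vx.
- by move=> wx; apply; exact: cell_sub_unitI (cidx_lt w N) _ wx.
- by move=> nI vx; apply: nI; exact: cell_sub_unitI (cidx_lt v N) _ vx.
Qed.

Let DE : [set: measurableTypeR R] = \bigcup_o E o.
Proof.
apply/seteqP; split=> // x _; have [Ix|nIx] := pselect (I x); last by exists None.
have [k kN kx] := exists_cell N Ix; have [w wk] := cidx_surj (leqnn N) kN.
by exists (Some w) => //=; rewrite wk.
Qed.

(** [1] lies outside [I] and represents the complement, a null set for [lebI]. *)
Let val (T : Type) (phi : measurableTypeR R -> T) (o : option (cube N)) : T :=
  if o is Some w then phi (cpt w) else phi 1.

Let n1 : ~ I 1. Proof. by move/unitIP => /andP[_]; lra. Qed.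

Let valE (T : Type) (phi : measurableTypeR R -> T) : step phi ->
  forall o x, E o x -> phi x = val phi o.
Proof.
move=> [h1 h2] [w|] x /= Ex; last exact: h2.
exact: h1 Ex (cpt_cell w (leqnn N)) (cidx_lt w N).
Qed.

Lemma measurable_step d (T : sigmaRingType d) (phi : measurableTypeR R -> T) :
  step phi -> measurable_fun setT phi.
Proof. by move=> sphi; exact: (measurable_fun_partition mE DE (valE sphi)). Qed.

Lemma integral_step (phi : measurableTypeR R -> R) : step phi -> (forall x, 0 <= phi x) ->
  (\int[lebI R]_x (phi x)%:E = (avg (fun w => phi (cpt w)))%:E)%E.
Proof.
move=> sphi phi0.
rewrite (integral_partition mE tE DE (lebI R) (c := val (fun x => (phi x)%:E))).
- rewrite /avg mulr_sumr -sumEFin.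
  rewrite (bigD1 None)//= [X in (_ * X)%E](_ : _ = 0%E); last first.
    by rewrite /lebI /= /mrestr setICl measure0.
  rewrite mule0 add0e.
  rewrite (reindex_omap (Some : cube N -> option (cube N)) id)/=; last by case.
  apply: eq_big => [w|w _]; first by rewrite eqxx.
  by rewrite lebI_cell ?cidx_lt// -EFinM mulrC.
- by case=> [w|]; rewrite lee_fin.
- exact: valE (step_comp EFin sphi).
Qed.

End CubeCells.

Section StepFunctions.
Context {R : realType}.
Local Notation I := (unitI R).
Local Notation cell := (dyadic_interval R).

Lemma step_mono n m (T : Type) (phi : measurableTypeR R -> T) :
  (n <= m)%N -> step n phi -> step m phi.
Proof.
move=> nm [h1 h2]; split=> // k x y kx ky km; have [w wk] := cidx_surj (leqnn m) km.
have sub := @cell_cidx_mono R _ w _ _ nm; rewrite wk in sub.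
exact: h1 (sub _ kx) (sub _ ky) (cidx_lt w n).
Qed.

Lemma step_ext m (T U : Type) (F : nat -> measurableTypeR R -> T)
    (phi : measurableTypeR R -> U) : (forall n, (n <= m)%N -> step n (F n)) ->
  (forall x y, (forall n, (n <= m)%N -> F n x = F n y) -> phi x = phi y) ->
  step m phi.
Proof.
move=> sF h; have sF' n : (n <= m)%N -> step m (F n).
  by move=> nm; exact: step_mono nm (sF n nm).
by split=> [k x y kx ky km|x y nx ny]; apply: h => n nm; have [h1 h2] := sF' n nm;
  [exact: h1 kx ky km|exact: h2].
Qed.

End StepFunctions.

Section DyadicMartingales.
Context {R : realType} {X : completeNormedModType R}.
Local Notation I := (unitI R).
Local Notation cell := (dyadic_interval R).
Implicit Types (F G : nat -> measurableTypeR R -> X).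

(** A pointwise limit of simple functions that are constant on the cells of generation [n] inherits
    this. *)
Lemma Delta_measurable_cst n (f : measurableTypeR R -> X) k x y :
  strongly_measurable I (Delta R n) f -> (k < 2 ^ n)%N ->
  cell n k x -> cell n k y -> f x = f y.
Proof.
move=> [s [ss cs]] kn kx ky.
have Ix := cell_sub_unitI kn kx; have Iy := cell_sub_unitI kn ky.
have sxy : s^~ y = s^~ x.
  apply/funext => j; have [_ /(_ (s j x)) /Delta_cst [_ h]] := ss j.
  by have [] := h k x y kx ky (conj Ix erefl).
have := cs y Iy; rewrite -/(s^~ y) sxy => cy.
exact: (cvg_unique _ (cs x Ix) cy).
Qed.

Lemma bochner_integral_halves n k (f : measurableTypeR R -> X) a b :
  (forall x, cell n.+1 k.*2 x -> f x = a) ->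
  (forall x, cell n.+1 k.*2.+1 x -> f x = b) ->
  bochner_integral (leb R) (cell n k) f = (2 ^+ n.+1)^-1 *: (a + b).
Proof.
move=> fa fb; pose E (i : bool) := cell n.+1 (i + k.*2).
have mE i : measurable (E i) by exact: measurable_cell.
have tE : trivIset setT E.
  apply/trivIsetP => i j _ _ ij; apply/seteqP; split=> // x [xi xj].
  by have /addIn e := cell_inj xi xj; move: ij e; case: i {xi}; case: j {xj}.
have DE : cell n k = \bigcup_i E i.
  apply/seteqP; split=> [x /cellS[h|h]|x [[] _ h]]; [by exists false|by exists true|..].
  - by apply/cellS; right.
  - by apply/cellS; left.
have fE i x : E i x -> f x = if i then b else a.
  by case: i => h; [exact: fb|exact: fa].
rewrite bochner_integral_simple; last 3 first.
- exact: measurable_cell.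
- by rewrite leb_cell ltry.
- exact: (@simple_on_partition _ _ R _ _ _ mE DE X f _ fE).
rewrite (simple_integral_partition mE tE DE _ fE); last by move=> i; rewrite leb_cell.
rewrite big_bool/= !leb_cell/= -scalerDr addrC //.
Qed.

(* The pointwise form of the martingale property, stable under differences. *)
Definition dyadic_sequence F :=
  [/\ forall n x, ~ I x -> F n x = 0,
      forall n k x y, (k < 2 ^ n)%N -> cell n k x -> cell n k y -> F n x = F n y
    & forall n k x y, (k < 2 ^ n)%N -> cell n.+1 k.*2 x -> cell n.+1 k.*2.+1 y ->
        F n x = 2^-1 *: (F n.+1 x + F n.+1 y)].

Lemma dyadic_martingale_sequence F : dyadic_martingale F -> dyadic_sequence F.
Proof.
move=> [F0 [Fi Fc]]; have Fcst n k x y : (k < 2 ^ n)%N -> cell n k x -> cell n k y ->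
  F n x = F n y by exact: Delta_measurable_cst (Fi n).1.
split=> // n k x y kn kx ky.
have [_ _ /(_ (cell n k) (Delta_cell kn))] := Fc n.
have kx' : cell n k x by apply/cellS; left.
have k1 : (k.*2 < 2 ^ n.+1)%N by rewrite expnS mul2n ltn_double.
have k2 : (k.*2.+1 < 2 ^ n.+1)%N by rewrite expnS mul2n ltn_Sdouble.
rewrite (@bochner_integral_halves _ _ (F n) (F n x) (F n x)); last 2 first.
- by move=> z kz; apply: (Fcst n k) => //; apply/cellS; left.
- by move=> z kz; apply: (Fcst n k) => //; apply/cellS; right.
rewrite (@bochner_integral_halves _ _ (F n.+1) (F n.+1 x) (F n.+1 y)); last 2 first.
- by move=> z kz; exact: (Fcst n.+1 k.*2).
- by move=> z kz; exact: (Fcst n.+1 k.*2.+1).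
move=> /(scalerI (invr_neq0 (lt0r_neq0 (exp2_gt0 n.+1)))) <-.
by rewrite half_double.
Qed.

Lemma dyadic_sequenceB F G : dyadic_sequence F -> dyadic_sequence G ->
  dyadic_sequence (fun n x => F n x - G n x).
Proof.
move=> [F0 Fc Fm] [G0 Gc Gm]; split=> [n x nx|n k x y kn kx ky|n k x y kn kx ky].
- by rewrite F0// G0// subrr.
- by rewrite (Fc n k x y)// (Gc n k x y).
- by rewrite (Fm n k x y)// (Gm n k x y)// -scalerBr opprD addrACA.
Qed.

Lemma sum_mdiff F n x : \sum_(k < n.+1) mdiff F k x = F n x.
Proof.
elim: n => [|n ih]; first by rewrite big_ord1.
by rewrite big_ord_recr/= ih addrC subrK.
Qed.

Section DyadicSequence.
Context F (dF : dyadic_sequence F).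

Lemma step_dyadic n : step n (F n).
Proof.
have [F0 Fc _] := dF; split=> [k x y kx ky kn|x y nx ny]; first exact: (Fc n k).
by rewrite !F0.
Qed.

(** The halves of a cell differ in one sign, and the value on the cell is the mean of those on the
    halves, so the two increments are opposite. *)
Lemma mdiffs_dyadic N : mdiffs (fun n (w : cube N) => mdiff F n (cpt w)).
Proof.
have [F0 Fc Fm] := dF.
have Fflip n m j (w : cube N) : (m <= n)%N -> (n <= j)%N ->
    F m (cpt (flip1 j w)) = F m (cpt w).
  move=> mn nj; have [jN|Nj] := ltnP j N; last by rewrite flip1_ge.
  have mN : (m <= N)%N by rewrite (leq_trans mn)// (leq_trans nj)// ltnW.
  apply: (Fc m (cidx w m)); [exact: cidx_lt| |exact: cpt_cell].
  by rewrite -(cidx_flip w (leq_trans mn nj)); exact: cpt_cell.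
split=> [n j w nj|n w nN].
  case: n nj => [|n] nj /=; first exact: (Fflip 0%N).
  by rewrite (Fflip n.+1)// (Fflip n.+1).
rewrite /= (Fflip n n)//; set x := cpt w; set y := cpt (flip1 n w).
have cx : cell n.+1 (cidx w n.+1) x by exact: cpt_cell.
have cy : cell n.+1 (cidx (flip1 n w) n.+1) y by exact: cpt_cell.
have e : F n x = 2^-1 *: (F n.+1 x + F n.+1 y).
  move: cx cy => /=; rewrite cidx_flip// bit_flip//= eqxx addbT.
  case: (bit w n) => /= cx cy; last exact: Fm (cidx_lt w n) cx cy.
  by rewrite -(Fflip n n n w)// addrC; exact: Fm (cidx_lt w n) cy cx.
have {}e : F n.+1 x + F n.+1 y = F n x + F n x.
  by rewrite e -scalerDl (_ : 2^-1 + 2^-1 = 1) ?scale1r//; field.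
by rewrite opprB; apply/eqP; rewrite subr_eq addrAC -e addrC addKr.
Qed.

Lemma psum_mdiff N n (w : cube N) :
  psum (fun n (w : cube N) => mdiff F n (cpt w)) n w = F n (cpt w).
Proof. exact: sum_mdiff. Qed.

Lemma step_mdiff m (T : Type) (Phi : (nat -> X) -> T) :
  (forall y z, (forall n, (n <= m)%N -> y n = z n) -> Phi y = Phi z) ->
  step m (fun x => Phi (mdiff F ^~ x)).
Proof.
move=> h; apply: (step_ext (F := F)) => [n _|x y Fxy]; first exact: step_dyadic.
by apply: h => -[|n] nm /=; rewrite ?Fxy// ltnW.
Qed.

End DyadicSequence.

End DyadicMartingales.

(** * Hardy norms *)

Section Suprema.
Context {R : realType}.

Lemma le_poweR (r : R) (a b : \bar R) : 0 <= r -> (0 <= a)%E -> (a <= b)%E ->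
  (a `^ r <= b `^ r)%E.
Proof.
move=> r0 a0 ab; apply: gt0_ler_poweR => //; rewrite in_itv/= ?leey ?andbT//.
exact: le_trans ab.
Qed.

Lemma poweRK (r : R) (a : \bar R) : 0 < r -> (0 <= a)%E -> ((a `^ r) `^ r^-1 = a)%E.
Proof. by move=> r0 a0; rewrite -poweRrM mulfV ?gt_eqF// poweRe1. Qed.

Lemma poweRVK (r : R) (a : \bar R) : 0 < r -> (0 <= a)%E -> ((a `^ r^-1) `^ r = a)%E.
Proof. by move=> r0 a0; rewrite -poweRrM mulVf ?gt_eqF// poweRe1. Qed.

Lemma le_poweR_root (p c : R) (a b : \bar R) : 0 < p -> 0 <= c ->
  (0 <= a)%E -> (0 <= b)%E -> (a `^ p <= c%:E * b `^ p)%E ->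
  (a <= (c `^ p^-1)%:E * b)%E.
Proof.
move=> p0 c0 a0 b0 ab; rewrite -(poweRK p0 a0).
apply: le_trans (le_poweR _ (poweR_ge0 _ _) ab) _; first by rewrite invr_ge0 ltW.
by rewrite poweRM ?poweR_ge0 ?lee_fin// poweRK// poweR_EFin.
Qed.

(** Running maxima turn the supremum into a monotone limit, as monotone convergence requires. *)
Lemma ereal_sup_poweR (u : nat -> R) (p : R) : 0 < p -> (forall n, 0 <= u n) ->
  (ereal_sup (range (fun n => (u n)%:E)) `^ p =
   ereal_sup (range (fun m => ((\big[Num.max/0%R]_(n < m.+1) u n) `^ p)%R%:E)))%E.
Proof.
move=> p0 u0; set S := ereal_sup _; set S' := ereal_sup (range (fun m : nat => _)).
have ubS n : ((u n)%:E <= S)%E by apply: ereal_sup_ubound; exists n.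
have ubS' m : ((((\big[Num.max/0]_(n < m.+1) u n) `^ p)%R)%:E <= S')%E.
  by apply: ereal_sup_ubound; exists m.
have S0 : (0 <= S)%E by apply: le_trans (ubS 0%N); rewrite lee_fin.
have S'0 : (0 <= S')%E by apply: le_trans (ubS' 0%N); rewrite lee_fin powR_ge0.
apply/eqP; rewrite eq_le; apply/andP; split.
  rewrite -[leRHS](poweRVK p0 S'0); apply: le_poweR => //; first exact: ltW.
  apply: ge_ereal_sup => _ [n _ <-].
  rewrite -[leLHS](poweRK p0) ?lee_fin//; apply: le_poweR.
  - by rewrite invr_ge0 ltW.
  - exact: poweR_ge0.
  rewrite poweR_EFin; apply: le_trans (ubS' n); rewrite lee_fin; apply: powR_le => //.
    exact: ltW.
  exact: (le_bigmax _ (fun i : 'I_n.+1 => u i) ord_max).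
apply: ge_ereal_sup => _ [m _ <-]; rewrite -poweR_EFin; apply: le_poweR.
- exact: ltW.
- by rewrite lee_fin bigmax_ge_id.
elim/big_ind: _ => // a b ha hb; rewrite /Num.max; by case: ifP.
Qed.

Lemma integral_ereal_sup d (T : measurableType d) (mu : {measure set T -> \bar R})
    (u : nat -> T -> \bar R) :
  (forall n, measurable_fun setT (u n)) -> (forall n x, 0 <= u n x)%E ->
  (forall x, {homo u^~ x : n m / (n <= m)%N >-> (n <= m)%E}) ->
  (\int[mu]_x ereal_sup (range (u^~ x)) = ereal_sup (range (fun n => \int[mu]_x u n x)))%E.
Proof.
move=> mu_ u0 hu.
have := @cvg_monotone_convergence _ _ _ mu setT measurableT u mu_ (fun n x _ => u0 n x) (fun x _ => hu x).
rewrite (_ : (fun x => limn (u^~ x)) = fun x => ereal_sup (range (u^~ x))); last first.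
  by apply/funext => x; apply/cvg_lim => //; exact: ereal_nondecreasing_cvgn.
move=> c; apply: (cvg_unique _ c); first exact: ereal_hausdorff.
apply: ereal_nondecreasing_cvgn => n m nm.
by apply: ge0_le_integral => // x _; exact: hu.
Qed.

Lemma measurable_ereal_sup d (T : measurableType d) (u : nat -> T -> \bar R) :
  (forall n, measurable_fun setT (u n)) ->
  measurable_fun setT (fun x => ereal_sup (range (u^~ x))).
Proof.
move=> mu_; have := measurable_fun_esups mu_ 0%N; congr (measurable_fun _ _).
apply/funext => x; rewrite /esups /sdrop; congr ereal_sup.
by apply/seteqP; split=> [_ [n _ <-]|_ [n _ <-]]; exists n.
Qed.

End Suprema.

Lemma powRK (R : realType) (q a : R) : 0 < q -> 0 <= a -> (a `^ q) `^ q^-1 = a.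
Proof. by move=> q0 a0; rewrite -powRrM mulfV ?gt_eqF// powRr1. Qed.

Lemma powRVK (R : realType) (q a : R) : 0 < q -> 0 <= a -> (a `^ q^-1) `^ q = a.
Proof. by move=> q0 a0; rewrite -powRrM mulVf ?gt_eqF// powRr1. Qed.

Lemma le_powR_root (R : realType) (p q a b c : R) : 0 < p -> 0 < q ->
  0 <= a -> 0 <= b -> 0 <= c -> a <= c * b ->
  (a `^ q^-1) `^ p <= ((c `^ q^-1) `^ p) * ((b `^ q^-1) `^ p).
Proof.
move=> p0 q0 a0 b0 c0 ab.
rewrite -(powRM p (powR_ge0 c _) (powR_ge0 b _)) -(powRM q^-1 c0 b0).
apply: powR_le; [exact: ltW|exact: powR_ge0|].
by apply: powR_le => //; rewrite invr_ge0 ltW.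
Qed.

Section HardyNorms.
Context {R : realType} {X : banachLatticeType R}.
Context (p q B : R) (p0 : 0 < p) (p1 : p <= 1) (q1 : 1 < q) (B0 : 0 < B).
Context (umd : umd_cube_bound X q B).
Implicit Types (F : nat -> measurableTypeR R -> X) (m : nat).

Let q0 : 0 < q. Proof. exact: lt_trans q1. Qed.

Let pN0 : p != 0. Proof. by rewrite gt_eqF. Qed.

Definition running_max F m x : R := \big[Num.max/0]_(n < m.+1) `|F n x|.

Definition random_norm (y : nat -> X) m : R := rq q m.+1 y `^ q^-1.

Lemma running_max_ge0 F m x : 0 <= running_max F m x.
Proof. exact: bigmax_ge_id. Qed.

Lemma random_norm_mono y n m : (n <= m)%N -> random_norm y n <= random_norm y m.
Proof.
move=> nm; apply: powR_le; [by rewrite invr_ge0 ltW|exact: rq_ge0|].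
exact: (rq_mono q1).
Qed.

Lemma rq_random_norm y m : rq q m.+1 y = ((random_norm y m `^ p) `^ p^-1) `^ q.
Proof.
by rewrite /random_norm (powRK p0 (powR_ge0 _ _)) (powRVK q0)// rq_ge0.
Qed.

Section Fixed.
Context F (dF : dyadic_sequence F).

Lemma step_running_max m : step m (fun x => running_max F m x `^ p).
Proof.
apply: (step_ext (F := F)) => [n _|x y Fxy]; first exact: step_dyadic.
by congr (_ `^ _); apply: eq_bigr => n _; rewrite Fxy// -ltnS.
Qed.

Lemma step_random_norm m : step m (fun x => random_norm (mdiff F ^~ x) m `^ p).
Proof.
apply: (step_mdiff dF (Phi := fun y => random_norm y m `^ p)) => y z yz.
rewrite /random_norm (@eq_rq _ _ q m.+1 y z)// => n; rewrite ltnS; exact: yz.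
Qed.

Lemma step_square_function m : step m (fun x => `|square_function F m x| `^ p).
Proof.
apply: (step_mdiff dF (Phi := fun y => `|lattice_l2 (fun n : 'I_m.+1 => y n)| `^ p)) => y z yz.
by congr (`| _ | `^ _); congr lattice_l2; apply/funext => n; rewrite yz// -ltnS.
Qed.

Let pw0 (a : R) : 0 <= a `^ p. Proof. exact: powR_ge0. Qed.

Let int_max m : (\int[lebI R]_x (running_max F m x `^ p)%:E =
  (avg (fun w : cube m => running_max F m (cpt w) `^ p))%:E)%E.
Proof. exact: (integral_step (step_running_max m) (fun _ => pw0 _)). Qed.

Let int_rad m : (\int[lebI R]_x (random_norm (mdiff F ^~ x) m `^ p)%:E =
  (avg (fun w : cube m => random_norm (mdiff F ^~ (cpt w)) m `^ p))%:E)%E.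
Proof. exact: (integral_step (step_random_norm m) (fun _ => pw0 _)). Qed.

Let int_sqf m : (\int[lebI R]_x (`|square_function F m x| `^ p)%:E =
  (avg (fun w : cube m => `|square_function F m (cpt w)| `^ p))%:E)%E.
Proof. exact: (integral_step (step_square_function m) (fun _ => pw0 _)). Qed.

Let avg_maximal m :
  avg (fun w => maximal (fun n (w : cube m) => mdiff F n (cpt w)) w `^ p) =
  avg (fun w : cube m => running_max F m (cpt w) `^ p).
Proof.
apply: eq_avg => w; congr (_ `^ p); apply: eq_bigr => n _.
exact: (congr1 (fun x => `|x|) (psum_mdiff F n w)).
Qed.

Let avg_radnorm m :
  avg (fun w => radnorm q (fun n (w : cube m) => mdiff F n (cpt w)) m w `^ p) =
  avg (fun w : cube m => random_norm (mdiff F ^~ (cpt w)) m `^ p).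
Proof. by apply: eq_avg => w; rewrite radnormN. Qed.

Lemma integral_max_le_random m :
  (\int[lebI R]_x (running_max F m x `^ p)%:E <=
   (2 `^ p * extrapolation_const p q * (1 + B))%:E *
   \int[lebI R]_x (random_norm (mdiff F ^~ x) m `^ p)%:E)%E.
Proof.
rewrite int_max int_rad -EFinM lee_fin -avg_maximal -avg_radnorm.
exact: (maximal_le_radnorm p0 p1 q1 B0 umd (mdiffs_dyadic dF m)).
Qed.

Lemma integral_random_le_max m :
  (\int[lebI R]_x (random_norm (mdiff F ^~ x) m `^ p)%:E <=
   ((2 `^ p * extrapolation_const p q * (1 + B)) *
    (2 `^ p * extrapolation_const p q * 2))%:E *
   \int[lebI R]_x (running_max F m x `^ p)%:E)%E.
Proof.
rewrite int_max int_rad -EFinM lee_fin -avg_maximal -avg_radnorm.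
exact: (radnorm_le_maximal p0 p1 q1 B0 umd (mdiffs_dyadic dF m)).
Qed.

Lemma integral_square_le_random m :
  (\int[lebI R]_x (`|square_function F m x| `^ p)%:E <=
   (((2 `^ q) `^ q^-1) `^ p)%:E *
   \int[lebI R]_x (random_norm (mdiff F ^~ x) m `^ p)%:E)%E.
Proof.
rewrite int_sqf int_rad -EFinM lee_fin -avgZ; apply: le_avg => w.
rewrite -(powRK q0 (normr_ge0 (square_function F m (cpt w)))).
apply: le_powR_root => //; first exact: rq_ge0.
exact: (lattice_l2_le_rq q1).
Qed.

Lemma integral_random_le_square m :
  (\int[lebI R]_x (random_norm (mdiff F ^~ x) m `^ p)%:E <=
   (((2 * (2 `^ q * B * 7 `^ q)) `^ q^-1) `^ p)%:E *
   \int[lebI R]_x (`|square_function F m x| `^ p)%:E)%E.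
Proof.
rewrite int_sqf int_rad -EFinM lee_fin -avgZ; apply: le_avg => w.
rewrite -(powRK q0 (normr_ge0 (square_function F m (cpt w)))).
apply: le_powR_root => //; first exact: rq_ge0.
  by rewrite !mulr_ge0 ?powR_ge0// ltW.
exact: (rq_le_lattice_l2 q1 B0 umd).
Qed.

Lemma Hm_norm_powR : (Hm_norm p F `^ p =
  ereal_sup (range (fun m => \int[lebI R]_x (running_max F m x `^ p)%:E)))%E.
Proof.
rewrite /Hm_norm (poweR_Lnorm _ _ pN0).
pose u m x := (running_max F m x `^ p)%R%:E.
rewrite -(@integral_ereal_sup R _ _ (lebI R) u).
- apply: eq_integral => x _.
  rewrite gee0_abs; last by apply: ereal_sup_ge; exists `|F 0%N x|%:E.
  by rewrite ereal_sup_poweR.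
- move=> m; apply: (measurable_step (N := m)).
  exact: (step_comp EFin (step_running_max m)).
- by move=> m x; rewrite lee_fin.
- move=> x n m nm; rewrite lee_fin; apply: powR_le; [exact: ltW|exact: running_max_ge0|].
  apply: bigmax_le => [|i _]; first exact: bigmax_ge_id.
  exact: (le_bigmax _ (fun i : 'I_m.+1 => `|F i x|) (widen_ord (nm : n < m.+1)%N i)).
Qed.

Lemma square_function_norm_powR m :
  ('N[lebI R]_p%:E[(fun x => `|square_function F m x|%:E)] `^ p =
   \int[lebI R]_x (`|square_function F m x| `^ p)%:E)%E.
Proof.
rewrite (poweR_Lnorm _ _ pN0); apply: eq_integral => x _.
by rewrite abse_EFin normr_id poweR_EFin.
Qed.

Lemma Hm_norm_ge0 : (0 <= Hm_norm p F)%E. Proof. exact: Lnorm_ge0. Qed.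

Lemma Hs_norm_ge0 : (0 <= Hs_norm p F)%E.
Proof. apply: le_trans (ereal_sup_ubound _); last by exists 0%N.
exact: Lnorm_ge0. Qed.

Lemma integral_max_le_Hm m :
  (\int[lebI R]_x (running_max F m x `^ p)%:E <= Hm_norm p F `^ p)%E.
Proof. by rewrite Hm_norm_powR; apply: ereal_sup_ubound; exists m. Qed.

Lemma Hm_norm_le (c : R) (a : \bar R) : 0 <= c -> (0 <= a)%E ->
  (forall m, \int[lebI R]_x (running_max F m x `^ p)%:E <= c%:E * a `^ p)%E ->
  (Hm_norm p F <= (c `^ p^-1)%:E * a)%E.
Proof.
move=> c0 a0 h; apply: le_poweR_root => //; first exact: Hm_norm_ge0.
by rewrite Hm_norm_powR; apply: ge_ereal_sup => _ [m _ <-].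
Qed.

End Fixed.

Lemma Hs_norm_le_Hm : exists2 C : R, 0 < C &
  forall F, dyadic_sequence F -> (Hs_norm p F <= C%:E * Hm_norm p F)%E.
Proof.
have e0 := extrapolation_const_gt0 p0 p1 q1.
set C1 := ((2 `^ q) `^ q^-1) `^ p.
pose C2 := (2 `^ p * extrapolation_const p q * (1 + B)) *
  (2 `^ p * extrapolation_const p q * 2).
have C1_gt0 : 0 < C1 by rewrite !powR_gt0.
have C2_gt0 : 0 < C2 by do !apply: mulr_gt0 => //; rewrite ?powR_gt0 ?addr_gt0.
exists ((C1 * C2) `^ p^-1) => [|F dF]; first by apply: powR_gt0; exact: mulr_gt0.
apply: ge_ereal_sup => _ [m _ <-].
apply: le_poweR_root => //; [by rewrite mulr_ge0// ltW|exact: Lnorm_ge0|exact: Hm_norm_ge0|].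
rewrite square_function_norm_powR; apply: le_trans (integral_square_le_random dF m) _.
rewrite [(C1 * C2)%:E]EFinM -muleA; apply: lee_wpmul2l; first by rewrite lee_fin ltW.
  apply: le_trans (integral_random_le_max dF m) _.
by apply: lee_wpmul2l; [rewrite lee_fin ltW|exact: integral_max_le_Hm].
Qed.

Lemma Hm_norm_le_Hs : exists2 C : R, 0 < C &
  forall F, dyadic_sequence F -> (Hm_norm p F <= C%:E * Hs_norm p F)%E.
Proof.
have e0 := extrapolation_const_gt0 p0 p1 q1.
pose C1 := 2 `^ p * extrapolation_const p q * (1 + B).
pose C2 := ((2 * (2 `^ q * B * 7 `^ q)) `^ q^-1) `^ p.
have C1_gt0 : 0 < C1 by do !apply: mulr_gt0 => //; rewrite ?powR_gt0 ?addr_gt0.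
have C2_gt0 : 0 < C2 by rewrite powR_gt0// powR_gt0// !mulr_gt0 ?powR_gt0.
exists ((C1 * C2) `^ p^-1) => [|F dF]; first by apply: powR_gt0; exact: mulr_gt0.
apply: Hm_norm_le => // [||m]; [by rewrite mulr_ge0// ltW|exact: Hs_norm_ge0|].
apply: le_trans (integral_max_le_random dF m) _.
rewrite [(C1 * C2)%:E]EFinM -muleA; apply: lee_wpmul2l; first by rewrite lee_fin ltW.
  apply: le_trans (integral_random_le_square dF m) _.
apply: lee_wpmul2l; first by rewrite lee_fin ltW.
rewrite -square_function_norm_powR; apply: le_poweR; [exact: ltW|exact: Lnorm_ge0|].
by apply: ereal_sup_ubound; exists m.
Qed.

End HardyNorms.

(** * Stopped martingales and approximation *)

Section StoppedMartingales.
Context {R : realType} {X : completeNormedModType R}.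
Local Notation I := (unitI R).
Implicit Types F : nat -> measurableTypeR R -> X.

Lemma bochner_integrable_sub d (T : measurableType d) (mu : {measure set T -> \bar R})
    (D : set T) (G G' : set (set T)) (f : T -> X) :
  G `<=` G' -> bochner_integrable mu D G f -> bochner_integrable mu D G' f.
Proof.
move=> GG' [[s [ss cs]] h]; split=> //; exists s; split=> // k.
by have [h1 h2] := ss k; split=> // v; exact: GG'.
Qed.

(** Tower property, by iterating the one-step condition; for [n > k] the function [F k] is its own
    conditional expectation. *)
Lemma dyadic_cond_exp F n k : dyadic_martingale F ->
  is_cond_exp (leb R) I (Delta R n) (F k) (F (minn n k)).
Proof.
move=> [_ [Fi Fc]]; split.
- by apply: bochner_integrable_sub (Fi k) => A; exact: Delta_measurable.
- by apply: bochner_integrable_sub (Fi _) => A; apply: Delta_mono; exact: geq_minl.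
move=> A nA; have [nk|kn] := leqP n k; last by [].
rewrite -(subnK nk); elim: (k - n)%N => [|i ih]; first by rewrite add0n.
rewrite ih addSn; have [_ _ h] := Fc (i + n)%N; apply: h.
by apply: Delta_mono nA; exact: leq_addl.
Qed.

Definition stop N F n := F (minn n N).

Lemma dyadic_martingale_stop N F : dyadic_martingale F -> dyadic_martingale (stop N F).
Proof.
move=> dF; have [F0 [Fi _]] := dF; split; first by move=> n x; exact: F0.
split=> n; first by have [_ h _] := dyadic_cond_exp n N dF.
have := dyadic_cond_exp n (minn n.+1 N) dF.
by rewrite minnA (minn_idPl (leqnSn n)).
Qed.

Lemma L1_martingale_stop N F : dyadic_martingale F -> L1_martingale (stop N F).
Proof.
move=> dF; split; first exact: dyadic_martingale_stop.
by exists (F N) => n; exact: dyadic_cond_exp.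
Qed.

Lemma mdiff_stop N F n x :
  mdiff (fun n x => F n x - stop N F n x) n x = mask (ltn N) (mdiff F ^~ x) n.
Proof.
rewrite /mask /stop; case: n => [|n] /=; first by rewrite min0n subrr.
rewrite ltnS; have [Nn|nN] := leqP N n.
  by rewrite (minn_idPr (leqW Nn)) opprB addrA subrK.
by rewrite (minn_idPl nN) !subrr.
Qed.

End StoppedMartingales.

Section Approximation.
Context {R : realType} {X : banachLatticeType R}.
Context (p q B : R) (p0 : 0 < p) (p1 : p <= 1) (q1 : 1 < q) (B0 : 0 < B).
Context (umd : umd_cube_bound X q B).
Context (F : nat -> measurableTypeR R -> X) (dF : dyadic_martingale F).
Context (F_fin : (Hm_norm p F < +oo)%E).

Let q0 : 0 < q. Proof. exact: lt_trans q1. Qed.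

Let sF : dyadic_sequence F. Proof. exact: dyadic_martingale_sequence. Qed.

Lemma Hm_norm_stop N : (Hm_norm p (stop N F) <= Hm_norm p F)%E.
Proof.
have sH := dyadic_martingale_sequence (dyadic_martingale_stop N dF).
have e1 : (1 `^ p^-1)%R%:E = 1%E :> \bar R by rewrite powR1.
rewrite -[leRHS]mul1e -[X in (X * _)%E]e1.
apply: (Hm_norm_le p0 sH); [exact: ler01|exact: Hm_norm_ge0|move=> m].
rewrite mul1e; apply: le_trans (integral_max_le_Hm p0 sF m).
rewrite (integral_step (step_running_max p sH m) (fun _ => powR_ge0 _ _)).
rewrite (integral_step (step_running_max p sF m) (fun _ => powR_ge0 _ _)) lee_fin.
apply: le_avg => w; apply: powR_le; [exact: ltW|exact: running_max_ge0|].
apply: bigmax_le => [|i _]; first exact: running_max_ge0.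
have im : (minn i N < m.+1)%N by rewrite (leq_ltn_trans (geq_minl _ _)).
exact: (le_bigmax _ (fun i : 'I_m.+1 => `|F i (cpt w)|) (Ordinal im)).
Qed.

Let tail N m x : \bar R := (random_norm q (mask (ltn N) (mdiff F ^~ x)) m `^ p)%:E.
Let sup_tail N x := ereal_sup (range (fun m => tail N m x)).
Let full m x : \bar R := (random_norm q (mdiff F ^~ x) m `^ p)%:E.
Let sup_full x := ereal_sup (range (fun m => full m x)).

Let tail_le_sup N m x : (tail N m x <= sup_tail N x)%E.
Proof. by apply: ereal_sup_ubound; exists m. Qed.

Let remainder N n x := F n x - stop N F n x.

Let dyadic_remainder N : dyadic_sequence (remainder N).
Proof.
apply: dyadic_sequenceB => //; apply: dyadic_martingale_sequence.
exact: dyadic_martingale_stop.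
Qed.

Let tailE N m x : tail N m x =
  (random_norm q (mdiff (remainder N) ^~ x) m `^ p)%:E.
Proof.
rewrite /tail; congr ((random_norm q _ m `^ p)%:E).
by apply/funext => n; rewrite -mdiff_stop.
Qed.

Let measurable_random (G : nat -> measurableTypeR R -> X) m : dyadic_sequence G ->
  measurable_fun setT (fun x => (random_norm q (mdiff G ^~ x) m `^ p)%:E).
Proof.
move=> dG; apply: (measurable_step (N := m)).
exact: (step_comp EFin (step_random_norm p q dG m)).
Qed.

Let random_mono (y : nat -> X) : {homo (fun m => (random_norm q y m `^ p)%:E) :
  n m / (n <= m)%N >-> (n <= m)%E}.
Proof.
move=> n m nm; rewrite lee_fin; apply: powR_le; [exact: ltW|exact: powR_ge0|].
exact: random_norm_mono.
Qed.

Let measurable_tail N m : measurable_fun setT (tail N m).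
Proof.
have -> : tail N m = fun x => (random_norm q (mdiff (remainder N) ^~ x) m `^ p)%:E.
  by apply/funext => x; exact: tailE.
exact: measurable_random.
Qed.

Let sup_tail_ge0 N x : (0 <= sup_tail N x)%E.
Proof.
by apply: le_trans (ereal_sup_ubound _); last (by exists 0%N); rewrite lee_fin powR_ge0.
Qed.

Let sup_tail_le N x : (sup_tail N x <= sup_full x)%E.
Proof.
apply: ge_ereal_sup => _ [m _ <-]; apply: le_trans (ereal_sup_ubound _); last by exists m.
rewrite lee_fin; apply: powR_le; [exact: ltW|exact: powR_ge0|].
apply: powR_le; [by rewrite invr_ge0 ltW|exact: rq_ge0|exact: rq_mask].
Qed.

(** Random norms increase with [m], so monotone convergence turns bounds uniform in [m] into
    integrability of the supremum, the dominating function below. *)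
Let integrable_full : (lebI R).-integrable setT sup_full.
Proof.
apply/integrableP; split.
  by apply: measurable_ereal_sup => m; exact: measurable_random.
rewrite (eq_integral sup_full); last first.
  by move=> x _; rewrite gee0_abs// (le_trans (sup_tail_ge0 0%N x) (sup_tail_le 0%N x)).
rewrite integral_ereal_sup; last 3 first.
- by move=> m; exact: measurable_random.
- by move=> m x; rewrite lee_fin powR_ge0.
- by move=> x; exact: random_mono.
set C := ((2 `^ p * extrapolation_const p q * (1 + B)) *
    (2 `^ p * extrapolation_const p q * 2)).
have e0 := extrapolation_const_gt0 p0 p1 q1.
have C0 : 0 < C by do !apply: mulr_gt0 => //; rewrite ?powR_gt0 ?addr_gt0.
apply: (@le_lt_trans _ _ (C%:E * Hm_norm p F `^ p)%E); last first.
  by apply: lte_mul_pinfty; [rewrite lee_fin ltW| |exact: poweR_lty].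
apply: ge_ereal_sup => _ [m _ <-].
apply: le_trans (integral_random_le_max p0 p1 q1 B0 umd sF m) _.
by apply: lee_wpmul2l; [rewrite lee_fin ltW|exact: integral_max_le_Hm].
Qed.

(** A finite [sup_full x] bounds all Rademacher sums of the differences at [x], and [rq_tail] makes
    their tails small uniformly in [m]. The power [q / p] of [e] is the threshold [e] expressed on
    the scale of [rq]. *)
Let cvg_sup_tail x : sup_full x \is a fin_num -> sup_tail N x @[N --> \oo] --> 0%E.
Proof.
move=> fx; set y := mdiff F ^~ x.
have fN N : sup_tail N x \is a fin_num.
  rewrite ge0_fin_numE//; apply: le_lt_trans (sup_tail_le N x) _.
  by rewrite ltey_eq fx.
apply/fine_cvgP; split; first by apply: nearW; exact: fN.
apply/cvgrPdist_le => e e0.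
pose C := (fine (sup_full x) `^ p^-1) `^ q.
have yC m : rq q m y <= C.
  apply: le_trans (rq_mono q1 y (leqnSn m)) _.
  rewrite (rq_random_norm p0 q1).
  apply: powR_le; [exact: ltW|exact: powR_ge0|].
  apply: powR_le; [by rewrite invr_ge0 ltW|exact: powR_ge0|].
  by rewrite -lee_fin fineK//; apply: ereal_sup_ubound; exists m.
have d0 : 0 < (e `^ p^-1) `^ q by rewrite !powR_gt0.
have [N0 hN0] := rq_tail q1 B0 umd d0 yC.
near=> N.
have N0N : (N0 <= N)%N by near: N; exact: nbhs_infty_ge.
change (`|0 - fine (sup_tail N x)| <= e).
rewrite sub0r normrN (ger0_norm (fine_ge0 (sup_tail_ge0 N x))) -lee_fin (fineK (fN N)).
apply: ge_ereal_sup => _ [m _ <-]; rewrite lee_fin.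
have h : rq q m.+1 (mask (ltn N) y) <= (e `^ p^-1) `^ q.
  apply: le_trans (hN0 m.+1).
  have -> : mask (ltn N) y = mask (ltn N) (mask (leq N0) y).
    apply/funext => n; rewrite /mask /=; case: ltnP => // Nn.
    by rewrite (leq_trans N0N (ltnW Nn)).
  exact: rq_mask.
have e' : ((((e `^ p^-1) `^ q) `^ q^-1) `^ p) = e.
  exact: etrans (congr1 (fun a => a `^ p) (powRK q0 (powR_ge0 e p^-1)))
    (powRVK p0 (ltW e0)).
rewrite -[leRHS]e'; apply: powR_le; [exact: ltW|exact: powR_ge0|].
by apply: powR_le; [rewrite invr_ge0 ltW|exact: rq_ge0|].
Unshelve. all: by end_near.
Qed.

Let cvg_integral_tail : (\int[lebI R]_x sup_tail N x)%E @[N --> \oo] --> 0%E.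
Proof.
have [] := @dominated_convergence _ _ R (lebI R) setT measurableT sup_tail (cst 0%E) sup_full.
- by move=> N; exact: measurable_ereal_sup.
- exact: measurable_cst.
(* An integrable function is finite almost everywhere, which is what [cvg_sup_tail] asks for. *)
- apply: filterS (integrable_ae measurableT integrable_full) => x h _.
  by apply: cvg_sup_tail; exact: h.
- exact: integrable_full.
- by apply: filterE => x N _; rewrite gee0_abs.
by move=> _ _; rewrite integral0.
Qed.

Lemma Hm_norm_approx (e : R) : 0 < e -> exists N,
  (Hm_norm p (fun n x => (F n x - stop N F n x)%R) < e%:E)%E.
Proof.
move=> e0; set C := 2 `^ p * extrapolation_const p q * (1 + B).
have C0 : 0 < C.
  have c0 := extrapolation_const_gt0 p0 p1 q1.
  by do !apply: mulr_gt0 => //; rewrite ?powR_gt0 ?addr_gt0.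
have Cp0 : 0 < C `^ p^-1 by rewrite powR_gt0.
(* Cancels the constant of the maximal inequality, so that the final bound is [e / 2]. *)
pose t := (C `^ p^-1)^-1 * (e / 2).
have t0 : 0 < t by rewrite mulr_gt0 ?invr_gt0 ?divr_gt0.
have /fine_cvgP[fin /cvgrPdist_le/(_ _ (powR_gt0 p t0)) cv] := cvg_integral_tail.
have [N [fN hN]] : exists N, (\int[lebI R]_x sup_tail N x)%E \is a fin_num /\
    `|0 - fine (\int[lebI R]_x sup_tail N x)%E| <= t `^ p.
  by have [N _ h] := filterI fin cv; exists N; apply: h => /=.
exists N; apply: (@le_lt_trans _ _ ((C `^ p^-1)%:E * t%:E)%E); last first.
  by rewrite -EFinM lte_fin mulVKf ?gt_eqF//; lra.
apply: (Hm_norm_le p0 (dyadic_remainder N)) => [||m]; rewrite ?lee_fin; [exact: ltW|exact: ltW|].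
apply: le_trans (integral_max_le_random p0 p1 q1 B0 umd (dyadic_remainder N) m) _.
apply: lee_wpmul2l; first by rewrite lee_fin ltW.
rewrite poweR_EFin.
apply: (@le_trans _ _ (\int[lebI R]_x sup_tail N x)%E); last first.
  by rewrite -(fineK fN) lee_fin; apply: le_trans hN; rewrite sub0r normrN ler_norm.
apply: ge0_le_integral => //.
- by move=> x _; rewrite lee_fin powR_ge0.
- exact: measurable_random.
- exact: measurable_ereal_sup.
- move=> x _; have <- := tailE N m x; exact: tail_le_sup.
Qed.

End Approximation.

Theorem corollary3p13 (R : realType) (X : banachLatticeType R) (hX : UMD X)
    (p : R) (hp0 : 0 < p) (hp1 : p <= 1) :
  [/\ @Hs R X p = @Hm R X p,
      @Hm R X p = @Hm0 R X p
    & equivalent_quasinorms (@Hs R X p) (@Hs_norm R X p) (@Hm_norm R X p)].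
Proof.
have [q q1 [B B0 umd]] := umd_cube hX.
have [C C0 hC] := Hs_norm_le_Hm hp0 hp1 q1 B0 umd.
have [C' C'0 hC'] := Hm_norm_le_Hs hp0 hp1 q1 B0 umd.
split.
- apply/seteqP; split=> F [dF hF]; split=> //; have sF := dyadic_martingale_sequence dF.
    apply: le_lt_trans (hC' F sF) _.
    by rewrite lte_mul_pinfty ?lee_fin ?(ltW C'0).
  apply: le_lt_trans (hC F sF) _.
  by rewrite lte_mul_pinfty ?lee_fin ?(ltW C0).
- apply/seteqP; split=> F; last by case.
  move=> HF; split=> // e e0; have [dF hF] := HF.
  have [N hN] := Hm_norm_approx hp0 hp1 q1 B0 umd dF hF e0.
  exists (stop N F); last exact: hN.
  split; last exact: L1_martingale_stop.
  split; first exact: dyadic_martingale_stop.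
  exact: le_lt_trans (Hm_norm_stop hp0 dF N) hF.
exists C^-1, C'; split=> //; first by rewrite invr_gt0.
move=> F [dF _]; have sF := dyadic_martingale_sequence dF; split; last exact: hC'.
by rewrite muleC lee_pdivrMr// muleC; exact: hC.
Qed.
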